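(* Let $p\ge5$, let $\lambda=\lambda_j$ be a simple eigenvalue, and let $\delta_2,\Lambda_{\rm qo},\Lambda_{\rm sep}>0$ be constants such that properties (i)–(iv) of the context hold for all $\mathcal T\in\mathbb T(\delta_2)$. Then there exists a constant $\Lambda_2>0$ such that for every $\mathcal T\in\mathbb T(\delta_2)$ and every refinement $\widehat{\mathcal T}\in\mathbb T$ of $\mathcal T$, the error estimators $\eta$ on $\mathcal T$ and $\widehat\eta$ on $\widehat{\mathcal T}$ satisfy (reduction) $$\widehat\eta(\widehat{\mathcal T}\setminus\mathcal T)\le2^{-1/4}\,\eta(\mathcal T\setminus\widehat{\mathcal T})+\Lambda_2\,|||\widehat u_h-u_h|||.$$
   Context: Continuous problem. $\Omega\subset\mathbb R^2$ is a bounded Lipschitz domain with polygonal boundary, $V:=H^2_0(\Omega)$, $a(u,v):=\int_\Omega D^2u:D^2v\,dx$ with norm $|||v|||:=a(v,v)^{1/2}$ on $V$, and $b(u,v):=\int_\Omega uv\,dx$ with norm $\|v\|:=\|v\|_{L^2(\Omega)}$. The eigenvalues $0<\lambda_1\le\lambda_2\le\dots\to\infty$ of $a(u,v)=\lambda b(u,v)$ for all $v\in V$ are enumerated with multiplicity, $\lambda_0:=0$. $j\in\mathbb N$ is fixed, $\lambda=\lambda_j$ is simple, and $u\in V$ with $\|u\|=1$ is a fixed corresponding eigenvector. Triangulations. $\mathbb T$ is the set of all regular triangulations of $\Omega$ obtained by newest-vertex bisection (NVB) from a fixed initial triangulation $\mathcal T_{\rm init}$ (hence uniformly shape-regular); $\mathbb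 T(\delta)$ is the subset of those with maximal triangle diameter $h_{\max}\le\delta$. Triangulations are sets of triangles, so $\mathcal T\setminus\widehat{\mathcal T}$ is the set of coarse but not fine triangles and $\widehat{\mathcal T}\setminus\mathcal T$ the set of fine but not coarse triangles. Discrete spaces (hierarchical Argyris spaces). $A_p(\mathcal T)$ is the set of all $v_h\in V$ that are polynomials of degree at most $p$ on every triangle of $\mathcal T$ and whose Hessian is continuous at every vertex of $\mathcal T$. For a sequence $\mathcal T_{\rm init}=\mathcal S_0,\dots,\mathcal S_m=\mathcal T$ of successive one-level NVB refinements (each triangle is divided into at most four sub-triangles by bisection of refinement edges), $V(\mathcal T):=A_p(\mathcal S_0)+\dots+A_p(\mathcal S_m)$; this depends only on $\mathcal T$, and $V(\mathcal T)\subset V(\widehat{\mathcal T})\subset V$ for refinements $\widehat{\mathcal T}$ of $\mathcal T$. Discrete problem. With $N=\dim V(\mathcal T)$, let $0<\lambda_h^{(1)}\le\dots\le\lambda_h^{(N)}$ be the discrete eigenvalues, counted with multiplicity, of $a(u_h,v_h)=\lambda_hb(u_h,v_h)$ for all $v_h\in V(\mathcal T)$, with $u_h\in V(\mathcal T)$, $\|u_h\|=1$; $\lambda_h^{(0)}:=0$ and $\lambda_h^{(k)}:=\infty$ for $k>N$. $(\lambda_h,u_h)$ is the discrete eigenpair number $j$ on $\mathcal T$ with $b(u,u_h)\ge0$; $(\widehat\lambda_h,\widehat u_h)$ denotes the same for $\widehat{\mathcal T}$. Properties for $\mathcal T\in\mathbb T(\delta_2)$: (i) $\dim V(\mathcal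 T)\ge j$ and ${\rm LB}:=|||u-u_h|||^2+\lambda_h-\lambda+\|u-u_h\|^2\le\Lambda_{\rm qo}\min_{v_h\in V(\mathcal T)}|||u-v_h|||^2$; (ii) ${\rm LB}<1/2$; (iii) $\lambda_{j-1}\le\lambda_h^{(j-1)}<\lambda_j\le\lambda_h^{(j)}<\lambda_{j+1}\le\lambda_h^{(j+1)}$; (iv) $\max\bigl\{\lambda_j/(\lambda_j-\lambda_h^{(j-1)}),\ \lambda_h^{(j)}/(\lambda_h^{(j+1)}-\lambda_h^{(j)})\bigr\}\le\Lambda_{\rm sep}$. Error estimators. For $T\in\mathcal T$ with area $|T|$, $$\eta^2(T)=|T|^2\|\lambda_hu_h-\Delta^2u_h\|_{L^2(T)}^2+|T|^{1/2}\|[\partial^2_{\nu\nu}u_h]_E\|^2_{L^2(\partial T\cap\Omega)}+|T|^{3/2}\|[\partial_\nu\Delta u_h]_E\|^2_{L^2(\partial T\cap\Omega)},$$ where $[\bullet]_E$ is the jump across interior edges $E$ and $\nu$ is a unit normal of the edge. For $T\in\widehat{\mathcal T}$, $\widehat\eta^2(T)$ is defined by the same formula with $(\widehat\lambda_h,\widehat u_h)$ and the edges of $\widehat{\mathcal T}$. For a set $\mathcal M$ of triangles, $\eta(\mathcal M):=(\sum_{T\in\mathcal M}\eta^2(T))^{1/2}$, and analogously for $\widehat\eta$. The constant $\Lambda_2$ is independent of $\mathcal T$ and $\widehat{\mathcal T}$. *)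

(* Defs.v *)
From HB Require Import structures.
From mathcomp Require Import all_boot all_order all_algebra.
From mathcomp Require Import finmap.
From mathcomp Require Import all_classical all_reals all_analysis.
From Stdlib Require Import Relation_Operators.

Set Implicit Arguments.
Unset Strict Implicit.
Unset Printing Implicit Defensive.

Import Order.TTheory GRing.Theory Num.Theory.
Import numFieldNormedType.Exports.

Local Open Scope classical_set_scope.
Local Open Scope ring_scope.

Notation point2 R := (R * R)%type.
Notation fun2 R := (R * R -> R).

(* The library norm on [R * R] is the maximum norm, hence the separate
   Euclidean distance. *)
Definition edist (R : realType) (x y : point2 R) : R :=
  Num.sqrt ((x.1 - y.1) ^+ 2 + (x.2 - y.2) ^+ 2).

Definition basis_vec (R : realType) (i : 'I_2) : point2 R :=
  ((i == 0%N :> nat)%:R, (i == 1%N :> nat)%:R).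

(* Iterated classical partial derivative along the multi-index [l]. *)
Definition partial (R : realType) (l : seq 'I_2) (f : fun2 R) : fun2 R :=
  foldr (fun i g => 'D_(basis_vec R i) g) f l.

(* [measurableTypeR R] is [R] with the Borel sigma-algebra in the form in which
   the library equips it with Lebesgue measure. *)
Notation mpoint2 R := (measurableTypeR R * measurableTypeR R)%type.

Definition leb2 (R : realType) : {measure set (mpoint2 R) -> \bar R} :=
  (@lebesgue_measure R \x @lebesgue_measure R)%E.

Definition int2 (R : realType) (D : set (point2 R)) (f : fun2 R) : R :=
  (\int[@leb2 R]_(x in D) f x)%R.

Definition hull (R : realType) (s : seq (point2 R)) : set (point2 R) :=
  [set x | exists w : 'I_(size s) -> R,
     [/\ forall i, 0 <= w i, \sum_i w i = 1 & x = \sum_i w i *: s`_i]].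

Definition boundary (R : realType) (A : set (point2 R)) : set (point2 R) :=
  closure A `\` interior A.

(* In a suitable Cartesian coordinate system (s, t) centred at any boundary
   point, [Omega] is locally the strict epigraph of a Lipschitz function. *)
Definition lipschitz_boundary (R : realType) (Omega : set (point2 R)) : Prop :=
  forall x, boundary Omega x ->
  exists (d : point2 R) (r h L : R) (g : R -> R),
    [/\ d.1 ^+ 2 + d.2 ^+ 2 = 1, 0 < r, 0 < h,
        forall s s', `|g s - g s'| <= L * `|s - s'| &
        g 0 = 0 /\
        forall s t, `|s| < r -> `|t| < h ->
          Omega (x.1 - s * d.2 + t * d.1, x.2 + s * d.1 + t * d.2) <-> g s < t].

Definition polygonal_boundary (R : realType) (Omega : set (point2 R)) : Prop :=
  exists segs : seq (point2 R * point2 R),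
    boundary Omega = [set x | exists2 e, e \in segs & hull [:: e.1; e.2] x].

Definition polygonal_lipschitz_domain (R : realType) (Omega : set (point2 R))
    : Prop :=
  [/\ Omega !=set0 /\ open Omega, connected Omega, bounded_set Omega,
      lipschitz_boundary Omega & polygonal_boundary Omega].

Fixpoint Ck (R : realType) (k : nat) (f : fun2 R) : Prop :=
  continuous f /\
  if k is k'.+1 then
    forall i, (forall x, derivable f x (basis_vec R i)) /\
              Ck k' ('D_(basis_vec R i) f)
  else True.

Definition test_function (R : realType) (Omega : set (point2 R)) (f : fun2 R)
    : Prop :=
  (forall k, Ck k f) /\
  exists K : set (point2 R),
    [/\ compact K, K `<=` Omega & forall x, ~ K x -> f x = 0].

Definition L2 (R : realType) (Omega : set (point2 R)) (f : fun2 R) : Prop :=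
  measurable_fun (Omega : set (mpoint2 R)) f /\
  (\int[@leb2 R]_(x in Omega) ((f x) ^+ 2)%:E < +oo)%E.

Definition weak_partial (R : realType) (Omega : set (point2 R))
    (l : seq 'I_2) (v g : fun2 R) : Prop :=
  L2 Omega g /\
  forall phi, test_function Omega phi ->
    int2 Omega (v \* partial l phi) = (-1) ^+ size l * int2 Omega (g \* phi).

(* A representative of the weak derivative; it is unique almost everywhere. *)
Definition wD (R : realType) (Omega : set (point2 R)) (l : seq 'I_2)
    (v : fun2 R) : fun2 R :=
  get [set g | weak_partial Omega l v g].

Definition H2 (R : realType) (Omega : set (point2 R)) (v : fun2 R) : Prop :=
  L2 Omega v /\
  forall l : seq 'I_2, (size l <= 2)%N -> exists g, weak_partial Omega l v g.

(* The closure of the test functions in the norm of H^2; the elements are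
   represented by functions on the plane that vanish outside [Omega]. *)
Definition H20 (R : realType) (Omega : set (point2 R)) (v : fun2 R) : Prop :=
  [/\ H2 Omega v, forall x, ~ Omega x -> v x = 0 &
      exists phi : nat -> fun2 R,
        (forall n, test_function Omega (phi n)) /\
        forall l : seq 'I_2, (size l <= 2)%N ->
          int2 Omega (fun x => (wD Omega l v x - partial l (phi n) x) ^+ 2)
            @[n --> \oo] --> (0 : R)].

Definition form_a (R : realType) (Omega : set (point2 R)) (u v : fun2 R) : R :=
  int2 Omega (fun x => \sum_(i < 2) \sum_(k < 2)
                         wD Omega [:: i; k] u x * wD Omega [:: i; k] v x).

Definition form_b (R : realType) (Omega : set (point2 R)) (u v : fun2 R) : R :=
  int2 Omega (u \* v).

Definition energy_norm (R : realType) (Omega : set (point2 R)) (v : fun2 R)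
    : R := Num.sqrt (form_a Omega v v).

Definition L2_norm (R : realType) (D : set (point2 R)) (v : fun2 R) : R :=
  Num.sqrt (int2 D (v \* v)).

Definition eigen (R : realType) (Omega : set (point2 R)) (W : set (fun2 R))
    (mu : R) (w : fun2 R) : Prop :=
  W w /\ forall v, W v -> form_a Omega w v = mu * form_b Omega w v.

(* The family [mu], indexed by [K], lists every eigenvalue of the pair (a, b)
   on [W] as often as its multiplicity: the eigenspace of each real [t] has
   (up to equality almost everywhere) an orthonormal basis indexed by
   { k in K | mu k = t }. *)
Definition eigenvalue_family (R : realType) (Omega : set (point2 R))
    (W : set (fun2 R)) (K : pred nat) (mu : nat -> R) : Prop :=
  exists e : nat -> fun2 R,
    [/\ forall k, K k -> eigen Omega W (mu k) (e k),
        forall k l, K k -> K l -> form_b Omega (e k) (e l) = (k == l)%:R &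
        forall t w, eigen Omega W t w ->
          exists (n : nat) (c : nat -> R),
            {ae @leb2 R, forall x, Omega x ->
               w x = \sum_(k < n | K k && (mu k == t)) c k * e k x}].

Definition spectrum (R : realType) (Omega : set (point2 R)) (lam : nat -> R)
    : Prop :=
  [/\ lam 0%N = 0, 0 < lam 1%N,
      forall k l, (0 < k <= l)%N -> lam k <= lam l,
      lam @ \oo --> +oo &
      eigenvalue_family Omega (H20 Omega) (fun k => 0 < k)%N lam].

Definition simple_eigenvalue (R : realType) (lam : nat -> R) (j : nat) : Prop :=
  forall k, (0 < k)%N -> lam k = lam j -> k = j.

Definition has_dim (R : realType) (W : set (fun2 R)) (N : nat) : Prop :=
  exists e : 'I_N -> fun2 R,
    (forall v, W v <-> exists c : 'I_N -> R, forall x, v x = \sum_i c i * e i x)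
    /\ forall c : 'I_N -> R,
         (forall x, \sum_i c i * e i x = 0) -> forall i, c i = 0.

Definition discrete_spectrum (R : realType) (Omega : set (point2 R))
    (W : set (fun2 R)) (N : nat) (lamh : nat -> \bar R) : Prop :=
  [/\ has_dim W N,
      lamh 0%N = 0%E,
      forall k, (N < k)%N -> lamh k = +oo%E,
      forall k, (0 < k <= N)%N -> (0 < lamh k < +oo)%E &
      (forall k l, (0 < k <= l)%N -> (lamh k <= lamh l)%E) /\
      eigenvalue_family Omega W (fun k => 0 < k <= N)%N (fine \o lamh)].

(* The triangle ((z0, z1), z2) is the convex hull of its vertices, z2 is the
   newest vertex and [z0, z1] the refinement edge.  The labels of all triangles
   that arise by bisection are determined by those of the initial
   triangulation, so that, within the bisection tree, equality of labelled
   triangles is equality of triangles. *)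
Notation triangle R := (point2 R * point2 R * point2 R)%type.

Definition vertices (R : realType) (T : triangle R) : seq (point2 R) :=
  [:: T.1.1; T.1.2; T.2].

Definition edges (R : realType) (T : triangle R) : seq (point2 R * point2 R) :=
  [:: (T.1.1, T.1.2); (T.1.2, T.2); (T.2, T.1.1)].

Definition closed_triangle (R : realType) (T : triangle R) : set (point2 R) :=
  hull (vertices T).

Definition area (R : realType) (T : triangle R) : R :=
  `|(T.1.2.1 - T.1.1.1) * (T.2.2 - T.1.1.2)
    - (T.2.1 - T.1.1.1) * (T.1.2.2 - T.1.1.2)| / 2.

Definition midpoint (R : realType) (x y : point2 R) : point2 R :=
  2^-1 *: (x + y).

Definition child1 (R : realType) (T : triangle R) : triangle R :=
  (T.2, T.1.1, midpoint T.1.1 T.1.2).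

Definition child2 (R : realType) (T : triangle R) : triangle R :=
  (T.1.2, T.2, midpoint T.1.1 T.1.2).

Definition bisection_step (R : realType) (A B : {fset triangle R}) : Prop :=
  exists2 T, T \in A & B = (A `\ T `|` [fset child1 T; child2 T])%fset.

Definition nvb_refinement (R : realType) :
    {fset triangle R} -> {fset triangle R} -> Prop :=
  clos_refl_trans _ (@bisection_step R).

Definition regular_triangulation (R : realType) (Omega : set (point2 R))
    (A : {fset triangle R}) : Prop :=
  [/\ forall T, T \in A -> 0 < area T,
      closure Omega = [set x | exists2 T, T \in A & closed_triangle T x] &
      forall T T', T \in A -> T' \in A -> T != T' ->
        exists s : seq (point2 R),
          [/\ (size s <= 2)%N, {subset s <= vertices T},
              {subset s <= vertices T'} &
              closed_triangle T `&` closed_triangle T' = hull s]].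

Definition triangulations (R : realType) (Omega : set (point2 R))
    (Tinit : {fset triangle R}) : set {fset triangle R} :=
  [set A | nvb_refinement Tinit A /\ regular_triangulation Omega A].

Definition fine_triangulations (R : realType) (Omega : set (point2 R))
    (Tinit : {fset triangle R}) (delta : R) : set {fset triangle R} :=
  [set A | triangulations Omega Tinit A /\
     forall T, T \in A -> forall x y, closed_triangle T x ->
       closed_triangle T y -> edist x y <= delta].

(* The admissible subdivisions of a triangle in one level: each of its edges is
   bisected at most once. *)
Definition one_level_splits (R : realType) (T : triangle R)
    : seq {fset triangle R} :=
  [:: [fset T];
      [fset child1 T; child2 T];
      [fset child1 (child1 T); child2 (child1 T); child2 T];
      [fset child1 T; child1 (child2 T); child2 (child2 T)];
      [fset child1 (child1 T); child2 (child1 T);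
            child1 (child2 T); child2 (child2 T)]]%fset.

Definition one_level_refinement (R : realType) (A B : {fset triangle R})
    : Prop :=
  exists f : triangle R -> {fset triangle R},
    (forall T, T \in A -> f T \in one_level_splits T) /\
    forall T', T' \in B <-> exists2 T, T \in A & T' \in f T.

Definition polynomial2 (R : realType) (p : nat) (q : fun2 R) : Prop :=
  exists c : nat -> nat -> R, forall x,
    q x = \sum_(i < p.+1) \sum_(k < p.+1 | (i + k <= p)%N)
            c i k * x.1 ^+ i * x.2 ^+ k.

(* The polynomial that coincides with [v] on the triangle [T].  Derivatives and
   traces of a piecewise polynomial on [T] are those of this polynomial. *)
Definition piece (R : realType) (v : fun2 R) (T : triangle R) : fun2 R :=
  get [set q : fun2 R | (exists p, polynomial2 p q) /\
                        forall x, closed_triangle T x -> v x = q x].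

(* Continuity of the Hessian at a vertex of the triangulation: the Hessians of
   the pieces on all triangles that meet at this vertex agree there. *)
Definition argyris (R : realType) (Omega : set (point2 R)) (p : nat)
    (A : {fset triangle R}) : set (fun2 R) :=
  [set v | [/\ H20 Omega v,
     forall T, T \in A -> exists2 q, polynomial2 p q &
       forall x, closed_triangle T x -> v x = q x &
     forall T T' z, T \in A -> T' \in A ->
       z \in vertices T -> z \in vertices T' ->
       forall i k : 'I_2,
         partial [:: i; k] (piece v T) z = partial [:: i; k] (piece v T') z]].

Definition level_sequence (R : realType) (Omega : set (point2 R))
    (Tinit A : {fset triangle R}) (m : nat) (S : nat -> {fset triangle R})
    : Prop :=
  [/\ S 0%N = Tinit, S m = A,
      forall k, (k <= m)%N -> triangulations Omega Tinit (S k) &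
      forall k, (k < m)%N -> one_level_refinement (S k) (S k.+1)].

(* The sum of the Argyris spaces does not depend on the sequence of one-level
   refinements from [Tinit] to [A]. *)
Definition hierarchical_argyris (R : realType) (Omega : set (point2 R))
    (p : nat) (Tinit A : {fset triangle R}) : set (fun2 R) :=
  [set v | exists (m : nat) (S : nat -> {fset triangle R}),
     level_sequence Omega Tinit A m S /\
     exists w : nat -> fun2 R,
       (forall k, (k <= m)%N -> argyris Omega p (S k) (w k)) /\
       forall x, v x = \sum_(k < m.+1) w k x].

Definition discrete_eigenpair (R : realType) (Omega : set (point2 R))
    (W : set (fun2 R)) (u : fun2 R) (j : nat) (lamh : R) (uh : fun2 R)
    : Prop :=
  exists (N : nat) (lams : nat -> \bar R),
    [/\ discrete_spectrum Omega W N lams, (0 < j <= N)%N, lams j = lamh%:E,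
        eigen Omega W lamh uh &
        L2_norm Omega uh = 1 /\ 0 <= form_b Omega u uh].

Definition LB (R : realType) (Omega : set (point2 R)) (lam : R) (u : fun2 R)
    (lamh : R) (uh : fun2 R) : R :=
  energy_norm Omega (u \- uh) ^+ 2 + lamh - lam + L2_norm Omega (u \- uh) ^+ 2.

Definition quasi_optimality (R : realType) (Omega : set (point2 R))
    (W : set (fun2 R)) (j : nat) (lam : nat -> R) (u : fun2 R) (Lqo : R)
    : Prop :=
  (exists2 N, has_dim W N & (j <= N)%N) /\
  forall lamh uh, discrete_eigenpair Omega W u j lamh uh ->
    LB Omega (lam j) u lamh uh
      <= Lqo * inf [set energy_norm Omega (u \- v) ^+ 2 | v in W].

Definition closeness (R : realType) (Omega : set (point2 R))
    (W : set (fun2 R)) (j : nat) (lam : nat -> R) (u : fun2 R) : Prop :=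
  forall lamh uh, discrete_eigenpair Omega W u j lamh uh ->
    LB Omega (lam j) u lamh uh < 2^-1.

Definition separation (R : realType) (Omega : set (point2 R))
    (W : set (fun2 R)) (j : nat) (lam : nat -> R) : Prop :=
  forall N lams, discrete_spectrum Omega W N lams ->
    ((lam j.-1)%:E <= lams j.-1 /\ lams j.-1 < (lam j)%:E /\
     (lam j)%:E <= lams j /\ lams j < (lam j.+1)%:E /\
     (lam j.+1)%:E <= lams j.+1)%E.

(* The quotients are taken in the extended reals, where x / +oo = 0. *)
Definition separation_bound (R : realType) (Omega : set (point2 R))
    (W : set (fun2 R)) (j : nat) (lam : nat -> R) (Lsep : R) : Prop :=
  forall N lams, discrete_spectrum Omega W N lams ->
    (maxe ((lam j)%:E / ((lam j)%:E - lams j.-1))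
          (lams j / (lams j.+1 - lams j)) <= Lsep%:E)%E.

Definition laplacian (R : realType) (q : fun2 R) : fun2 R :=
  fun x => \sum_(i < 2) partial [:: i; i] q x.

Definition normal (R : realType) (E : point2 R * point2 R) : point2 R :=
  ((E.2.2 - E.1.2) / edist E.1 E.2, (E.1.1 - E.2.1) / edist E.1 E.2).

Definition coord (R : realType) (x : point2 R) (i : 'I_2) : R :=
  if i == 0%N :> nat then x.1 else x.2.

Definition normal_deriv (R : realType) (nu : point2 R) (q : fun2 R) : fun2 R :=
  fun x => \sum_(i < 2) coord nu i * partial [:: i] q x.

Definition normal_deriv2 (R : realType) (nu : point2 R) (q : fun2 R) : fun2 R :=
  fun x => \sum_(i < 2) \sum_(k < 2)
             coord nu i * coord nu k * partial [:: i; k] q x.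

Definition edge_integral (R : realType) (E : point2 R * point2 R) (f : fun2 R)
    : R :=
  edist E.1 E.2 *
  (\int[@lebesgue_measure R]_(t in `[0%R, 1%R]) f (E.1 + t *: (E.2 - E.1)))%R.

(* Square of the L^2 norm, over the part of the boundary of [T] in the domain,
   of the jump of the piecewise function [d v].  The interior edges of [T] are
   those that it shares with another triangle [T'] of the triangulation, and
   the jump is the difference of the traces from [T] and [T']. *)
Definition jump_norm2 (R : realType) (A : {fset triangle R}) (T : triangle R)
    (d : point2 R -> fun2 R -> fun2 R) (v : fun2 R) : R :=
  \sum_(E <- edges T)
    \sum_(T' <- A | [&& T' != T, E.1 \in vertices T' & E.2 \in vertices T'])
      edge_integral E (fun x =>
        (d (normal E) (piece v T) x - d (normal E) (piece v T') x) ^+ 2).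

Definition eta2 (R : realType) (A : {fset triangle R}) (lamh : R)
    (uh : fun2 R) (T : triangle R) : R :=
  area T ^+ 2 *
    L2_norm (closed_triangle T)
      (fun x => lamh * uh x - laplacian (laplacian (piece uh T)) x) ^+ 2
  + area T `^ (1 / 2) * jump_norm2 A T (@normal_deriv2 R) uh
  + area T `^ (3 / 2) *
      jump_norm2 A T (fun nu q => normal_deriv nu (laplacian q)) uh.

Definition eta (R : realType) (A : {fset triangle R}) (lamh : R)
    (uh : fun2 R) (M : {fset triangle R}) : R :=
  Num.sqrt (\sum_(T <- M) eta2 A lamh uh T).

(* Main.v *)
Require Import Defs.
From mathcomp Require Import all_boot all_order all_algebra.
From mathcomp Require Import finmap ring lra.
From mathcomp Require Import all_classical all_reals all_analysis.
From mathcomp Require Import measurable_realfun.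
From Stdlib Require Import Relation_Operators.
Import Order.TTheory GRing.Theory Num.Theory.
Import numFieldNormedType.Exports.
Set Implicit Arguments.
Unset Strict Implicit.
Unset Printing Implicit Defensive.
Local Open Scope classical_set_scope.
Local Open Scope ring_scope.

(** A fine triangle outside the coarse triangulation lies in exactly one coarse
    triangle T and has at most half of its area.  Since uh is a polynomial on T,
    its jumps vanish on the new edges inside T, so that the edge terms of the
    descendants of T add up to at most those of T.  The estimator of uh on the
    fine triangulation is therefore reduced by the weights alone, and the
    smallest power |T|^(1/2) leads to 2^(-1/2) for the squares.

    Passing from uh to uhat costs the estimator of w := uhat - uh.  Testing the
    weak second derivatives of w with functions that are supported in a box
    inside K and biorthogonal to the monomials recovers the coefficients of the
    second derivatives of the polynomial w|K; this bounds all its derivatives of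
    order two to four, scaled by powers of |K|^(1/2), by the energy of w in the
    box, without any trace inequality.  The remaining term lamhat uhat - lamh uh
    is controlled by the Friedrichs inequality and lamh = |||uh|||^2. *)

(** * Integration over subsets of the plane *)

(** The representatives chosen by [wD] are additive only almost everywhere, because weak derivatives
    are unique only up to null sets; the fundamental lemma serves to establish this uniqueness. All
    explicit test functions are tensor products of smooth functions of one variable. In place of a
    reference triangle, the size of a triangle enters through the square root of its area, its shape
    through a ratio that bisection preserves, and the biorthogonal functions are scaled to a box
    about the centroid. That box has to lie in the open set [Omega], whereas the triangles only fill
    its closure: here the Lipschitz boundary enters. The factor 2^(-1/4) leaves no room for a lossy
    splitting. Squares are therefore separated with the weights 1 + t and 1 + 1/t for every t > 0,
    summed over the triangles, and only then optimised in t. Property (ii), applied on both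
    triangulations, bounds lamh and lamhat by |lam_j| + 1. Their difference is one of squared
    energies and hence at most of the order of |||w|||. *)

Definition measurable2 (R : realType) (D : set (point2 R)) : Prop :=
  @measurable _ (mpoint2 R) D.

Definition measurable_fun2 (R : realType) (D : set (point2 R)) (f : fun2 R) : Prop :=
  measurable_fun (D : set (mpoint2 R)) f.

Definition integrable2 (R : realType) (D : set (point2 R)) (f : fun2 R) : Prop :=
  (@leb2 R).-integrable D (EFin \o f).

Section Measurability.
Variable R : realType.
Implicit Types (D : set (point2 R)) (f g : fun2 R).

(** The topology comes from the norm of the plane, the sigma-algebra from the product; a countable
    cover by rational boxes links the two. *)
Lemma open_measurable2 D : open D -> measurable2 D.
Proof.
move=> oD.
pose box (q : (rat * rat) * (rat * rat)) : set (point2 R) :=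
  `]ratr q.1.1, ratr q.1.2[%classic `*` `]ratr q.2.1, ratr q.2.2[%classic.
have -> : D = \bigcup_q (if pselect (box q `<=` D) then box q else set0).
  apply/seteqP; split=> [x Dx|x [q _]]; last first.
    by case: pselect => // qD /qD.
  have [e /= e0 eD] : nbhs_ball x D by apply/nbhs_ballP; exact: open_nbhs_nbhs.
  have [a1] := rat_in_itvoo (ltr_pwDl e0 (lexx (x.1 - e))).
  have [b1] := rat_in_itvoo (ltr_pwDl e0 (lexx x.1)).
  have [a2] := rat_in_itvoo (ltr_pwDl e0 (lexx (x.2 - e))).
  have [b2] := rat_in_itvoo (ltr_pwDl e0 (lexx x.2)).
  rewrite !in_itv /= => /andP[xb2 b2e] /andP[a2e a2x] /andP[xb1 b1e] /andP[a1e a1x].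
  exists ((a1, b1), (a2, b2)) => //.
  have sub : box ((a1, b1), (a2, b2)) `<=` D.
    move=> y [] /=; rewrite !in_itv /= => /andP[y1 y2] /andP[y3 y4].
    apply: eD; split; rewrite /ball /= ltr_norml; lra.
  by case: pselect => [bD|//]; split; rewrite /= in_itv /=; lra.
apply: countable_bigcupT_measurable => [|q].
  exact: countableP.
case: pselect => [bD|bD]; last exact: measurable0.
by apply: measurableX; exact: measurable_itv.
Qed.

Lemma continuous_measurable_fun2 f : continuous f -> measurable_fun2 setT f.
Proof.
move=> cf; apply: (measurability _ (RGenOpens.measurableE R)).
move=> /= A [B [a [b Bab]] <-]; rewrite setTI Bab; apply: open_measurable2.
by move/continuousP: cf; apply; exact: interval_open.
Qed.

End Measurability.

Section Integrals.
Variable R : realType.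
Implicit Types (D : set (point2 R)) (f g : fun2 R).

Lemma int2_eq D f g : (forall x, D x -> f x = g x) -> int2 D f = int2 D g.
Proof. by move=> fg; apply: eq_Rintegral => x; rewrite inE => /fg. Qed.

Lemma int2_ge0 D f : (forall x, D x -> 0 <= f x) -> 0 <= int2 D f.
Proof. by move=> f0; apply: (Rintegral_ge0 (@leb2 R) f0). Qed.

Lemma int2_le D f g : measurable2 D -> integrable2 D f -> integrable2 D g ->
  (forall x, D x -> f x <= g x) -> int2 D f <= int2 D g.
Proof. by move=> mD fi gi fg; apply: (@le_Rintegral _ _ R (@leb2 R)). Qed.

Lemma int2D D f g : measurable2 D -> integrable2 D f -> integrable2 D g ->
  int2 D (fun x => f x + g x) = int2 D f + int2 D g.
Proof. by move=> mD fi gi; apply: (@RintegralD _ _ R (@leb2 R)). Qed.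

Lemma int2B D f g : measurable2 D -> integrable2 D f -> integrable2 D g ->
  int2 D (fun x => f x - g x) = int2 D f - int2 D g.
Proof. by move=> mD fi gi; apply: (@RintegralB _ _ R (@leb2 R)). Qed.

Lemma int2Z D f (r : R) : measurable2 D -> integrable2 D f ->
  int2 D (fun x => r * f x) = r * int2 D f.
Proof. by move=> mD fi; apply: (@RintegralZl _ _ R (@leb2 R)). Qed.

Lemma int2_mkcond D f : int2 D f = int2 setT (f \_ D).
Proof. exact: (Rintegral_mkcond (@leb2 R)). Qed.

Lemma eq_integrable2 D f g : measurable2 D -> (forall x, D x -> f x = g x) ->
  integrable2 D f -> integrable2 D g.
Proof.
by move=> mD fg; apply: eq_integrable => // x; rewrite inE => /fg /= ->.
Qed.

Lemma integrable2D D f g : measurable2 D -> integrable2 D f -> integrable2 D g ->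
  integrable2 D (fun x => f x + g x).
Proof. by move=> mD fi gi; exact: (integrableD mD fi gi). Qed.

Lemma integrable2Z D f (r : R) : measurable2 D -> integrable2 D f ->
  integrable2 D (fun x => r * f x).
Proof. by move=> mD fi; exact: (integrableZl mD r fi). Qed.

Lemma integrable2S D E f : measurable2 D -> measurable2 E -> E `<=` D ->
  integrable2 D f -> integrable2 E f.
Proof. by move=> mD mE ED; exact: integrableS. Qed.

Lemma integrable2_mfun D f : integrable2 D f -> measurable_fun2 D f.
Proof. by move=> /measurable_int/measurable_EFinP. Qed.

Lemma integrable2_dominated D f g : measurable2 D -> measurable_fun2 D f ->
  (forall x, D x -> `|f x| <= g x) -> integrable2 D g -> integrable2 D f.
Proof.
move=> mD mf fg gi; apply: (le_integrable mD _ _ gi).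
  exact/measurable_EFinP.
by move=> x Dx; rewrite /= lee_fin (le_trans (fg _ Dx))// ler_norm.
Qed.

Lemma integrable2_mkcond D f : measurable2 D ->
  integrable2 D f <-> integrable2 setT (f \_ D).
Proof.
by move=> mD; rewrite /integrable2 (integrable_mkcond _ mD) restrict_EFin.
Qed.

Lemma int2_subset D E f : measurable2 D -> measurable2 E -> E `<=` D ->
  integrable2 D f -> (forall x, D x -> 0 <= f x) -> int2 E f <= int2 D f.
Proof.
move=> mD mE ED fi f0.
rewrite [leLHS]int2_mkcond [leRHS]int2_mkcond.
apply: int2_le => //.
- exact: measurableT.
- exact/(integrable2_mkcond f mE)/(integrable2S mD mE ED fi).
- exact/(integrable2_mkcond f mD).
move=> x _; rewrite !patchE; case: ifPn; rewrite ?inE ?notin_setE => Ex.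
  by rewrite mem_set//; exact: ED.
by case: ifPn => //; rewrite inE; exact: f0.
Qed.

Lemma measurable_fun2_mkcond D f : measurable2 D ->
  measurable_fun2 D f <-> measurable_fun2 setT (f \_ D).
Proof. by move=> mD; exact: (measurable_restrictT _ mD). Qed.

Lemma measurable_fun2D D f g : measurable_fun2 D f -> measurable_fun2 D g ->
  measurable_fun2 D (fun x => f x + g x).
Proof. exact: measurable_funD. Qed.

Lemma measurable_fun2M D f g : measurable_fun2 D f -> measurable_fun2 D g ->
  measurable_fun2 D (fun x => f x * g x).
Proof. exact: measurable_funM. Qed.

Lemma measurable_fun2Z D f (r : R) : measurable_fun2 D f ->
  measurable_fun2 D (fun x => r * f x).
Proof. by move=> mf; apply: measurable_funM => //; exact: measurable_cst. Qed.

Lemma measurable_fun2S D E f : measurable2 D -> E `<=` D ->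
  measurable_fun2 D f -> measurable_fun2 E f.
Proof. by move=> mD ED; exact: measurable_funS. Qed.

Lemma L2P D f : measurable2 D ->
  L2 D f <-> measurable_fun2 D f /\ integrable2 D (fun x => f x ^+ 2).
Proof.
move=> mD; split=> -[mf fi]; split => //.
  apply/integrableP; split.
    by apply/measurable_EFinP; exact: measurable_funX.
  under eq_integral do rewrite /= ger0_norm ?sqr_ge0//.
  exact: fi.
move/integrableP: fi => [_].
by under eq_integral do rewrite /= ger0_norm ?sqr_ge0//.
Qed.

Lemma L2_integrableM D f g : measurable2 D -> L2 D f -> L2 D g ->
  integrable2 D (fun x => f x * g x).
Proof.
move=> mD /(L2P _ mD)[mf fi] /(L2P _ mD)[mg gi].
apply: (@integrable2_dominated D _ (fun x => f x ^+ 2 + g x ^+ 2)) => //.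
- exact: measurable_fun2M.
- by move=> x _; rewrite ler_norml; nra.
- exact: integrable2D.
Qed.

Lemma L2_comb D f g (a b : R) : measurable2 D -> L2 D f -> L2 D g ->
  L2 D (fun x => a * f x + b * g x).
Proof.
move=> mD Lf Lg; move: (Lf) (Lg) => /(L2P _ mD)[mf fi] /(L2P _ mD)[mg gi].
have fgi := L2_integrableM mD Lf Lg.
apply/L2P => //; split.
  by apply: measurable_fun2D; exact: measurable_fun2Z.
apply: (@eq_integrable2 _ (fun x => (a ^+ 2 * f x ^+ 2 + b ^+ 2 * g x ^+ 2)
   + 2 * a * b * (f x * g x))) => // [x _|]; first by ring.
apply: integrable2D => //; last exact: integrable2Z.
by apply: integrable2D => //; exact: integrable2Z.
Qed.

Lemma L2B D f g : measurable2 D -> L2 D f -> L2 D g -> L2 D (fun x => f x - g x).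
Proof.
move=> mD /(L2_comb 1 (-1) mD) h /h.
by under [X in L2 D X]funext do rewrite mul1r mulN1r.
Qed.

Lemma L2_integrable_sqr D f : measurable2 D -> L2 D f ->
  integrable2 D (fun x => f x ^+ 2).
Proof. by move=> mD /(L2P _ mD)[]. Qed.

Lemma L2S D E f : measurable2 D -> measurable2 E -> E `<=` D -> L2 D f -> L2 E f.
Proof.
move=> mD mE ED /(L2P _ mD)[mf fi]; apply/L2P => //; split.
  exact: (measurable_fun2S mD ED mf).
exact: (integrable2S mD mE ED fi).
Qed.

Lemma int2_cauchy_schwarz D f g : measurable2 D -> L2 D f -> L2 D g ->
  int2 D (fun x => f x * g x) ^+ 2
    <= int2 D (fun x => f x ^+ 2) * int2 D (fun x => g x ^+ 2).
Proof.
move=> mD Lf Lg.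
have fi := L2_integrable_sqr mD Lf; have gi := L2_integrable_sqr mD Lg.
have fgi := L2_integrableM mD Lf Lg.
set A := int2 D (fun x => f x ^+ 2); set B := int2 D (fun x => g x ^+ 2).
set P := int2 D (fun x => f x * g x).
have A0 : 0 <= A by apply: int2_ge0 => x _; exact: sqr_ge0.
have B0 : 0 <= B by apply: int2_ge0 => x _; exact: sqr_ge0.
have quad (s t : R) : 0 <= s ^+ 2 * A + t ^+ 2 * B + 2 * s * t * P.
  rewrite -!int2Z// -int2D//; [|exact: integrable2Z..].
  rewrite -int2D//; [|by apply: integrable2D => //; exact: integrable2Z|exact: integrable2Z].
  apply: int2_ge0 => x _.
  have -> : s ^+ 2 * f x ^+ 2 + t ^+ 2 * g x ^+ 2 + 2 * s * t * (f x * g x)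
            = (s * f x + t * g x) ^+ 2 by ring.
  exact: sqr_ge0.
have [A1|A1] := leP A 0.
  have A2 : A = 0 by apply/eqP; rewrite eq_le A1 A0.
  rewrite A2 mul0r; have [->|P0] := eqVneq P 0; first by rewrite expr0n.
  (* If [A] = 0 and [P] were nonzero, this choice would give the form the negative value - [B] -
     2. *)
  have := quad (- (B + 1) / P) 1; rewrite A2 mulr0 add0r expr1n mul1r mulr1.
  by rewrite -!mulrA mulVf// mulr1; lra.
have := quad P (- A).
have -> : P ^+ 2 * A + (- A) ^+ 2 * B + 2 * P * - A * P = A * (A * B - P ^+ 2) by ring.
by rewrite pmulr_rge0// subr_ge0.
Qed.

End Integrals.

(** * Boxes, compact supports and coordinate slices *)

Section Plane.
Variable R : realType.
Implicit Types (D : set (point2 R)) (f g : fun2 R).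

Definition cbox (a b c d : R) : set (point2 R) :=
  [set x | (a <= x.1 <= b) /\ (c <= x.2 <= d)].

Lemma cboxE a b c d : cbox a b c d = `[a, b]%classic `*` `[c, d]%classic.
Proof. by apply/seteqP; split=> x [] /=; rewrite ?in_itv /= ?in_itv /=. Qed.

Lemma measurable2_cbox a b c d : measurable2 (cbox a b c d).
Proof. by rewrite cboxE; apply: measurableX; exact: measurable_itv. Qed.

Lemma leb2_cbox a b c d : a <= b -> c <= d ->
  leb2 R (cbox a b c d) = ((b - a) * (d - c))%:E.
Proof.
move=> ab cd; rewrite cboxE.
have := @product_measure1E _ _ _ _ R (@lebesgue_measure R) (@lebesgue_measure R)
  _ _ (measurable_itv `[a, b]) (measurable_itv `[c, d]).
move=> H; apply: (etrans H).
have itv (s t : R) : s <= t ->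
    (@lebesgue_measure R) (`[s, t]%classic : set (measurableTypeR R)) = (t - s)%:E.
  move=> st; rewrite (lebesgue_measure_itv `[s, t]) /= lte_fin -EFinB.
  by case: ltgtP st => // -> _; rewrite subrr.
by rewrite EFinM; congr mule; exact: itv.
Qed.

Lemma leb2_sub_cbox D a b c d : measurable2 D -> a <= b -> c <= d ->
  D `<=` cbox a b c d -> (leb2 R D <= ((b - a) * (d - c))%:E)%E.
Proof.
move=> mD ab cd DB; rewrite -leb2_cbox//; apply: le_measure => //; rewrite inE //.
exact: measurable2_cbox.
Qed.

Lemma integrable2_cst D (k : R) : measurable2 D -> (leb2 R D < +oo)%E ->
  integrable2 D (cst k).
Proof.
move=> mD Doo; apply/integrableP; split; first exact/measurable_EFinP/measurable_cst.
by rewrite (integral_cst _ mD `|k|%:E)// lte_mul_pinfty.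
Qed.

Lemma integrable2_bounded D a b c d f M : measurable2 D -> a <= b -> c <= d ->
  D `<=` cbox a b c d -> measurable_fun2 D f -> (forall x, D x -> `|f x| <= M) ->
  integrable2 D f.
Proof.
move=> mD ab cd DB mf fM; apply: (integrable2_dominated mD mf fM).
apply: integrable2_cst => //.
by rewrite (le_lt_trans (leb2_sub_cbox mD ab cd DB))// ltry.
Qed.

Lemma int2_bounded D a b c d f M : measurable2 D -> a <= b -> c <= d ->
  D `<=` cbox a b c d -> measurable_fun2 D f -> 0 <= M ->
  (forall x, D x -> `|f x| <= M) ->
  int2 D f <= M * ((b - a) * (d - c)).
Proof.
move=> mD ab cd DB mf M0 fM.
have lD := leb2_sub_cbox mD ab cd DB.
have lD' : (leb2 R D < +oo)%E by rewrite (le_lt_trans lD)// ltry.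
apply: (@le_trans _ _ (int2 D (cst M))).
  apply: int2_le => //; first exact: (integrable2_bounded mD ab cd DB mf fM).
    exact: integrable2_cst.
  by move=> x /fM; apply: le_trans; exact: ler_norm.
rewrite /int2 (Rintegral_cst (leb2 R) mD) ler_wpM2l//.
have fD : leb2 R D \is a fin_num by rewrite ge0_fin_numE.
by rewrite -lee_fin fineK.
Qed.

Lemma continuous_cbox_bounded f a b c d : continuous f ->
  exists2 M, 0 <= M & forall x, cbox a b c d x -> `|f x| <= M.
Proof.
move=> cf.
have cK : compact (cbox a b c d).
  by rewrite cboxE; apply: compact_setX; exact: segment_compact.
have : compact (f @` cbox a b c d).
  by apply: continuous_compact => //; exact: continuous_subspaceT.
move=> /compact_bounded[M [Mr HM]].
exists (`|M| + 1); first by rewrite addr_ge0.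
move=> x Bx; apply: (HM (`|M| + 1)); last by exists x.
by rewrite (le_lt_trans (ler_norm M))// ltrDl.
Qed.

Definition supp_in (M : R) f := forall x, ~ cbox (- M) M (- M) M x -> f x = 0.

Lemma compact_support_in K f : compact K -> (forall x, ~ K x -> f x = 0) ->
  exists2 M, 0 < M & supp_in M f.
Proof.
move=> cK fK.
have /compact_bounded[M [Mr HM]] := cK.
exists (`|M| + 1); first by rewrite ltr_wpDl.
move=> x Bx; apply: fK => Kx; apply: Bx.
have /HM/(_ x Kx) : M < `|M| + 1 by rewrite (le_lt_trans (ler_norm M))// ltrDl.
rewrite /cbox /= -!ler_norml prod_normE /= ge_max => /andP[-> ->] //.
Qed.

Lemma supp_bounded f M : continuous f -> supp_in M f ->
  exists2 C, 0 <= C & forall x, `|f x| <= C.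
Proof.
move=> cf sf; have [C C0 HC] := continuous_cbox_bounded (- M) M (- M) M cf.
exists C => // x; have [/HC//|/sf->] := pselect (cbox (- M) M (- M) M x).
by rewrite normr0.
Qed.

Lemma supp_integrable f M : 0 <= M -> continuous f -> supp_in M f ->
  integrable2 setT f.
Proof.
move=> M0 cf sf; have [C C0 HC] := supp_bounded cf sf.
have mf := continuous_measurable_fun2 cf.
have : integrable2 (cbox (- M) M (- M) M) f.
  apply: (@integrable2_bounded _ (- M) M (- M) M _ C) => //; try lra.
  - exact: measurable2_cbox.
  - exact: (measurable_fun2S measurableT (@subsetT _ _) mf).
move/(integrable2_mkcond f (measurable2_cbox _ _ _ _)).
apply: eq_integrable2 => [|x _]; first exact: measurableT.
rewrite patchE; case: ifPn => //; rewrite notin_setE => /sf ->//.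
Qed.

Lemma supp_L2 f M : 0 <= M -> continuous f -> supp_in M f -> L2 setT f.
Proof.
move=> M0 cf sf; apply/L2P; first exact: measurableT.
split; first exact: continuous_measurable_fun2.
apply: (@supp_integrable _ M) => //; last by move=> x /sf ->; rewrite expr0n.
by under [X in continuous X]funext do rewrite expr2; move=> x;
  apply: (@continuousM _ _ f f); exact: cf.
Qed.

(** The difference quotients agree as functions of the increment, so that both existence and value
    of a partial derivative reduce to a function of one variable. *)
Lemma slice0_quotient f t y :
  (fun h : R => h^-1 *: (f (h *: basis_vec R 0 + (t, y)) - f (t, y)))
  = (fun h : R => h^-1 *: (f (h *: (1 : R) + t, y) - f (t, y))).
Proof.
apply/funext => h; congr (_ *: (f _ - _)).
by apply/eqP; rewrite xpair_eqE /= !scaler0 add0r !eqxx.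
Qed.

Lemma slice1_quotient f x t :
  (fun h : R => h^-1 *: (f (h *: basis_vec R 1 + (x, t)) - f (x, t)))
  = (fun h : R => h^-1 *: (f (x, h *: (1 : R) + t) - f (x, t))).
Proof.
apply/funext => h; congr (_ *: (f _ - _)).
by apply/eqP; rewrite xpair_eqE /= !scaler0 add0r !eqxx.
Qed.

Lemma derivable_slice0 f t y :
  derivable f (t, y) (basis_vec R 0) <-> derivable (fun s => f (s, y)) t 1.
Proof. by rewrite /derivable slice0_quotient. Qed.

Lemma derivable_slice1 f x t :
  derivable f (x, t) (basis_vec R 1) <-> derivable (fun s => f (x, s)) t 1.
Proof. by rewrite /derivable slice1_quotient. Qed.

Lemma derive_slice0 f t y :
  'D_(basis_vec R 0) f (t, y) = 'D_1 (fun s => f (s, y)) t.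
Proof. by rewrite /derive slice0_quotient. Qed.

Lemma derive_slice1 f x t :
  'D_(basis_vec R 1) f (x, t) = 'D_1 (fun s => f (x, s)) t.
Proof. by rewrite /derive slice1_quotient. Qed.

Lemma continuous_slice0 f y : continuous f -> continuous (fun s => f (s, y)).
Proof.
move=> cf x.
apply: (@continuous2_cvg _ _ _ _ _ _ id (cst y) (fun a b => f (a, b)) x y).
- by rewrite (_ : (fun z => _) = f); [exact: cf|apply/funext => -[]].
- exact: cvg_id.
- exact: cvg_cst.
Qed.

Lemma continuous_slice1 f x : continuous f -> continuous (fun s => f (x, s)).
Proof.
move=> cf y.
apply: (@continuous2_cvg _ _ _ _ _ _ (cst x) id (fun a b => f (a, b)) x y).
- by rewrite (_ : (fun z => _) = f); [exact: cf|apply/funext => -[]].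
- exact: cvg_cst.
- exact: cvg_id.
Qed.

Lemma derive1_out (F : R -> R) (M : R) :
  (forall t, ~ (- M <= t <= M) -> F t = 0) ->
  forall t, ~ (- M <= t <= M) -> derive1 F t = 0.
Proof.
move=> sF t tM; rewrite derive1E.
have tM' : M < `|t|.
  by rewrite ltNge; apply/negP => /ler_normlP[? ?]; apply: tM; lra.
have : \forall s \near t, F s = 0.
  have : \forall s \near t, M < `|s|.
    have ct : (fun s : R => `|s|) @ t --> `|t| by exact: norm_continuous.
    exact: cvgr_gt ct _ tM'.
  apply: filterS => s sM; apply: sF => /andP[? ?].
  by move: sM; rewrite ltNge => /negP; apply; rewrite ler_norml; apply/andP.
move=> F0.
rewrite (near_eq_derive (g := cst 0)) ?derive_cst//.
Qed.

Lemma integral_derive1_supp (F : R -> R) (M : R) : 0 < M ->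
  (forall t, derivable F t 1) -> continuous (derive1 F) ->
  (forall t, ~ (- M <= t <= M) -> F t = 0) ->
  (\int[@lebesgue_measure R]_x (derive1 F x)%:E)%E = 0%E.
Proof.
move=> M0 dF cF sF.
have cF0 : continuous F by move=> x; apply: differentiable_continuous; exact/derivable1_diffP.
have D0 := derive1_out sF.
(* At the end points of the larger interval [F] vanishes by hypothesis, at those of [-M, M] only by
   continuity. *)
pose N := M + 1.
have N1 : - N < N by rewrite /N; lra.
transitivity (\int[@lebesgue_measure R]_(x in `[(- N)%R, N]) (derive1 F x)%:E)%E.
  rewrite [RHS]integral_mkcond; apply: eq_integral => x _.
  rewrite patchE; case: ifPn => //; rewrite notin_setE /= in_itv /= => xN.
  by rewrite D0// => /andP[? ?]; apply: xN; rewrite /N; apply/andP; split; lra.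
rewrite (continuous_FTC2 (F := F) N1).
- by rewrite !sF ?subee// /N; lra.
- exact: continuous_subspaceT.
- split; [by move=> x _; exact: dF|exact: cvg_at_right_filter (cF0 _)|exact: cvg_at_left_filter (cF0 _)].
- by move=> x _.
Qed.

(** Fubini's theorem allows integration along direction [i] first, where the fundamental theorem of
    calculus yields zero on every line. *)
Lemma int2_partial_supp (i : 'I_2) f M : 0 < M -> supp_in M f ->
  (forall x, derivable f x (basis_vec R i)) ->
  continuous ('D_(basis_vec R i) f) ->
  int2 setT ('D_(basis_vec R i) f) = 0.
Proof.
move=> M0 sf df cDf.
have Di : integrable2 setT ('D_(basis_vec R i) f).
  (* Around a point outside the larger box, a whole unit ball avoids the support of [f]. *)
  apply: (@supp_integrable _ (M + 1)) => //; first by rewrite addr_ge0// ltW.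
  move=> x xM; rewrite -(derive_cst (0 : R) x (basis_vec R i)).
  apply: near_eq_derive.
  apply/nbhs_ballP; exists 1; rewrite /= // => y [y1 y2].
  apply: sf => -[/andP[? ?] /andP[? ?]]; apply: xM.
  move: y1 y2; rewrite /ball /= !ltr_norml => /andP[? ?] /andP[? ?].
  by split; apply/andP; split; lra.
have [i0|i1] : i = 0 \/ i = 1.
  by case: i {df cDf Di} => [[|[|//]] ?]; [left|right]; exact/val_inj.
- subst i.
  have key (y : R) :
      (\int[@lebesgue_measure R]_x ('D_(basis_vec R 0) f (x, y))%:E)%E = 0%E.
    have E : (fun x => 'D_(basis_vec R 0) f (x, y)) = derive1 (fun s => f (s, y)).
      apply/funext => x.
      by rewrite derive1E derive_slice0.
    have := @integral_derive1_supp (fun s => f (s, y)) M M0; rewrite -E; apply.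
    + by move=> t; apply/derivable_slice0.
    + exact: continuous_slice0 cDf.
    + by move=> t tM; apply: sf => -[].
  rewrite /int2 /Rintegral /leb2 -(integral21_prod_meas1 Di).
  rewrite (_ : fubini_G _ _ = cst 0%E) ?integral0//.
  by apply/funext => y; exact: key.
- subst i.
  have key (x : R) :
      (\int[@lebesgue_measure R]_y ('D_(basis_vec R 1) f (x, y))%:E)%E = 0%E.
    have E : (fun y => 'D_(basis_vec R 1) f (x, y)) = derive1 (fun s => f (x, s)).
      apply/funext => y.
      by rewrite derive1E derive_slice1.
    have := @integral_derive1_supp (fun s => f (x, s)) M M0; rewrite -E; apply.
    + by move=> t; apply/derivable_slice1.
    + exact: (continuous_slice1 cDf).
    + by move=> t tM; apply: sf => -[].
  rewrite /int2 /Rintegral /leb2 -(integral12_prod_meas1 Di).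
  rewrite (_ : fubini_F _ _ = cst 0%E) ?integral0//.
  by apply/funext => x; exact: key.
Qed.

End Plane.

(** * Smooth functions of one variable *)

Section Smooth.
Variable R : realType.
Implicit Types (f g : R -> R).

(** The index is shifted: [C1k n] asks for [n.+1] derivatives, which makes the first [n] of them,
    and [f], continuous without saying so. *)
Fixpoint C1k (n : nat) f : Prop :=
  (forall t, derivable f t 1) /\
  if n is n'.+1 then C1k n' (derive1 f) else True.

Lemma is_derive1E f (t d : R) : is_derive (t : R) (1 : R) f d -> derive1 f t = d.
Proof. by move=> fd; rewrite derive1E; exact: derive_val. Qed.

Lemma is_derive1_eq f (t d d' : R) :
  is_derive (t : R) (1 : R) f d -> d = d' -> is_derive (t : R) (1 : R) f d'.
Proof. by move=> fd <-. Qed.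

Lemma C1kS n f : C1k n.+1 f -> C1k n f.
Proof. by elim: n f => [|n IH] f [df] // Cf; split => //; exact: IH. Qed.

Lemma C1k0 n f : C1k n f -> forall t, derivable f t 1.
Proof. by case: n => [|n] []. Qed.

Lemma C1k_continuous n f : C1k n f -> continuous f.
Proof.
by move=> /C1k0 df t; apply: differentiable_continuous; exact/derivable1_diffP.
Qed.

Lemma C1k_intro n f g : (forall t, is_derive (t : R) (1 : R) f (g t)) ->
  (if n is n'.+1 then C1k n' g else True) -> C1k n f.
Proof.
move=> fg; have -> : g = derive1 f by apply/funext => t; rewrite (is_derive1E (fg t)).
by case: n => [|n] Cg; split => //; move=> t; exact: ex_derive.
Qed.

Lemma C1k_is_derive n f t : C1k n f -> is_derive (t : R) (1 : R) f (derive1 f t).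
Proof. by move=> /C1k0 df; rewrite derive1E; exact: derivableP. Qed.

Lemma C1kD n f g : C1k n f -> C1k n g -> C1k n (fun t => f t + g t).
Proof.
elim: n f g => [|n IH] f g Cf Cg;
  apply: (@C1k_intro _ _ (fun t => derive1 f t + derive1 g t)) => //.
- by move=> t; exact: (is_deriveD (C1k_is_derive t Cf) (C1k_is_derive t Cg)).
- by move=> t; exact: (is_deriveD (C1k_is_derive t Cf) (C1k_is_derive t Cg)).
- by apply: IH; [case: Cf|case: Cg].
Qed.

Lemma C1kM n f g : C1k n f -> C1k n g -> C1k n (fun t => f t * g t).
Proof.
elim: n f g => [|n IH] f g Cf Cg;
  apply: (@C1k_intro _ _ (fun t => f t * derive1 g t + g t * derive1 f t)) => //.
- by move=> t; exact: (is_deriveM (C1k_is_derive t Cf) (C1k_is_derive t Cg)).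
- by move=> t; exact: (is_deriveM (C1k_is_derive t Cf) (C1k_is_derive t Cg)).
- by apply: C1kD; apply: IH; [exact: C1kS|case: Cg|exact: C1kS|case: Cf].
Qed.

Lemma C1k_cst n (c : R) : C1k n (cst c).
Proof.
elim: n c => [|n IH] c; apply: (@C1k_intro _ _ (cst 0)) => // t; exact: is_derive_cst.
Qed.

Lemma C1kZ n (c : R) f : C1k n f -> C1k n (fun t => c * f t).
Proof. by apply: C1kM; exact: C1k_cst. Qed.

Lemma C1k_sum n (I : Type) (s : seq I) (F : I -> R -> R) :
  (forall i, C1k n (F i)) -> C1k n (fun t => \sum_(i <- s) F i t).
Proof.
move=> CF; elim: s => [|i s IH].
  by under [X in C1k _ X]funext do rewrite big_nil; exact: C1k_cst.
by under [X in C1k _ X]funext do rewrite big_cons; exact: C1kD.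
Qed.

Lemma is_derive_affine (a b t : R) : is_derive (t : R) (1 : R) (fun t => a * t + b) a.
Proof.
have h1 : is_derive t (1 : R) (cst a * id) (a *: (1 : R) + t *: (0 : R)).
  exact: is_deriveM.
have := is_deriveD h1 (is_derive_cst b t (1 : R)).
by rewrite scaler0 !addr0 scaler1.
Qed.

Lemma C1k_affine n f (a b : R) : C1k n f -> C1k n (fun t => f (a * t + b)).
Proof.
elim: n f => [|n IH] f Cf;
  apply: (@C1k_intro _ _ (fun t => a * derive1 f (a * t + b))) => //.
- move=> t; rewrite mulrC.
  exact: (is_derive1_comp (C1k_is_derive _ Cf) (is_derive_affine a b t)).
- move=> t; rewrite mulrC.
  exact: (is_derive1_comp (C1k_is_derive _ Cf) (is_derive_affine a b t)).
- by apply: C1kZ; apply: IH; case: Cf.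
Qed.

(** The standard flat function exp(-1/x), together with the powers 1/x^m that make the family closed
    under differentiation; smoothness then follows by induction for all [m] at once. *)
Definition flat (m : nat) (x : R) : R := if 0 < x then x ^- m * expR (- x^-1) else 0.

(** One term of the exponential series gives exp(1/x) >= x^-(m+2) / (m+2)!, so two powers of x are
    left over. A quadratic bound is what makes the derivative at the origin vanish. *)
Lemma flat_bound m (x : R) : `|flat m x| <= (m.+2)`!%:R * x ^+ 2.
Proof.
rewrite /flat; case: ifPn => [x0|_]; last first.
  by rewrite normr0 mulr_ge0// sqr_ge0.
have xm : 0 < x ^+ m by rewrite exprn_gt0.
have xmV : 0 <= x ^- m by rewrite invr_ge0 (ltW xm).
rewrite ger0_norm; last by rewrite mulr_ge0 ?expR_ge0.
rewrite expRN.
have := @expR_ge1Dxn R x^-1 m.+1; rewrite invr_ge0 (ltW x0) => /(_ isT) H.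
have {}H : (x ^+ m.+2 * (m.+2)`!%:R)^-1 <= expR x^-1.
  apply: le_trans H; rewrite invfM exprVn; rewrite lerDr; exact: ler01.
have p0 : 0 < x ^+ m.+2 * (m.+2)`!%:R by rewrite mulr_gt0 ?exprn_gt0// ltr0n fact_gt0.
have {}H : (expR x^-1)^-1 <= x ^+ m.+2 * (m.+2)`!%:R.
  by rewrite -[leRHS]invrK lef_pV2// ?posrE ?expR_gt0// invr_gt0.
apply: (le_trans (ler_wpM2l xmV H)).
by rewrite le_eqVlt; apply/orP; left; apply/eqP; rewrite !exprS; field; rewrite ?gt_eqF ?exprn_gt0.
Qed.

Lemma is_derive_sqr_bound f (C : R) : f 0 = 0 -> (forall x, `|f x| <= C * x ^+ 2) ->
  is_derive (0 : R) (1 : R) f 0.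
Proof.
move=> f0 fC.
have H : (fun h : R => h^-1 *: (f (h *: (1 : R) + 0) - f 0)) @ 0^' --> (0 : R).
  apply/cvgr0Pnorm_le => e e0.
  have C0 : 0 <= C by have := le_trans (normr_ge0 _) (fC 1); rewrite expr1n mulr1.
  have d0 : 0 < e / (C + 1) by rewrite divr_gt0// ltr_wpDl.
  near=> h.
  have h0 : h != 0 by near: h; exact: nbhs_dnbhs_neq.
  rewrite f0 subr0 addr0 scaler1 normrZ normfV.
  rewrite ler_pdivrMl ?normr_gt0//.
  apply: (le_trans (fC h)).
  have hd : `|h| <= e / (C + 1).
    near: h; apply: nbhs_dnbhs; apply/nbhs_ballP; exists (e / (C + 1)) => //= y.
    by rewrite /ball /= sub0r normrN => /ltW.
  rewrite -real_normK ?num_real// expr2 mulrCA ler_wpM2l//.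
  rewrite (le_trans (ler_wpM2l C0 hd))// mulrA ler_pdivrMr ?ltr_wpDl//.
  by rewrite mulrC ler_pM2l// lerDl.
by split; [apply/cvg_ex; exists 0|apply/cvg_lim => //; exact: Rhausdorff].
Unshelve. all: by end_near. Qed.

Lemma is_derive_flat m (x : R) :
  is_derive (x : R) (1 : R) (flat m) (- m%:R * flat m.+1 x + flat m.+2 x).
Proof.
have [x0|x0|->] := ltgtP x 0.
- have -> : - m%:R * flat m.+1 x + flat m.+2 x = 0.
    by rewrite /flat ltNge (ltW x0) /= mulr0 addr0.
  have c0 : is_derive x (1 : R) (cst (0 : R)) (0 : R) by exact: is_derive_cst.
  apply: near_eq_is_derive c0.
  have : \forall s \near x, s < 0 by exact: lt_nbhsl.
  by apply: filterS => s s0; rewrite /flat ltNge (ltW s0).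
- have xn0 : x != 0 by rewrite gt_eqF.
  suff fd : is_derive x (1 : R) (fun x : R => x ^- m * expR (- x^-1))
     (- m%:R * flat m.+1 x + flat m.+2 x).
    apply: near_eq_is_derive fd.
    have : \forall s \near x, 0 < s by exact: lt_nbhsr.
    by apply: filterS => s s0; rewrite /flat s0.
  have dV : is_derive (x : R) (1 : R) (fun x : R => x^-1) (- x ^- 2).
    have := is_deriveV xn0 (is_derive_id x 1).
    by rewrite scaler1.
  have dN : is_derive (x : R) (1 : R) (fun x : R => - x^-1) (x ^- 2).
    by have := is_deriveN dV; rewrite opprK.
  have dE := @is_derive1_comp _ expR (fun x => - x^-1) x _ _ (is_derive_expR _) dN.
  have dX : is_derive x (1 : R) (fun x : R => x ^- m) (- m%:R * x ^- m.+1).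
    have -> : (fun x : R => x ^- m) = (fun x : R => x^-1) ^+ m.
      by apply/funext => y; rewrite -exprVn exprfctE.
    have := is_deriveX m dV; move/is_derive1_eq; apply.
    rewrite /GRing.scale /=; case: m => [|k]; first by rewrite oppr0 !mul0r.
    have xk : x ^+ k != 0 by rewrite expf_neq0.
    rewrite /= exprVn !exprS expr0; move: (x ^+ k) xk => y y0.
    by field; rewrite ?y0 ?xn0.
  have := is_deriveM dX dE; move/is_derive1_eq; apply.
  rewrite /GRing.scale /= /flat x0 !exprS expr0.
  have xm : x ^+ m != 0 by rewrite expf_neq0.
  move: (expR _) => e; move: (x ^+ m) xm => y y0.
  by field; rewrite ?y0 ?xn0.
- have -> : - m%:R * flat m.+1 0 + flat m.+2 0 = 0 :> R.
    by rewrite /flat ltxx mulr0 addr0.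
  apply: (@is_derive_sqr_bound _ (m.+2)`!%:R); first by rewrite /flat ltxx.
  exact: flat_bound.
Qed.

Lemma C1k_flat n m : C1k n (flat m).
Proof.
elim: n m => [|n IH] m; apply: (C1k_intro (is_derive_flat m)) => //.
by apply: C1kD => //; exact: C1kZ.
Qed.

Lemma flat_ge0 m x : 0 <= flat m x.
Proof.
rewrite /flat; case: ifPn => // x0.
by rewrite mulr_ge0 ?expR_ge0// invr_ge0 exprn_ge0// ltW.
Qed.

End Smooth.

(** * Test functions *)

Section Tests.
Variable R : realType.
Implicit Types (f v phi : fun2 R) (i : 'I_2) (Omega : set (point2 R)).

Lemma ord2P i : i = 0 \/ i = 1.
Proof. by case: i => [[|[|//]] ?]; [left|right]; exact/val_inj. Qed.

Definition tens (al be : R -> R) : fun2 R := fun x => al x.1 * be x.2.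

Lemma is_derive_tens0 al be (x : point2 R) d :
  is_derive (x.1 : R) (1 : R) al d ->
  is_derive x (basis_vec R 0) (tens al be) (d * be x.2).
Proof.
case: x => t y /= ald.
have H : is_derive (t : R) (1 : R) (fun s => tens al be (s, y)) (d * be y).
  have := is_deriveM ald (is_derive_cst (be y) t (1 : R)).
  by move/is_derive1_eq; apply; rewrite scaler0 add0r /GRing.scale /= mulrC.
split; first by apply/derivable_slice0; exact: ex_derive.
by rewrite derive_slice0; exact: derive_val.
Qed.

Lemma is_derive_tens1 al be (x : point2 R) d :
  is_derive (x.2 : R) (1 : R) be d ->
  is_derive x (basis_vec R 1) (tens al be) (al x.1 * d).
Proof.
case: x => y t /= bed.
have H : is_derive (t : R) (1 : R) (fun s => tens al be (y, s)) (al y * d).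
  have := is_deriveM (is_derive_cst (al y) t (1 : R)) bed.
  by move/is_derive1_eq; apply; rewrite scaler0 addr0 /GRing.scale /= mulrC.
split; first by apply/derivable_slice1; exact: ex_derive.
by rewrite derive_slice1; exact: derive_val.
Qed.

Lemma continuous_fst2 : continuous (fst : point2 R -> R).
Proof. by move=> x; exact: cvg_fst. Qed.

Lemma continuous_snd2 : continuous (snd : point2 R -> R).
Proof. by move=> x; exact: cvg_snd. Qed.

Lemma continuous_tens al be : continuous al -> continuous be ->
  continuous (tens al be).
Proof.
move=> cal cbe x; apply: (@continuousM _ _ (al \o fst) (be \o snd)).
  by apply: continuous_comp; [exact: continuous_fst2|exact: cal].
by apply: continuous_comp; [exact: continuous_snd2|exact: cbe].
Qed.

Lemma Ck_tens k al be : C1k k al -> C1k k be -> Ck k (tens al be).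
Proof.
elim: k al be => [|k IH] al be Ca Cb;
  have ct := continuous_tens (C1k_continuous Ca) (C1k_continuous Cb); split => //.
move=> i; have [->|->] := ord2P i.
  have D x := is_derive_tens0 be (C1k_is_derive x.1 Ca).
  split=> [x|]; first exact: ex_derive.
  have -> : 'D_(basis_vec R 0) (tens al be) = tens (derive1 al) be.
    by apply/funext => x; exact: derive_val.
  by apply: IH; [case: Ca|exact: C1kS].
have D x := is_derive_tens1 al (C1k_is_derive x.2 Cb).
split=> [x|]; first exact: ex_derive.
have -> : 'D_(basis_vec R 1) (tens al be) = tens al (derive1 be).
  by apply/funext => x; exact: derive_val.
by apply: IH; [exact: C1kS|case: Cb].
Qed.

Lemma compact_cbox (a b c d : R) : compact (cbox a b c d).
Proof. by rewrite cboxE; apply: compact_setX; exact: segment_compact. Qed.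

Lemma test_tens Omega (a b c d : R) al be :
  (forall k, C1k k al) -> (forall k, C1k k be) ->
  (forall t, ~ (a <= t <= b) -> al t = 0) ->
  (forall t, ~ (c <= t <= d) -> be t = 0) ->
  cbox a b c d `<=` Omega -> test_function Omega (tens al be).
Proof.
move=> Ca Cb sa sb sub; split; first by move=> k; exact: Ck_tens.
exists (cbox a b c d); split=> //; first exact: compact_cbox.
move=> x xK; rewrite /tens.
have [x1|x1] := pselect (a <= x.1 <= b); last by rewrite sa// mul0r.
by rewrite sb ?mulr0// => x2; apply: xK.
Qed.

Lemma Ck_continuous k f : Ck k f -> continuous f.
Proof. by case: k => [|k] []. Qed.

Lemma closed_compact2 (K : set (point2 R)) : compact K -> closed K.
Proof. by apply: compact_closed; exact: norm_hausdorff. Qed.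

Lemma test_partial Omega phi i : test_function Omega phi ->
  test_function Omega ('D_(basis_vec R i) phi).
Proof.
case=> Cp [K [cK KO phiK]]; split.
  by move=> k; have [_ /(_ i)[]] := Cp k.+1.
exists K; split => // x xK.
rewrite -(derive_cst (0 : R) x (basis_vec R i)); apply: near_eq_derive.
have : \forall y \near x, (~` K) y.
  by apply: open_nbhs_nbhs; split => //; apply: closed_openC; exact: closed_compact2.
by apply: filterS => y /phiK.
Qed.

Lemma test_partials Omega phi (l : seq 'I_2) : test_function Omega phi ->
  test_function Omega (partial l phi).
Proof. by move=> tphi; elim: l => //= i l IH; exact: test_partial. Qed.

Lemma test_continuous Omega phi : test_function Omega phi -> continuous phi.
Proof. by case=> /(_ 0%N)/Ck_continuous. Qed.

Lemma test_out Omega phi x : test_function Omega phi -> ~ Omega x -> phi x = 0.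
Proof. by case=> _ [K [_ KO phiK]] Ox; apply: phiK => /KO. Qed.

Lemma test_supp Omega phi : test_function Omega phi ->
  exists2 M, 0 < M & supp_in M phi.
Proof. by case=> _ [K [cK _ phiK]]; exact: compact_support_in phiK. Qed.

Lemma test_L2T Omega phi : test_function Omega phi -> L2 setT phi.
Proof.
move=> tphi; have [M M0 sM] := test_supp tphi.
exact: supp_L2 (ltW M0) (test_continuous tphi) sM.
Qed.

Lemma test_L2 Omega D phi : measurable2 D -> test_function Omega phi -> L2 D phi.
Proof. by move=> mD /test_L2T; apply: L2S => //; exact: measurableT. Qed.

Lemma test_derivable Omega phi i x : test_function Omega phi ->
  derivable phi x (basis_vec R i).
Proof. by case=> /(_ 1%N) [_ /(_ i)[]]. Qed.

Lemma int2_supp D f : (forall x, ~ D x -> f x = 0) -> int2 D f = int2 setT f.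
Proof.
move=> fD; rewrite int2_mkcond; apply: int2_eq => x _.
by rewrite patchE; case: ifPn => //; rewrite notin_setE => /fD.
Qed.

Lemma continuous_mul2 f g : continuous f -> continuous g ->
  continuous (fun x => f x * g x).
Proof. by move=> cf cg x; apply: (@continuousM _ _ f g); [exact: cf|exact: cg]. Qed.

Lemma continuous_add2 f g : continuous f -> continuous g ->
  continuous (fun x => f x + g x).
Proof. by move=> cf cg x; apply: (@continuousD _ _ _ f g); [exact: cf|exact: cg]. Qed.

(** The product with a test function has compact support, so that its partial derivative integrates
    to zero. *)
Lemma int2_by_parts Omega v phi i : Ck 1 v -> test_function Omega phi ->
  int2 setT (fun x => 'D_(basis_vec R i) v x * phi x)
    = - int2 setT (fun x => v x * 'D_(basis_vec R i) phi x).
Proof.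
move=> [cv Cv] tphi; have [dv [cdv _]] := Cv i.
have tD := test_partial i tphi.
have [M M0 sM] := test_supp tphi.
have [M' M'0 sM'] := test_supp tD.
have cphi := test_continuous tphi; have cD := test_continuous tD.
have i1 : integrable2 setT (fun x => 'D_(basis_vec R i) v x * phi x).
  apply: (@supp_integrable _ _ M); first exact: ltW.
    exact: continuous_mul2.
  by move=> x /sM ->; rewrite mulr0.
have i2 : integrable2 setT (fun x => v x * 'D_(basis_vec R i) phi x).
  apply: (@supp_integrable _ _ M'); first exact: ltW.
    exact: continuous_mul2.
  by move=> x /sM' ->; rewrite mulr0.
have E x : 'D_(basis_vec R i) (v * phi) x =
    'D_(basis_vec R i) v x * phi x + v x * 'D_(basis_vec R i) phi x.
  rewrite (deriveM (dv x) (test_derivable tphi)).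
  by rewrite /GRing.scale /= addrC mulrC.
have cE : continuous ('D_(basis_vec R i) (v * phi)).
  rewrite (funext E); apply: continuous_add2; exact: continuous_mul2.
have sv : supp_in M (v * phi) by move=> x /sM E0; rewrite fctE E0 mulr0.
have dvp x : derivable (v * phi) x (basis_vec R i).
  exact: (derivableM (dv x) (test_derivable tphi)).
have := int2_partial_supp M0 sv dvp cE.
rewrite (int2_eq (fun x _ => E x)) int2D//; last exact: measurableT.
by move/eqP; rewrite addr_eq0 => /eqP.
Qed.

Lemma Ck1M f g : Ck 1 f -> Ck 1 g -> Ck 1 (f * g).
Proof.
move=> [cf Cf] [cg Cg]; split; first exact: (continuous_mul2 cf cg).
move=> i; have [df [cdf _]] := Cf i; have [dg [cdg _]] := Cg i.
split; first by move=> x; exact: (derivableM (df x) (dg x)).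
split=> [|//]; have -> : 'D_(basis_vec R i) (f * g) =
    (fun x => f x * 'D_(basis_vec R i) g x + g x * 'D_(basis_vec R i) f x).
  by apply/funext => x; rewrite (deriveM (df x) (dg x)).
exact: (continuous_add2 (continuous_mul2 cf cdg) (continuous_mul2 cg cdf)).
Qed.

Lemma C1k_id n : C1k n (@id R).
Proof.
apply: (@C1k_intro _ _ _ (cst 1) (fun t => is_derive_id t _)).
by case: n => // n; exact: C1k_cst.
Qed.

(** Integration by parts with x_1 phi turns the integral of phi^2 into -2 times that of x_1 phi d_1
    phi. Since |x_1| <= M on [Omega], Young's inequality bounds the integrand by phi^2 / 2 + 2 M^2
    (d_1 phi)^2, and half of the left-hand side is absorbed. *)
Lemma friedrichs_partial0 Omega M phi : 0 < M ->
  Omega `<=` cbox (- M) M (- M) M -> test_function Omega phi ->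
  int2 setT (fun x => phi x ^+ 2)
    <= 4 * M ^+ 2 * int2 setT (fun x => 'D_(basis_vec R 0) phi x ^+ 2).
Proof.
move=> M0 OM tphi; have mT := @measurableT _ (mpoint2 R).
pose X := tens (@id R) (cst 1).
have tD := test_partial 0 tphi.
have CX : Ck 1 X by apply: Ck_tens; [exact: C1k_id|exact: C1k_cst].
have Cphi : Ck 1 phi by case: tphi.
have DX x : 'D_(basis_vec R 0) X x = 1.
  have := is_derive_tens0 (cst 1) (is_derive_id x.1 (1 : R)).
  by move=> h; rewrite derive_val mul1r.
have dX x : derivable X x (basis_vec R 0) by have [_ /(_ 0)[]] := CX.
have XE x : X x = x.1 by rewrite /X /tens mulr1.
have L1 := test_L2T tphi; have L2' := test_L2T tD.
have i1 := L2_integrable_sqr mT L1; have i2 := L2_integrable_sqr mT L2'.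
have := int2_by_parts 0 (Ck1M CX Cphi) tphi.
have LX : L2 setT (X * phi).
  have [M' M'0 sM'] := test_supp tphi.
  apply: (@supp_L2 _ _ M'); first exact: ltW.
    by case: (Ck1M CX Cphi).
  by move=> x /sM' E0; rewrite fctE E0 mulr0.
have iX := L2_integrableM mT LX L2'.
have E x : 'D_(basis_vec R 0) (X * phi) x * phi x =
    phi x ^+ 2 + (X * phi) x * 'D_(basis_vec R 0) phi x.
  rewrite deriveM//; last exact: test_derivable tphi.
  by rewrite DX /GRing.scale /= -[(X * phi) x]/(X x * phi x); ring.
rewrite (int2_eq (fun x _ => E x)) int2D// => H.
have {}H : int2 setT (fun x => phi x ^+ 2) =
    - 2 * int2 setT (fun x => (X * phi) x * 'D_(basis_vec R 0) phi x) by lra.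
have : int2 setT (fun x => - 2 * ((X * phi) x * 'D_(basis_vec R 0) phi x)) <=
   int2 setT (fun x => 2^-1 * phi x ^+ 2 + 2 * M ^+ 2 * 'D_(basis_vec R 0) phi x ^+ 2).
  apply: int2_le => //.
  - exact: integrable2Z.
  - by apply: integrable2D => //; exact: integrable2Z.
  move=> x _; rewrite -[(X * phi) x]/(X x * phi x) XE.
  have [Ox|Ox] := pselect (Omega x); last first.
    by rewrite (test_out tphi Ox) (test_out tD Ox) !(mulr0, mul0r, expr0n) addr0.
  have [/andP[? ?] _] := OM _ Ox.
  have M2 : x.1 ^+ 2 <= M ^+ 2 by nra.
  set a := phi x; set b := 'D_(_) phi x.
  have : x.1 ^+ 2 * b ^+ 2 <= M ^+ 2 * b ^+ 2 by rewrite ler_wpM2r ?sqr_ge0.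
  have := sqr_ge0 (a + 2 * x.1 * b); nra.
rewrite int2Z// int2D//; try exact: integrable2Z.
by rewrite !int2Z//; lra.
Qed.

End Tests.

(** * Functions biorthogonal to the monomials *)

Section OneDim.
Variable R : realType.
Implicit Types (f g : R -> R).
Notation mu := (@lebesgue_measure R).

Definition int1 f : R := (\int[mu]_x f x)%R.

Definition supp1 (a b : R) f := forall t, ~ (a <= t <= b) -> f t = 0.

Lemma supp1_E a b f : supp1 a b f -> f = f \_ `[a, b]%classic.
Proof.
move=> sf; apply/funext => t; rewrite patchE; case: ifPn => //.
by rewrite notin_setE /= in_itv /= => /sf.
Qed.

Lemma supp1_integrable a b f : continuous f -> supp1 a b f ->
  mu.-integrable setT (EFin \o f).
Proof.
move=> cf /supp1_E ->; rewrite -restrict_EFin.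
have mI : measurable (`[a, b]%classic : set (measurableTypeR R)) by exact: measurable_itv.
apply: (iffLR (integrable_mkcond _ mI)).
apply: continuous_compact_integrable; first exact: segment_compact.
exact: continuous_subspaceT.
Qed.

Lemma int1_supp a b f : supp1 a b f ->
  int1 f = (\int[mu]_(x in `[a, b]) f x)%R.
Proof.
move=> /supp1_E sf; rewrite [RHS](Rintegral_mkcond mu `[a, b]%classic).
by rewrite -sf.
Qed.

Lemma int1D a b f g : continuous f -> supp1 a b f -> continuous g -> supp1 a b g ->
  int1 (fun t => f t + g t) = int1 f + int1 g.
Proof.
move=> cf sf cg sg; apply: (@RintegralD _ _ R mu); first exact: measurableT.
  exact: supp1_integrable sf.
exact: supp1_integrable sg.
Qed.

Lemma int1Z a b f (c : R) : continuous f -> supp1 a b f ->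
  int1 (fun t => c * f t) = c * int1 f.
Proof.
move=> cf sf; apply: (@RintegralZl _ _ R mu); first exact: measurableT.
exact: supp1_integrable sf.
Qed.

Lemma int1_sum (I : finType) a b (c : I -> R) (F : I -> R -> R) :
  (forall i, continuous (F i)) -> (forall i, supp1 a b (F i)) ->
  int1 (fun t => \sum_i c i * F i t) = \sum_i c i * int1 (F i).
Proof.
move=> cF sF.
have cs (s : seq I) : continuous (fun t => \sum_(i <- s) c i * F i t).
  elim: s => [|i s IH].
    by under [X in continuous X]funext do rewrite big_nil; exact: cst_continuous.
  under [X in continuous X]funext do rewrite big_cons.
  move=> t; apply: (@continuousD _ _ _ (fun t => c i * F i t)); last exact: IH.
  by apply: (@continuousM _ _ (cst (c i))); [exact: cst_continuous|exact: cF].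
have ss (s : seq I) : supp1 a b (fun t => \sum_(i <- s) c i * F i t).
  by move=> t tM; apply: big1 => i _; rewrite sF// mulr0.
elim: (index_enum I) => [|i s IH].
  rewrite big_nil; under [X in int1 X]funext do rewrite big_nil.
  by rewrite /int1 (Rintegral_cst mu measurableT) mul0r.
rewrite big_cons -IH; under [X in int1 X]funext do rewrite big_cons.
rewrite (@int1D a b _ _ _ _ (cs s) (ss s)); first by rewrite (int1Z _ (cF i) (sF i)).
  by move=> t; apply: (@continuousM _ _ (cst (c i))); [exact: cst_continuous|exact: cF].
by move=> t tM; rewrite sF// mulr0.
Qed.

Lemma C1k_horner n (p : {poly R}) : C1k n (horner p).
Proof.
elim: n p => [|n IH] p; apply: (@C1k_intro _ _ _ (horner p^`())) => // t;
  exact: is_derive_poly.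
Qed.

Lemma int1_by_parts (M : R) (p : {poly R}) f : 0 < M -> C1k 1 f -> supp1 (- M) M f ->
  int1 (fun t => p.[t] * derive1 f t) = - int1 (fun t => p^`().[t] * f t).
Proof.
move=> M0 Cf sf; have Cp := C1k_horner 1 p.
have cp := C1k_continuous (C1k_horner 0 p).
have cp' := C1k_continuous (C1k_horner 0 p^`()).
have cf := C1k_continuous Cf; have cf' := @C1k_continuous _ 0 (derive1 f) (proj2 Cf).
have sf' := derive1_out sf.
have E : derive1 (fun t => p.[t] * f t) = (fun t => p.[t] * derive1 f t + p^`().[t] * f t).
  apply/funext => t; apply: is_derive1E.
  have := is_deriveM (is_derive_poly p t) (C1k_is_derive t Cf).
  by move/is_derive1_eq; apply; rewrite /GRing.scale /= addrC [f t * _]mulrC addrC.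
have := @integral_derive1_supp _ (fun t => p.[t] * f t) _ M0; rewrite E => H.
have c1 : continuous (fun t => p.[t] * derive1 f t).
  by move=> t; apply: (@continuousM _ _ (horner p)); [exact: cp|exact: cf'].
have c2 : continuous (fun t => p^`().[t] * f t).
  by move=> t; apply: (@continuousM _ _ (horner p^`())); [exact: cp'|exact: cf].
have {}H : int1 (fun t => p.[t] * derive1 f t + p^`().[t] * f t) = 0.
  rewrite /int1 /Rintegral H //.
  - exact (C1k0 (C1kM Cp Cf)).
  - by move=> t; apply: (@continuousD _ _ _ (fun t => p.[t] * derive1 f t)); [exact: c1|exact: c2].
  - by move=> t /sf ->; rewrite mulr0.
apply/eqP; rewrite -addr_eq0 -(@int1D (- M) M) ?H//.
  by move=> t /sf' ->; rewrite mulr0.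
by move=> t /sf ->; rewrite mulr0.
Qed.

Lemma affine_int1 f (M c s : R) : 0 < M -> 0 < s -> continuous f -> supp1 (- M) M f ->
  int1 (fun t => f (s^-1 * t + - (c / s))) = s * int1 f.
Proof.
move=> M0 s0 cf sf; pose F t := s^-1 * t + - (c / s).
have s0' : s != 0 by rewrite gt_eqF.
have dF t : is_derive (t : R) (1 : R) F s^-1 by exact: is_derive_affine.
have F' : derive1 F = cst s^-1 by apply/funext => t; exact: is_derive1E.
have cF : continuous F by exact: C1k_continuous (C1k_affine s^-1 (- (c / s)) (@C1k_id R 0)).
have ab : c - s * M < c + s * M by have := mulr_gt0 s0 M0; lra.
have Fa : F (c - s * M) = - M by rewrite /F; field.
have Fb : F (c + s * M) = M by rewrite /F; field.
have cfF : continuous (fun t => f (F t)).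
  by move=> t; apply: (@continuous_comp _ _ _ F f); [exact: cF|exact: cf].
have sfF : supp1 (c - s * M) (c + s * M) (fun t => f (F t)).
  move=> t tM; apply: sf => /andP[h1 h2]; apply: tM.
  have e : s * F t = t - c by rewrite /F; field.
  have := ler_wpM2l (ltW s0) h1; have := ler_wpM2l (ltW s0) h2.
  by rewrite e mulrN => *; apply/andP; split; lra.
rewrite (int1_supp sfF) (int1_supp sf).
have -> : `[- M, M]%classic = `[F (c - s * M), F (c + s * M)]%classic by rewrite Fa Fb.
rewrite /Rintegral (@integration_by_substitution_increasing _ F f) ?ltW//.
- rewrite F'; under [in RHS]eq_integral => t _ do rewrite /= mulrC EFinM.
  rewrite integralZl//=; last first.
    apply: continuous_compact_integrable; first exact: segment_compact.
    exact: continuous_subspaceT.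
  have fI : (\int[mu]_(x in `[(c - s * M)%R, (c + s * M)%R]) (f (F x))%:E)%E \is a fin_num.
    apply: integrable_fin_num; first exact: measurable_itv.
    apply: continuous_compact_integrable; first exact: segment_compact.
    exact: continuous_subspaceT.
  by rewrite fineM// mulrA divff// mul1r.
- by move=> x y _ _ xy; rewrite /F ltrD2r ltr_pM2l// invr_gt0.
- by rewrite F' => x _; exact: cst_continuous.
- by rewrite F'; exact: is_cvg_cst.
- by rewrite F'; exact: is_cvg_cst.
- split; [by move=> x _; exact: ex_derive|exact: cvg_at_right_filter (cF _)|exact: cvg_at_left_filter (cF _)].
- exact: continuous_subspaceT.
Qed.

Definition mollifier (t : R) : R := flat 0 (1 * t + 1) * flat 0 ((-1) * t + 1).

Lemma C1k_mollifier n : C1k n mollifier.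
Proof. by apply: C1kM; apply: C1k_affine; exact: C1k_flat. Qed.

Lemma mollifier_supp : supp1 (-1) 1 mollifier.
Proof.
move=> t tM; rewrite /mollifier /flat; case: ifPn => t1; last by rewrite mul0r.
case: ifPn => t2; last by rewrite mulr0.
by exfalso; apply: tM; lra.
Qed.

Lemma mollifier_int1_gt0 : 0 < int1 mollifier.
Proof.
have m0 t : 0 <= mollifier t by rewrite mulr_ge0// flat_ge0.
have cm := C1k_continuous (C1k_mollifier 0).
have sm := mollifier_supp.
(* On [-1/2, 1/2] both factors have an argument of at least 1/2 and hence a value of at least
   exp(-2). *)
pose d : R := expR (- 2) ^+ 2.
have d0 : 0 < d by rewrite exprn_gt0// expR_gt0.
have md t : - 2^-1 <= t <= 2^-1 -> d <= mollifier t.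
  move=> /andP[t1 t2]; rewrite /mollifier /flat.
  have half (x : R) : 2^-1 <= x -> expR (- 2) <= (if 0 < x then x ^- 0 * expR (- x^-1) else 0).
    move=> x2; have x0 : 0 < x by rewrite (lt_le_trans _ x2)// invr_gt0.
    rewrite x0 expr0 invr1 mul1r ler_expR lerN2 -[leRHS]invrK lef_pV2// posrE// invr_gt0//.
  by rewrite /d expr2 ler_pM ?expR_ge0//; apply: half; lra.
have mI : measurable (`[- 2^-1, 2^-1]%classic : set (measurableTypeR R)) by exact: measurable_itv.
apply: (@lt_le_trans _ _ (int1 (cst d \_ `[- 2^-1, 2^-1]%classic))).
  rewrite /int1 -(Rintegral_mkcond mu `[- 2^-1, 2^-1]%classic) (Rintegral_cst mu mI).
  have E : mu `[- 2^-1, 2^-1]%classic = 1%:E.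
    have h : - 2^-1 < 2^-1 :> R by lra.
    rewrite lebesgue_measure_itv /= lte_fin h.
    by rewrite -EFinB; congr EFin; lra.
  apply: mulr_gt0 => //; apply: (@lt_le_trans _ _ 1) => //.
  by rewrite le_eqVlt; apply/orP; left; apply/eqP; exact: (esym (congr1 fine E)).
apply: (@le_Rintegral _ _ R mu); first exact: measurableT.
- rewrite -restrict_EFin; apply: (iffLR (integrable_mkcond _ mI)).
  apply: continuous_compact_integrable; first exact: segment_compact.
  by apply: continuous_subspaceT; exact: cst_continuous.
- exact: supp1_integrable sm.
- move=> t _; rewrite patchE; case: ifPn => // tI; apply: md.
  by move: tI; rewrite inE /= in_itv.
Qed.

Lemma iter_derive_mollifier k : (forall n, C1k n (iter k (@derive1 R R) mollifier)) /\
  supp1 (-1) 1 (iter k (@derive1 R R) mollifier).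
Proof.
elim: k => [|k [IH1 IH2]]; first by split; [exact: C1k_mollifier|exact: mollifier_supp].
split=> [n|/=]; first by have [] := IH1 n.+1.
exact: derive1_out IH2.
Qed.

(** Integration by parts moves the derivatives to the polynomial; in particular, monomials of degree
    below [k] are annihilated. *)
Lemma moment_mollifier k (p : {poly R}) :
  int1 (fun t => p.[t] * iter k (@derive1 R R) mollifier t)
    = (-1) ^+ k * int1 (fun t => p^`(k).[t] * mollifier t).
Proof.
elim: k p => [|k IH] p; first by rewrite expr0 mul1r.
have [C S] := iter_derive_mollifier k.
by rewrite (int1_by_parts _ ltr01 (C _) S) IH -derivSn exprS !mulN1r mulNr.
Qed.

(* The moments of the derivatives of the mollifier form a triangular matrix. *)
Lemma biorthogonal_exists n : exists phi : nat -> R -> R,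
  [/\ forall k m, C1k m (phi k), forall k, supp1 (-1) 1 (phi k) &
      forall m k, (m < n)%N -> (k < n)%N ->
        int1 (fun t => t ^+ m * phi k t) = (m == k)%:R].
Proof.
case: n => [|n].
  exists (fun _ => cst 0); split=> // *; exact: C1k_cst.
pose D (i : nat) := iter i (@derive1 R R) mollifier.
pose B : 'M[R]_n.+1 := \matrix_(m, i) int1 (fun t => t ^+ m * D i t).
have cX m : continuous (fun t : R => t ^+ m) by exact: exprn_continuous.
have BE (m i : nat) : int1 (fun t => t ^+ m * D i t) =
    (-1) ^+ i * int1 (fun t => ('X^m)^`(i).[t] * mollifier t).
  rewrite -moment_mollifier; congr int1; apply/funext => t.
  by rewrite hornerXn.
have trigB : is_trig_mx B.
  apply/is_trig_mxP => m i mi; rewrite mxE BE derivnXn ffact_small// mulr0n.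
  rewrite (_ : (fun t => _) = cst 0); last by apply/funext => t; rewrite horner0 mul0r.
  by rewrite /int1 Rintegral_cst ?mul0r ?mulr0//; exact: measurableT.
(* The diagonal entries are (-1)^i i! times the positive integral of the mollifier. *)
have uB : B \in unitmx.
  rewrite unitmxE det_trig// unitfE; apply/prodf_neq0 => i _; rewrite mxE BE /=.
  rewrite derivnXn subnn ffactnn expr0 mulf_neq0 ?expf_neq0 ?oppr_eq0 ?oner_eq0//.
  rewrite (_ : (fun t => _) = (fun t => i`!%:R * mollifier t)); last first.
    by apply/funext => t; rewrite hornerMn hornerC.
  rewrite (int1Z _ (C1k_continuous (C1k_mollifier 0)) mollifier_supp).
  by rewrite mulf_neq0 ?pnatr_eq0 -?lt0n ?fact_gt0// gt_eqF// mollifier_int1_gt0.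
(* Column [k] of the inverse matrix lists the coefficients of the function dual to t^k. *)
exists (fun k t => \sum_(i < n.+1) (invmx B) i (inord k) * D i t); split.
- by move=> k m; apply: C1k_sum => i; apply: C1kZ; have [] := iter_derive_mollifier i.
- move=> k t /= tM; apply: big1 => i _.
  by have [_ E] := iter_derive_mollifier i; rewrite /D (E t tM) mulr0.
move=> m k mn kn.
have H : (B *m invmx B) (inord m) (inord k) = (m == k)%:R.
  by rewrite mulmxV// mxE -val_eqE /= !inordK.
rewrite -H mxE.
transitivity (int1 (fun t => \sum_(i < n.+1) (invmx B) i (inord k) * (t ^+ m * D i t))).
  by congr int1; apply/funext => t; rewrite mulr_sumr; apply: eq_bigr => i _; rewrite mulrCA.
have cD i := C1k_continuous ((iter_derive_mollifier i).1 0%N).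
have sD i := (iter_derive_mollifier i).2.
have cF i : continuous (fun t : R => t ^+ m * D i t).
  by move=> t; apply: (@continuousM _ _ (fun t : R => t ^+ m)); [exact: cX|exact: cD].
have sF i : supp1 (-1) 1 (fun t => t ^+ m * D i t) by move=> t tM; rewrite /D (sD i t tM) mulr0.
rewrite (int1_sum (fun i : 'I_n.+1 => (invmx B) i (inord k)) (fun i : 'I_n.+1 => cF i) (fun i : 'I_n.+1 => sF i)).
by apply: eq_bigr => i _; rewrite !mxE /= inordK// mulrC.
Qed.

Lemma int2_tens (M : R) f g : 0 < M -> continuous f -> supp1 (- M) M f ->
  continuous g -> supp1 (- M) M g -> int2 setT (tens f g) = int1 f * int1 g.
Proof.
move=> M0 cf sf cg sg.
have fgi : integrable2 setT (tens f g).
  apply: (@supp_integrable _ _ M); [exact: ltW|exact: continuous_tens|].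
  move=> x xM; rewrite /tens; have [h|h] := pselect (- M <= x.1 <= M).
    by rewrite sg ?mulr0// => h'; apply: xM.
  by rewrite sf// mul0r.
have gi := supp1_integrable cg sg; have fi := supp1_integrable cf sf.
have gfin : (\int[mu]_y (g y)%:E)%E = (int1 g)%:E.
  by rewrite fineK//; apply: integrable_fin_num => //; exact: measurableT.
rewrite /int2 /Rintegral /leb2 -(integral12_prod_meas1 fgi).
transitivity (fine (\int[mu]_x ((int1 g)%:E * (f x)%:E))%E).
  congr fine; apply: eq_integral => x _.
  rewrite /fubini_F /= /tens /=.
  under eq_integral do rewrite EFinM.
  by rewrite integralZl//= gfin muleC.
rewrite integralZl//= fineM//; first by rewrite mulrC.
by apply: integrable_fin_num => //; exact: measurableT.
Qed.

End OneDim.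

(** * The fundamental lemma of the calculus of variations *)

Section FundamentalLemma.
Variable R : realType.
Implicit Types (g : fun2 R) (Omega : set (point2 R)).

Definition obox (a b c d : R) : set (point2 R) :=
  [set x | (a < x.1 < b) /\ (c < x.2 < d)].

Definition oboxes : set (set (mpoint2 R)) :=
  [set A | exists a b c d, A = obox a b c d].

Lemma oboxE a b c d : obox a b c d = `]a, b[%classic `*` `]c, d[%classic.
Proof. by apply/seteqP; split=> x [] /=; rewrite ?in_itv /= ?in_itv /=. Qed.

Lemma measurable2_obox a b c d : measurable2 (obox a b c d).
Proof. by rewrite oboxE; apply: measurableX; exact: measurable_itv. Qed.

Lemma oboxI a b c d a' b' c' d' : obox a b c d `&` obox a' b' c' d' =
  obox (Num.max a a') (Num.min b b') (Num.max c c') (Num.min d d').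
Proof.
apply/seteqP; split=> x; rewrite /obox /=.
  by move=> [[/andP[? ?] /andP[? ?]] [/andP[? ?] /andP[? ?]]]; split;
    rewrite gt_max lt_min; do 3 (apply/andP; split => //).
by rewrite !gt_max !lt_min => -[/andP[/andP[-> ->] /andP[-> ->]] /andP[/andP[-> ->] /andP[-> ->]]].
Qed.

Lemma sigma_sub_preimage (h : mpoint2 R -> measurableTypeR R) :
  (forall a b, (<<s oboxes >>) (h @^-1` `]a, b[%classic)) ->
  forall A, measurable A -> (<<s oboxes >>) (h @^-1` A).
Proof.
move=> hab A; rewrite [X in X A](RGenOpens.measurableE R) => mA.
pose S := [set A : set R | (<<s oboxes >>) (h @^-1` A)].
have : <<s @RGenOpens.G R >> `<=` S.
  apply: smallest_sub.
    split; rewrite /S /=.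
    - by rewrite preimage_set0; exact: sigma_algebra0.
    - move=> B mB; rewrite setTD preimage_setC -setTD.
      exact: sigma_algebraCD.
    - by move=> F mF; rewrite preimage_bigcup; exact: sigma_algebra_bigcup.
  by move=> _ [a [b ->]]; exact: hab.
exact.
Qed.

(** The product sigma-algebra is generated by preimages under the projections; the preimage of an
    open interval is a strip and thus a countable union of boxes. *)
Lemma measurable2_oboxes : @measurable _ (mpoint2 R) = <<s oboxes >>.
Proof.
apply/seteqP; split; last first.
  apply: smallest_sub; first exact: sigma_algebra_measurable.
  by move=> _ [a [b [c [d ->]]]]; exact: measurable2_obox.
apply: smallest_sub; first exact: smallest_sigma_algebra.
move=> B [] [A mA <-]; rewrite setTI; apply: sigma_sub_preimage mA => a b.
  rewrite (_ : _ @^-1` _ = \bigcup_n obox a b (- n%:R) n%:R).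
    apply: sigma_algebra_bigcup => n; apply: sub_sigma_algebra.
    by exists a, b, (- n%:R), n%:R.
  apply/seteqP; split=> x /=; last by move=> [n _] []; rewrite in_itv.
  rewrite in_itv /= => xab; exists (Num.bound `|x.2|) => //; split => //.
  by rewrite -ltr_norml; exact: archi_boundP.
rewrite (_ : _ @^-1` _ = \bigcup_n obox (- n%:R) n%:R a b).
  apply: sigma_algebra_bigcup => n; apply: sub_sigma_algebra.
  by exists (- n%:R), n%:R, a, b.
apply/seteqP; split=> x /=; last by move=> [n _] []; rewrite in_itv.
rewrite in_itv /= => xab; exists (Num.bound `|x.1|) => //; split => //.
by rewrite -ltr_norml; exact: archi_boundP.
Qed.

Lemma oboxes_setI : setI_closed oboxes.
Proof.
move=> _ _ [a [b [c [d ->]]]] [a' [b' [c' [d' ->]]]].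
by rewrite oboxI; do 4 eexists.
Qed.

(** Scaling by [n.+1] sharpens the flanks: as exp(-1/(n x)) tends to 1 for x > 0, these smooth
    functions with values in [0, 1] tend to the indicator of the open interval. *)
Definition plateau (a b : R) (n : nat) (t : R) : R :=
  flat 0 (n.+1%:R * t + (- (n.+1%:R * a))) * flat 0 (- n.+1%:R * t + n.+1%:R * b).

Lemma C1k_plateau a b n k : C1k k (plateau a b n).
Proof. by apply: C1kM; apply: C1k_affine; exact: C1k_flat. Qed.

Lemma plateau_supp a b n t : ~ (a < t < b) -> plateau a b n t = 0.
Proof.
move=> tab; rewrite /plateau /flat; have n0 := ler0n R n.+1.
case: ifPn => t1; last by rewrite mul0r.
case: ifPn => t2; last by rewrite mulr0.
exfalso; apply: tab; apply/andP; split; rewrite ltNge; apply/negP => h.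
  by have := ler_wpM2l n0 h; lra.
by have := ler_wpM2l n0 h; lra.
Qed.

Lemma flat0_le1 (x : R) : 0 <= flat 0 x <= 1.
Proof.
rewrite flat_ge0 /flat /=; case: ifPn => x0; last exact: ler01.
by rewrite expr0 invr1 mul1r -[leRHS]expR0 ler_expR oppr_le0 invr_ge0 ltW.
Qed.

Lemma plateau_le1 a b n t : 0 <= plateau a b n t <= 1.
Proof.
rewrite /plateau; have /andP[? ?] := flat0_le1 (n.+1%:R * t + (- (n.+1%:R * a))).
have /andP[? ?] := flat0_le1 (- n.+1%:R * t + n.+1%:R * b).
by rewrite mulr_ge0 //= mulr_ile1.
Qed.

Lemma cvg_flat0 (x : R) : 0 < x -> flat 0 (n.+1%:R * x) @[n --> \oo] --> (1 : R).
Proof.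
move=> x0.
have H : - (x^-1 * (@harmonic R n)) @[n --> \oo] --> - (x^-1 * 0).
  by apply: cvgN; apply: cvgM; [exact: cvg_cst|exact: cvg_harmonic].
have := cvg_comp _ _ H (@continuous_expR R _).
rewrite mulr0 oppr0 expR0 => {}H.
rewrite (_ : (fun n => _) = expR \o (fun n => - (x^-1 * (@harmonic R n))))//.
apply/funext => n.
by rewrite /flat mulr_gt0 ?ltr0n// expr0 invr1 mul1r invfM /= mulrC.
Qed.

Lemma cvg_plateau a b t : plateau a b n t @[n --> \oo] --> ((a < t < b)%R%:R : R).
Proof.
case: (boolP (a < t < b)) => tab; last first.
  rewrite (_ : (fun n => _) = cst 0); first exact: cvg_cst.
  by apply/funext => n; rewrite plateau_supp//; exact/negP.
have /andP[ta tb] := tab.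
rewrite (_ : (fun n => _) = (fun n => flat 0 (n.+1%:R * (t - a)) * flat 0 (n.+1%:R * (b - t)))).
  by rewrite -[X in _ --> X](mulr1 1); apply: cvgM; apply: cvg_flat0; rewrite subr_gt0.
by apply/funext => n; rewrite /plateau; congr (flat 0 _ * flat 0 _); ring.
Qed.

Notation mu2 := (@leb2 R).

(** Products of two plateaus are admissible tests that converge to the indicator of the open box.
    The limit passes under the integral since |g| is integrable on the closed box, where constants
    are square integrable. *)
Lemma integral_obox_eq0 Omega g a b c d : open Omega -> L2 Omega g ->
  (forall phi, test_function Omega phi -> int2 Omega (g \* phi) = 0) ->
  cbox a b c d `<=` Omega ->
  (\int[mu2]_(x in (obox a b c d : set (mpoint2 R))) (g x)%:E)%E = 0%E.
Proof.
move=> oO Lg gphi sub; have mO := open_measurable2 oO.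
pose phi n := tens (plateau a b n) (plateau c d n).
have plc a' b' n t : ~ (a' <= t <= b') -> plateau a' b' n t = 0.
  by move=> h; apply: plateau_supp => /andP[? ?]; apply: h; apply/andP; split; lra.
have tphi n : test_function Omega (phi n).
  apply: (@test_tens _ _ a b c d) => //; try by move=> k; exact: C1k_plateau.
    by move=> t; exact: plc.
  by move=> t; exact: plc.
have mB : measurable2 (cbox a b c d) by exact: measurable2_cbox.
have mo : measurable2 (obox a b c d) by exact: measurable2_obox.
have oc : obox a b c d `<=` cbox a b c d.
  by move=> x [/andP[? ?] /andP[? ?]]; split; apply/andP; split; lra.
have [ab|ab] := leP a b; last first.
  rewrite (_ : obox a b c d = set0) ?integral_set0//.
  by apply/seteqP; split=> // x [/andP[? ?] _]; lra.
have [cd|cd] := leP c d; last first.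
  rewrite (_ : obox a b c d = set0) ?integral_set0//.
  by apply/seteqP; split=> // x [_ /andP[? ?]]; lra.
have gB : integrable2 (cbox a b c d) g.
  have LB := L2S mO mB sub Lg.
  have := LB => /(L2P _ mB)[mg _].
  have L1 : L2 (cbox a b c d) (cst 1).
    apply/L2P => //; split; first exact: measurable_cst.
    under [X in integrable2 _ X]funext do rewrite /cst expr1n.
    apply: integrable2_cst => //.
    by rewrite leb2_cbox// ltry.
  have := L2_integrableM mB LB L1.
  by under [X in integrable2 _ X -> _]funext do rewrite /cst mulr1.
have mg := integrable2_mfun gB.
have E n : (\int[mu2]_(x in (cbox a b c d : set (mpoint2 R))) (g x * phi n x)%:E)%E = 0%E.
  have iphi : integrable2 (cbox a b c d) (fun x => g x * phi n x).
    by apply: L2_integrableM => //; [exact: L2S Lg|exact: test_L2 (tphi n)].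
  have : int2 (cbox a b c d) (fun x => g x * phi n x) = 0.
    rewrite -(gphi _ (tphi n)) [LHS]int2_mkcond [RHS]int2_mkcond.
    apply: int2_eq => x _; rewrite !patchE.
    case: ifPn => [/set_mem xB|]; first by rewrite mem_set//; exact: sub.
    rewrite notin_setE => xB; case: ifPn => // _.
    suff E0 : phi n x = 0 by rewrite /= E0 mulr0.
    rewrite /phi /tens; have [h|h] := pselect (a <= x.1 <= b).
      by rewrite (plc c d) ?mulr0// => h'; apply: xB.
    by rewrite plc// mul0r.
  have fI := integrable_fin_num mB iphi.
  by rewrite /int2 /Rintegral => H; rewrite -(fineK fI) H.
pose G x := (g x * \1_(obox a b c d) x)%:E.
have [_ _] : [/\ mu2.-integrable (cbox a b c d : set (mpoint2 R)) G,
   [sequence \int[mu2]_(x in (cbox a b c d : set (mpoint2 R))) `|(g x * phi n x)%:E - G x|]_n%E @ \oo --> 0%E &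
   [sequence \int[mu2]_(x in (cbox a b c d : set (mpoint2 R))) (g x * phi n x)%:E]_n%E @ \oo -->
     (\int[mu2]_(x in (cbox a b c d : set (mpoint2 R))) G x)%E].
  apply: (@dominated_convergence _ _ _ mu2 _ mB (fun n x => (g x * phi n x)%:E) G (fun x => `|g x|%:E)).
  - move=> n; apply/measurable_EFinP; apply: measurable_fun2M => //.
    exact: (test_L2 mB (tphi n)).1.
  - apply/measurable_EFinP; apply: measurable_fun2M => //.
    exact: measurable_indic.
  - apply: aeW => x _; apply: cvg_EFin; first exact: nearW.
    apply: cvgM; first exact: cvg_cst.
    rewrite indicE (_ : _%:R = (a < x.1 < b)%R%:R * (c < x.2 < d)%R%:R).
      by apply: cvgM; exact: cvg_plateau.
    rewrite -natrM mulnb; congr (_%:R); congr nat_of_bool.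
    by apply/idP/andP => [/set_mem//|h]; exact/mem_set.
  - exact: (integrable_norm gB).
  - apply: aeW => x n _; rewrite lee_fin normrM ler_piMr// /phi /tens normrM.
    have /andP[? ?] := plateau_le1 a b n x.1; have /andP[? ?] := plateau_le1 c d n x.2.
    by rewrite !ger0_norm// mulr_ile1.
rewrite (_ : (fun n => _) = cst 0%E); last by apply/funext => n; exact: E.
move=> /(cvg_lim (@ereal_hausdorff _)); rewrite lim_cst; last exact: ereal_hausdorff.
move=> H.
rewrite (_ : obox a b c d = cbox a b c d `&` obox a b c d); last by rewrite setIidr.
rewrite [LHS]integral_mkcondr [RHS]H; apply: eq_integral => x _.
by rewrite patchE /G indicE; case: ifPn => _; rewrite ?mulr1 ?mulr0.
Qed.

(** The sets over which the restriction of [g] to the box integrates to zero form a Dynkin system.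
    It contains the open boxes, which are stable under intersection and generate the sigma-algebra;
    a function with vanishing integral over every measurable set is zero almost everywhere. *)
Lemma ae_eq0_obox Omega g a b c d : open Omega -> L2 Omega g ->
  (forall phi, test_function Omega phi -> int2 Omega (g \* phi) = 0) ->
  cbox a b c d `<=` Omega ->
  {ae mu2, forall x, obox a b c d x -> g x = 0}.
Proof.
move=> oO Lg gphi sub; have mO := open_measurable2 oO.
have mo : measurable2 (obox a b c d) by exact: measurable2_obox.
have oc : obox a b c d `<=` cbox a b c d.
  by move=> x [/andP[? ?] /andP[? ?]]; split; apply/andP; split; lra.
have [ab|ab] := leP a b; last first.
  by apply: aeW => x [/andP[? ?] _]; lra.
have [cd|cd] := leP c d; last first.
  by apply: aeW => x [_ /andP[? ?]]; lra.
have gB : integrable2 (obox a b c d) g.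
  have LB := L2S mO mo (subset_trans oc sub) Lg.
  have L1 : L2 (obox a b c d) (cst 1).
    apply/L2P => //; split; first exact: measurable_cst.
    under [X in integrable2 _ X]funext do rewrite /cst expr1n.
    apply: integrable2_cst => //.
    by rewrite (le_lt_trans (leb2_sub_cbox mo ab cd oc))// ltry.
  have := L2_integrableM mo LB L1.
  by under [X in integrable2 _ X -> _]funext do rewrite /cst mulr1.
pose h := (EFin \o g) \_ (obox a b c d).
have hi : mu2.-integrable setT h by exact: (iffLR (integrable_mkcond _ mo)).
pose P := [set A : set (mpoint2 R) | (\int[mu2]_(x in A) h x)%E = 0%E].
have P0 : P setT.
  rewrite /P /= /h -integral_mkcond.
  exact: (integral_obox_eq0 oO Lg gphi sub).
have PP A : (<<s oboxes >>) A -> P A.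
  apply: (dynkin_induction measurable2_oboxes oboxes_setI P0).
  - move=> _ [a' [b' [c' [d' ->]]]]; rewrite /P /= /h -integral_mkcondr oboxI.
    apply: (integral_obox_eq0 oO Lg gphi).
    move=> x [/andP[h1 h2] /andP[h3 h4]]; apply: sub.
    move: h1 h2 h3 h4; rewrite !ge_max !le_min => /andP[? ?] /andP[? ?] /andP[? ?] /andP[? ?].
    by split; apply/andP; split.
  - move=> B mB; rewrite /P /= => PA.
    have : (\int[mu2]_(x in B `|` ~` B) h x)%E = 0%E by rewrite setUv; exact: P0.
    rewrite integral_setU//.
    + by rewrite PA add0e.
    + exact: measurableC.
    + by rewrite setUv; exact: (measurable_int mu2).
    + by apply/disj_setPS => x [].
  - move=> F mF tF PF; rewrite /P /= integral_bigcup//.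
      by apply: eseries0 => n _ _; exact: PF.
    by apply: integrableS hi => //; exact: bigcupT_measurable.
have : ae_eq mu2 setT h (cst 0%E).
  apply: (integral_ae_eq measurableT hi); first exact: measurable_cst.
  move=> E _ mE; rewrite integral0; apply: PP.
  by rewrite -measurable2_oboxes.
apply: filterS => x /(_ I) hx ox.
by move: hx; rewrite /h patchE mem_set//= => -[].
Qed.

(** Countably many rational boxes with closure in [Omega] cover [Omega], and a countable union of
    null sets is null. *)
Theorem fundamental_lemma Omega g : open Omega -> L2 Omega g ->
  (forall phi, test_function Omega phi -> int2 Omega (g \* phi) = 0) ->
  {ae mu2, forall x, Omega x -> g x = 0}.
Proof.
move=> oO Lg gphi.
pose box (q : (rat * rat) * (rat * rat)) : set (point2 R) :=
  obox (ratr q.1.1) (ratr q.1.2) (ratr q.2.1) (ratr q.2.2).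
pose cb (q : (rat * rat) * (rat * rat)) : set (point2 R) :=
  cbox (ratr q.1.1) (ratr q.1.2) (ratr q.2.1) (ratr q.2.2).
(* [choice.unpickle] enumerates the rational boxes; numbers that encode no box, and boxes that are
   not contained in [Omega], contribute the empty set. *)
pose N n : set (mpoint2 R) := if @choice.unpickle ((rat * rat) * (rat * rat))%type n is Some q then
  (if pselect (cb q `<=` Omega) then [set x | box q x /\ g x <> 0] else set0) else set0.
have NN : mu2.-negligible (\bigcup_n N n).
  apply: negligible_bigcup => n; rewrite /N; case: choice.unpickle => [q|]; last exact: negligible_set0.
  case: pselect => [sub|nsub]; last exact: negligible_set0.
  have := ae_eq0_obox oO Lg gphi sub; rewrite /almost_everywhere.
  by apply: negligibleS => x [bx gx] /(_ bx).
apply: negligibleS NN => x /= /not_implyP[Ox gx].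
have [e /= e0 eD] : nbhs_ball x Omega by apply/nbhs_ballP; exact: open_nbhs_nbhs.
have [a1] := rat_in_itvoo (ltr_pwDl e0 (lexx (x.1 - e))).
have [b1] := rat_in_itvoo (ltr_pwDl e0 (lexx x.1)).
have [a2] := rat_in_itvoo (ltr_pwDl e0 (lexx (x.2 - e))).
have [b2] := rat_in_itvoo (ltr_pwDl e0 (lexx x.2)).
rewrite !in_itv /= => /andP[xb2 b2e] /andP[a2e a2x] /andP[xb1 b1e] /andP[a1e a1x].
pose q0 : (rat * rat) * (rat * rat) := ((a1, b1), (a2, b2)).
exists (choice.pickle q0); [exact: I|]; rewrite /N choice.pickleK.
case: pselect => [sub|[]].
  by split => //; split => /=; apply/andP; split; lra.
move=> y [] /= /andP[y1 y2] /andP[y3 y4].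
apply: eD; split; rewrite /ball /= ltr_norml; apply/andP; split; lra.
Qed.

End FundamentalLemma.

(** * Square roots and weighted Young inequalities *)

Section Sqrt.
Variable R : realType.

(** The infimum over t of the right-hand side is (sqrt B + sqrt C)^2, attained at t = sqrt C / sqrt
    B. This is how sums of squares return to norms with a factor of exactly one in front of each. *)
Lemma sqrt_le_add (A B C : R) : 0 <= B -> 0 <= C ->
  (forall t, 0 < t -> A <= (1 + t) * B + (1 + t^-1) * C) ->
  Num.sqrt A <= Num.sqrt B + Num.sqrt C.
Proof.
move=> B0 C0 H; apply/ler_addgt0Pr => e e0.
(* The summand e / 2 keeps the optimal t = c / b positive and finite even if [B] or [C] vanishes. *)
pose b := Num.sqrt B + e / 2; pose c := Num.sqrt C + e / 2.
have b0 : 0 < b by rewrite ltr_wpDl ?sqrtr_ge0// divr_gt0.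
have c0 : 0 < c by rewrite ltr_wpDl ?sqrtr_ge0// divr_gt0.
have Bb : B <= b ^+ 2.
  rewrite -[leLHS](sqr_sqrtr B0) lerXn2r ?nnegrE ?sqrtr_ge0 ?(ltW b0)// lerDl.
  by rewrite divr_ge0 ?ltW.
have Cc : C <= c ^+ 2.
  rewrite -[leLHS](sqr_sqrtr C0) lerXn2r ?nnegrE ?sqrtr_ge0 ?(ltW c0)// lerDl.
  by rewrite divr_ge0 ?ltW.
have t0 : 0 < c / b by rewrite divr_gt0.
have s0 : 0 < b / c by rewrite divr_gt0.
have AA : A <= (b + c) ^+ 2.
  apply: (le_trans (H _ t0)); rewrite invf_div.
  apply: (@le_trans _ _ ((1 + c / b) * b ^+ 2 + (1 + b / c) * c ^+ 2)).
    by rewrite lerD// ler_pM2l// addr_gt0.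
  rewrite le_eqVlt; apply/orP; left; apply/eqP; field.
  by rewrite !gt_eqF.
have -> : Num.sqrt B + Num.sqrt C + e = b + c by rewrite /b /c; lra.
have bc0 : 0 <= b + c by rewrite addr_ge0// ltW.
by rewrite -[leRHS](ger0_norm bc0) -sqrtr_sqr ler_wsqrtr.
Qed.

Lemma le_sum_term (I : finType) (F : I -> R) (i : I) :
  (forall j, 0 <= F j) -> F i <= \sum_j F j.
Proof. by move=> F0; rewrite (bigD1 i)//= lerDl sumr_ge0. Qed.

Lemma sqr_add_le (t x y : R) : 0 < t ->
  (x + y) ^+ 2 <= (1 + t) * x ^+ 2 + (1 + t^-1) * y ^+ 2.
Proof.
move=> t0; have t1 : t != 0 by rewrite gt_eqF.
rewrite -subr_ge0 (_ : _ - _ = t^-1 * (t * x - y) ^+ 2); last by field.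
by rewrite mulr_ge0 ?sqr_ge0// invr_ge0 ltW.
Qed.

End Sqrt.

(** * Weak derivatives *)

Section WeakDerivatives.
Variable R : realType.
Variable Omega : set (point2 R).
Hypothesis oO : open Omega.
Implicit Types (f g u v w phi psi : fun2 R) (l : seq 'I_2).

Let mO : measurable2 Omega. Proof. exact: open_measurable2. Qed.

Lemma ae2S (P Q : point2 R -> Prop) : (forall x, P x -> Q x) ->
  {ae @leb2 R, forall x, P x} -> {ae @leb2 R, forall x, Q x}.
Proof. by move=> PQ; apply: negligibleS => x; apply: contra_not; exact: PQ. Qed.

Lemma int2_ae_eq D f g : measurable2 D -> measurable_fun2 D f -> measurable_fun2 D g ->
  {ae @leb2 R, forall x, D x -> f x = g x} -> int2 D f = int2 D g.
Proof.
move=> mD mf mg fg; rewrite /int2 /Rintegral; congr fine.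
apply: ae_eq_integral => //; try exact/measurable_EFinP.
by apply: ae2S fg => x H Dx; rewrite /= H.
Qed.

Lemma Ck_comb k (a b : R) phi psi : Ck k phi -> Ck k psi ->
  Ck k (fun x => a * phi x + b * psi x).
Proof.
elim: k phi psi => [|k IH] phi psi [c1 C1] [c2 C2];
  have cc : continuous (fun x => a * phi x + b * psi x);
  try (by apply: continuous_add2; apply: continuous_mul2 => //; exact: cst_continuous);
  split => //.
move=> i; have [d1 Cd1] := C1 i; have [d2 Cd2] := C2 i.
have D x : is_derive x (basis_vec R i) (fun x => a * phi x + b * psi x)
   (a * 'D_(basis_vec R i) phi x + b * 'D_(basis_vec R i) psi x).
  apply: (@is_deriveD _ _ _ (a *: phi) (b *: psi)).
    exact: (is_deriveZ a (derivableP (d1 x))).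
  exact: (is_deriveZ b (derivableP (d2 x))).
split=> [x|]; first exact: ex_derive.
have -> : 'D_(basis_vec R i) (fun x => a * phi x + b * psi x) =
    (fun x => a * 'D_(basis_vec R i) phi x + b * 'D_(basis_vec R i) psi x).
  by apply/funext => x; exact: derive_val.
exact: IH.
Qed.

Lemma test_comb (a b : R) phi psi : test_function Omega phi ->
  test_function Omega psi -> test_function Omega (fun x => a * phi x + b * psi x).
Proof.
case=> C1 [K1 [cK1 KO1 s1]] [C2 [K2 [cK2 KO2 s2]]].
split; first by move=> k; exact: Ck_comb.
exists (K1 `|` K2); split; first exact: compactU.
  by rewrite subUset.
by move=> x xK; rewrite s1 ?s2 ?mulr0 ?addr0// => h; apply: xK; [right|left].
Qed.

Lemma partial_comb (a b : R) phi psi l : test_function Omega phi ->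
  test_function Omega psi ->
  partial l (fun x => a * phi x + b * psi x) =
  (fun x => a * partial l phi x + b * partial l psi x).
Proof.
move=> t1 t2; elim: l => // i l IH.
rewrite [LHS]/= -/(partial l _) IH; apply/funext => x /=.
have d1 : derivable (partial l phi) x (basis_vec R i) := test_derivable (test_partials l t1).
have d2 : derivable (partial l psi) x (basis_vec R i) := test_derivable (test_partials l t2).
apply: derive_val.
apply: (@is_deriveD _ _ _ (a *: partial l phi) (b *: partial l psi)).
  exact: (is_deriveZ a (derivableP d1)).
exact: (is_deriveZ b (derivableP d2)).
Qed.

(** [wD] selects some weak derivative; whatever is computed with it, linearity above all, rests on
    this uniqueness. *)
Lemma weak_partial_unique l v g1 g2 :
  weak_partial Omega l v g1 -> weak_partial Omega l v g2 ->
  {ae @leb2 R, forall x, Omega x -> g1 x = g2 x}.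
Proof.
move=> [L1 H1] [L2' H2].
have : {ae @leb2 R, forall x, Omega x -> (fun x => g1 x - g2 x) x = 0}.
  apply: (fundamental_lemma oO); first exact: L2B.
  move=> phi tphi; have Lphi := test_L2 mO tphi.
  rewrite (@int2_eq _ _ _ (fun x => g1 x * phi x - g2 x * phi x)); last first.
    by move=> x _ /=; rewrite mulrBl.
  rewrite int2B//; try exact: L2_integrableM.
  apply/eqP; rewrite subr_eq0; apply/eqP.
  have /(congr1 ( *%R ((-1) ^+ size l))) := etrans (esym (H1 _ tphi)) (H2 _ tphi).
  by rewrite !mulrA -!exprMn mulrNN mulr1 expr1n !mul1r.
by apply: ae2S => x H /H /eqP; rewrite subr_eq0 => /eqP.
Qed.

Lemma weak_partial_comb l (a b : R) v w g1 g2 : L2 Omega v -> L2 Omega w ->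
  weak_partial Omega l v g1 -> weak_partial Omega l w g2 ->
  weak_partial Omega l (fun x => a * v x + b * w x) (fun x => a * g1 x + b * g2 x).
Proof.
move=> Lv Lw [L1 H1] [L2' H2]; split; first exact: L2_comb.
move=> phi tphi; have Lphi := test_L2 mO tphi.
have Ld := test_L2 mO (test_partials l tphi).
rewrite (@int2_eq _ _ _ (fun x => a * (v x * partial l phi x) + b * (w x * partial l phi x))); last first.
  by move=> x _ /=; ring.
rewrite [in RHS](@int2_eq _ _ _ (fun x => a * (g1 x * phi x) + b * (g2 x * phi x))); last first.
  by move=> x _ /=; ring.
have i1 := L2_integrableM mO Lv Ld; have i2 := L2_integrableM mO Lw Ld.
have i3 := L2_integrableM mO L1 Lphi; have i4 := L2_integrableM mO L2' Lphi.
rewrite !int2D//; try exact: integrable2Z.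
rewrite !int2Z// (H1 _ tphi : int2 Omega (fun x => _) = _).
by rewrite (H2 _ tphi : int2 Omega (fun x => _) = _) mulrDr; congr (_ + _); rewrite mulrCA.
Qed.

Lemma wDP l v : H2 Omega v -> (size l <= 2)%N -> weak_partial Omega l v (wD Omega l v).
Proof. by move=> [_ Hv] /Hv [g gP]; apply: (@getPex _ [set g | weak_partial Omega l v g]); exists g. Qed.

Lemma wD_L2 l v : H2 Omega v -> (size l <= 2)%N -> L2 Omega (wD Omega l v).
Proof. by move=> Hv /(wDP Hv)[]. Qed.

Lemma H2_comb (a b : R) v w : H2 Omega v -> H2 Omega w ->
  H2 Omega (fun x => a * v x + b * w x).
Proof.
move=> Hv Hw; split; first by apply: L2_comb => //; [case: Hv|case: Hw].
move=> l sl; exists (fun x => a * wD Omega l v x + b * wD Omega l w x).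
by apply: weak_partial_comb; [case: Hv|case: Hw|exact: wDP|exact: wDP].
Qed.

Lemma wD_comb (a b : R) l v w : H2 Omega v -> H2 Omega w -> (size l <= 2)%N ->
  {ae @leb2 R, forall x, Omega x ->
     wD Omega l (fun x => a * v x + b * w x) x = a * wD Omega l v x + b * wD Omega l w x}.
Proof.
move=> Hv Hw sl; apply: weak_partial_unique; first exact: wDP (H2_comb a b Hv Hw) sl.
by apply: weak_partial_comb; [case: Hv|case: Hw|exact: wDP|exact: wDP].
Qed.

(** The same combination of the approximating sequences works, by (a p + b q)^2 <= 2 a^2 p^2 + 2 b^2
    q^2 and a squeeze. *)
Lemma H20_comb (a b : R) v w : H20 Omega v -> H20 Omega w ->
  H20 Omega (fun x => a * v x + b * w x).
Proof.
move=> [Hv v0 [phi [tphi phiv]]] [Hw w0 [psi [tpsi psiw]]].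
have Hc := H2_comb a b Hv Hw.
split=> //; first by move=> x Ox; rewrite v0// w0// !mulr0 addr0.
exists (fun n x => a * phi n x + b * psi n x); split; first by move=> n; exact: test_comb.
move=> l sl.
have Lp n : L2 Omega (fun x => wD Omega l v x - partial l (phi n) x).
  by apply: L2B => //; [exact: wD_L2|exact: test_L2 (test_partials l (tphi n))].
have Lq n : L2 Omega (fun x => wD Omega l w x - partial l (psi n) x).
  by apply: L2B => //; [exact: wD_L2|exact: test_L2 (test_partials l (tpsi n))].
pose B n := 2 * a ^+ 2 * int2 Omega (fun x => (wD Omega l v x - partial l (phi n) x) ^+ 2)
   + 2 * b ^+ 2 * int2 Omega (fun x => (wD Omega l w x - partial l (psi n) x) ^+ 2).
apply: (@squeeze_cvgr _ _ _ _ (cst 0) B).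
- apply: nearW => n; apply/andP; split; first by apply: int2_ge0 => x _; exact: sqr_ge0.
  have tc := test_comb a b (tphi n) (tpsi n).
  have Lc := L2_comb a b mO (Lp n) (Lq n).
  have Ld : L2 Omega (fun x => wD Omega l (fun x => a * v x + b * w x) x -
       partial l (fun x => a * phi n x + b * psi n x) x).
    by apply: L2B => //; [exact: wD_L2|exact: test_L2 (test_partials l tc)].
  have ip := L2_integrable_sqr mO (Lp n); have iq := L2_integrable_sqr mO (Lq n).
  rewrite (@int2_ae_eq _ _ (fun x => (a * (wD Omega l v x - partial l (phi n) x) +
       b * (wD Omega l w x - partial l (psi n) x)) ^+ 2)) //.
  + rewrite /B -!int2Z// -int2D//; try exact: integrable2Z.
    apply: int2_le => //; first exact: L2_integrable_sqr.
      by apply: integrable2D => //; exact: integrable2Z.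
    move=> x _; set p := _ - _; set q := _ - _.
    by have := sqr_ge0 (a * p - b * q); nra.
  + exact: (integrable2_mfun (L2_integrable_sqr mO Ld)).
  + exact: (integrable2_mfun (L2_integrable_sqr mO Lc)).
  + apply: ae2S (wD_comb a b Hv Hw sl) => x H Ox.
    by rewrite H// partial_comb//; congr (_ ^+ 2); ring.
- exact: cvg_cst.
- rewrite /B -[X in _ --> X](_ : 2 * a ^+ 2 * 0 + 2 * b ^+ 2 * 0 = 0); last by ring.
  by apply: cvgD; apply: cvgMr; [exact: phiv|exact: psiw].
Qed.

Lemma wD0_ae v : H2 Omega v ->
  {ae @leb2 R, forall x, Omega x -> v x = wD Omega [::] v x}.
Proof.
move=> Hv; apply: (@weak_partial_unique [::] v); last exact: wDP.
by split; [case: Hv|move=> phi _; rewrite expr0 mul1r].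
Qed.

Lemma form_aE v : form_a Omega v v =
  int2 Omega (fun x => \sum_(i < 2) \sum_(k < 2) wD Omega [:: i; k] v x ^+ 2).
Proof. by []. Qed.

Lemma integrable2_sum D (I : finType) (F : I -> fun2 R) : measurable2 D ->
  (forall i, integrable2 D (F i)) -> integrable2 D (fun x => \sum_i F i x).
Proof.
move=> mD FI; elim: (index_enum I) => [|i s IH].
  under [X in integrable2 _ X]funext do rewrite big_nil.
  apply: (@eq_integrable2 _ _ (fun x => 0 * 0)) => // [x _|]; first by rewrite mul0r.
  by apply: (@integrable2Z _ _ (fun=> 0)) => //; exact: integrable0.
under [X in integrable2 _ X]funext do rewrite big_cons.
exact: integrable2D.
Qed.

Lemma energy_integrable v : H2 Omega v ->
  integrable2 Omega (fun x => \sum_(i < 2) \sum_(k < 2) wD Omega [:: i; k] v x ^+ 2).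
Proof.
move=> Hv; apply: integrable2_sum => // i; apply: integrable2_sum => // k.
by apply: L2_integrable_sqr => //; exact: wD_L2.
Qed.

Lemma form_a_ge0 v : 0 <= form_a Omega v v.
Proof. by apply: int2_ge0 => x _; do 2 apply: sumr_ge0 => ? _; exact: sqr_ge0. Qed.

(** Young's inequality is applied pointwise to each second derivative. The sign s = 1 or s = -1
    covers sums and differences alike. *)
Lemma form_a_comb_le v w (s t : R) : H20 Omega v -> H20 Omega w -> s ^+ 2 = 1 -> 0 < t ->
  form_a Omega (fun x => v x + s * w x) (fun x => v x + s * w x)
    <= (1 + t) * form_a Omega v v + (1 + t^-1) * form_a Omega w w.
Proof.
move=> [Hv _ _] [Hw _ _] s1 t0.
have -> : (fun x => v x + s * w x) = (fun x => 1 * v x + s * w x).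
  by apply/funext => x; rewrite mul1r.
have Hc := H2_comb 1 s Hv Hw.
have ev := energy_integrable Hv; have ew := energy_integrable Hw.
have ec := energy_integrable Hc.
rewrite !form_aE -!int2Z// -int2D//; try exact: integrable2Z.
have ei : integrable2 Omega (fun x => \sum_(i < 2) \sum_(k < 2)
    (wD Omega [:: i; k] v x + s * wD Omega [:: i; k] w x) ^+ 2).
  apply: integrable2_sum => // i; apply: integrable2_sum => // k.
  apply: L2_integrable_sqr => //.
  have := L2_comb 1 s mO (@wD_L2 [:: i; k] v Hv isT) (@wD_L2 [:: i; k] w Hw isT).
  by under [X in L2 _ X -> _]funext do rewrite mul1r.
rewrite (@int2_ae_eq _ _ (fun x => \sum_(i < 2) \sum_(k < 2)
    (wD Omega [:: i; k] v x + s * wD Omega [:: i; k] w x) ^+ 2)) //.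
- apply: int2_le => //; first by apply: integrable2D => //; exact: integrable2Z.
  move=> x _; rewrite !mulr_sumr -big_split; apply: ler_sum => i _.
  rewrite !mulr_sumr -big_split; apply: ler_sum => k _ /=.
  by rewrite (le_trans (sqr_add_le _ _ t0))// exprMn s1 mul1r.
- exact: integrable2_mfun.
- exact: integrable2_mfun.
have key (i k : 'I_2) := @wD_comb 1 s [:: i; k] v w Hv Hw isT.
(* The four almost everywhere identities are merged into one null set by encoding the pair (i, k) as
   i + 2 k. *)
have N : (@leb2 R).-negligible (\bigcup_(n in [set: nat])
   ~` [set x | forall i k : 'I_2, n = (i + 2 * k)%N -> Omega x ->
      wD Omega [:: i; k] (fun x => 1 * v x + s * w x) x
        = 1 * wD Omega [:: i; k] v x + s * wD Omega [:: i; k] w x]).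
  apply: negligible_bigcup => n.
  have [[[i k] nik]|no] := pselect (exists ik : 'I_2 * 'I_2, n = (ik.1 + 2 * ik.2)%N); last first.
    apply: (@negligibleS _ _ _ (leb2 R) set0); last exact: negligible_set0.
    by move=> x; apply => i k nik; exfalso; apply: no; exists (i, k).
  apply: negligibleS (key i k) => x /=; apply: contra_not => H i' k' E.
  have [-> ->] : i' = i /\ k' = k; last exact: H.
  move: nik E => /= -> E.
  case: i i' k k' E {H} => [[|[|i]] hi] // [[|[|i']] hi'] // [[|[|k]] hk] // [[|[|k']] hk'] // E;
    by split; exact/val_inj.
apply: negligibleS N => x /= /not_implyP[Ox H]; apply: contrapT => H'; apply: H.
apply: eq_bigr => i _; apply: eq_bigr => k _; congr (_ ^+ 2).
have : (~` (\bigcup_(n in [set: nat])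
   ~` [set x | forall i k : 'I_2, n = (i + 2 * k)%N -> Omega x ->
      wD Omega [:: i; k] (fun x => 1 * v x + s * w x) x
        = 1 * wD Omega [:: i; k] v x + s * wD Omega [:: i; k] w x])) x by [].
rewrite setC_bigcup => /(_ (i + 2 * k)%N I); rewrite setCK => /(_ i k erefl Ox) ->.
by rewrite mul1r.
Qed.

Lemma energy_comb_le v w (s : R) : H20 Omega v -> H20 Omega w -> s ^+ 2 = 1 ->
  energy_norm Omega (fun x => v x + s * w x)
    <= energy_norm Omega v + energy_norm Omega w.
Proof.
move=> Hv Hw s1; apply: sqrt_le_add; try exact: form_a_ge0.
by move=> t t0; exact: form_a_comb_le.
Qed.

(** The first-order inequality is used twice, the second time for d_1 phi, which is again a test
    function. *)
Lemma friedrichs_test M phi : 0 < M -> Omega `<=` cbox (- M) M (- M) M ->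
  test_function Omega phi ->
  int2 Omega (fun x => phi x ^+ 2)
    <= (4 * M ^+ 2) ^+ 2 * int2 Omega (fun x => partial [:: 0; 0] phi x ^+ 2).
Proof.
move=> M0 OM tphi; have tD := test_partial 0 tphi.
have C0 : 0 <= 4 * M ^+ 2 by rewrite mulr_ge0// sqr_ge0.
rewrite !int2_supp; last 2 first.
- move=> x Ox; have -> : partial [:: 0; 0] phi x = 0 := test_out (test_partial 0 tD) Ox.
  by rewrite expr0n.
- by move=> x Ox; rewrite (test_out tphi Ox) expr0n.
apply: (le_trans (friedrichs_partial0 M0 OM tphi)).
rewrite [X in _ <= X * _]expr2 -[leRHS]mulrA.
exact: (ler_wpM2l C0 (friedrichs_partial0 M0 OM tD)).
Qed.

(** Test functions are dense, so the inequality passes to the limit along an approximating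
    sequence. *)
Lemma friedrichs M v : 0 < M -> Omega `<=` cbox (- M) M (- M) M -> H20 Omega v ->
  int2 Omega (fun x => v x ^+ 2) <= 4 * (4 * M ^+ 2) ^+ 2 * form_a Omega v v.
Proof.
move=> M0 OM [Hv _ [phi [tphi cphi]]]; set C := (4 * M ^+ 2) ^+ 2.
have C0 : 0 <= C by rewrite sqr_ge0.
pose l0 : seq 'I_2 := [::]; pose l2 : seq 'I_2 := [:: 0; 0].
pose g := wD Omega l2 v; pose g0 := wD Omega l0 v.
have Lg : L2 Omega g by exact: wD_L2.
have Lg0 : L2 Omega g0 by exact: wD_L2.
pose G := int2 Omega (fun x => g x ^+ 2).
have GE : G <= form_a Omega v v.
  rewrite form_aE; apply: int2_le => //.
  - exact: L2_integrable_sqr.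
  - exact: energy_integrable.
  move=> x _; pose F (i k : 'I_2) := wD Omega [:: i; k] v x ^+ 2.
  have F0 i k : 0 <= F i k by exact: sqr_ge0.
  apply: (le_trans (le_sum_term (F := F 0) 0 (F0 0))).
  by apply: (le_sum_term (F := fun i => \sum_(k < 2) F i k) 0) => i; apply: sumr_ge0 => k _; exact: F0.
have -> : int2 Omega (fun x => v x ^+ 2) = int2 Omega (fun x => g0 x ^+ 2).
  apply: int2_ae_eq => //.
  - by apply: (integrable2_mfun (L2_integrable_sqr mO _)); case: Hv.
  - exact: (integrable2_mfun (L2_integrable_sqr mO Lg0)).
  by apply: ae2S (wD0_ae Hv) => x H Ox; rewrite H.
pose e0 n := int2 Omega (fun x => (g0 x - partial l0 (phi n) x) ^+ 2).
pose e2 n := int2 Omega (fun x => (g x - partial l2 (phi n) x) ^+ 2).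
have tri f h : L2 Omega f -> L2 Omega h ->
    int2 Omega (fun x => f x ^+ 2) <= 2 * int2 Omega (fun x => (f x - h x) ^+ 2)
       + 2 * int2 Omega (fun x => h x ^+ 2).
  move=> Lf Lh; have i1 := L2_integrable_sqr mO (L2B mO Lf Lh).
  have i2 := L2_integrable_sqr mO Lh.
  rewrite -!int2Z// -int2D//; try exact: integrable2Z.
  apply: int2_le => //; first exact: L2_integrable_sqr.
    by apply: integrable2D => //; exact: integrable2Z.
  move=> x _; have := sqr_ge0 (f x - 2 * h x); nra.
(* Both the function and its second derivative are split at the test function, each time with a
   factor 2; this produces the 4. *)
have bound n : int2 Omega (fun x => g0 x ^+ 2) <= 2 * e0 n + 4 * C * e2 n + 4 * C * form_a Omega v v.
  have t0 := test_L2 mO (test_partials l0 (tphi n)).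
  have t2 := test_L2 mO (test_partials l2 (tphi n)).
  have h1 := tri _ _ Lg0 t0.
  have h2 := friedrichs_test M0 OM (tphi n).
  have h3 := tri _ _ t2 Lg.
  have h4 : int2 Omega (fun x => (partial l2 (phi n) x - g x) ^+ 2) = e2 n.
    by apply: int2_eq => x _; rewrite -sqrrN opprB.
  rewrite h4 in h3.
  have {}h3 := ler_wpM2l C0 h3; have GE' := ler_wpM2l C0 GE.
  rewrite -/C -/l2 in h2; rewrite -/(e0 n) in h1; rewrite -/G in h3.
  by move: h1 h2 h3 GE'; rewrite /l0 /=; lra.
have cR : (2 * e0 n + 4 * C * e2 n + 4 * C * form_a Omega v v) @[n --> \oo] -->
    2 * 0 + 4 * C * 0 + 4 * C * form_a Omega v v.
  apply: cvgD; last exact: cvg_cst.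
  by apply: cvgD; apply: cvgMr; exact: cphi.
rewrite (_ : 4 * C * _ = 2 * 0 + 4 * C * 0 + 4 * C * form_a Omega v v); last by ring.
rewrite -(cvg_lim (@Rhausdorff _) cR); apply: limr_ge; first exact: cvgP cR.
exact: nearW.
Qed.

End WeakDerivatives.

(** * Polynomials in local coordinates and the inverse estimate *)

Section LocalPolynomials.
Variable R : realType.
Implicit Types (f g q v : fun2 R) (z : point2 R) (s m : R) (i : 'I_2).

(** Powers of (t - z) / s: in this scaling, coefficients of polynomials on boxes of different sizes
    are comparable. The affine form s^-1 t - z/s suits the chain rule and the substitution rule. *)
Definition mono (z s : R) (a : nat) (t : R) : R := (s^-1 * t + - (z / s)) ^+ a.

Definition bipoly n z s (c : nat -> nat -> R) : fun2 R :=
  fun x => \sum_(a < n) \sum_(b < n) c a b * tens (mono z.1 s a) (mono z.2 s b) x.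

(** The maximum norm of the coefficients in scaled coordinates, in which differentiation costs a
    factor n / s and evaluation near the box a constant. *)
Definition bipoly_bound n z s m f : Prop :=
  exists2 c, (forall a b, `|c a b| <= m) & f = bipoly n z s c.

Lemma C1k_mono k (w : R) s a : C1k k (mono w s a).
Proof.
have := C1k_affine s^-1 (- (w / s)) (C1k_horner k ('X^a : {poly R})).
by under [X in C1k _ X -> _]funext do rewrite hornerXn.
Qed.

Lemma derive1_mono (w : R) s a t :
  derive1 (mono w s a) t = a%:R * s^-1 * mono w s a.-1 t.
Proof.
apply: is_derive1E.
have := is_deriveX a (is_derive_affine s^-1 (- (w / s)) t).
rewrite (_ : _ ^+ a = mono w s a); last by apply/funext => x; rewrite exprfctE.
by move/is_derive1_eq; apply; rewrite /GRing.scale /= /mono; ring.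
Qed.

Lemma partial0_tens al be (x : point2 R) : C1k 0 al ->
  'D_(basis_vec R 0) (tens al be) x = tens (derive1 al) be x.
Proof. by move=> Ca; have := is_derive_tens0 be (C1k_is_derive x.1 Ca) => h; exact: derive_val. Qed.

Lemma partial1_tens al be (x : point2 R) : C1k 0 be ->
  'D_(basis_vec R 1) (tens al be) x = tens al (derive1 be) x.
Proof. by move=> Cb; have := is_derive_tens1 al (C1k_is_derive x.2 Cb) => h; exact: derive_val. Qed.

Definition smooth2 f := forall k, Ck k f.

Lemma smooth2_comb (a b : R) f g : smooth2 f -> smooth2 g ->
  smooth2 (fun x => a * f x + b * g x).
Proof. by move=> Cf Cg k; exact: Ck_comb. Qed.

Lemma smooth2_partial i f : smooth2 f -> smooth2 ('D_(basis_vec R i) f).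
Proof. by move=> Cf k; have [_ /(_ i)[]] := Cf k.+1. Qed.

Lemma smooth2_partials l f : smooth2 f -> smooth2 (partial l f).
Proof. by move=> Cf; elim: l => //= i l IH; exact: smooth2_partial. Qed.

Lemma smooth2_derivable i f x : smooth2 f -> derivable f x (basis_vec R i).
Proof. by move=> /(_ 1%N)[_ /(_ i)[]]. Qed.

Lemma smooth2_continuous f : smooth2 f -> continuous f.
Proof. by move=> /(_ 0%N)/Ck_continuous. Qed.

Lemma derive_comb (a b : R) f g i : smooth2 f -> smooth2 g ->
  'D_(basis_vec R i) (fun x => a * f x + b * g x) =
  (fun x => a * 'D_(basis_vec R i) f x + b * 'D_(basis_vec R i) g x).
Proof.
move=> Cf Cg; apply/funext => x.
have d1 : derivable f x (basis_vec R i) := smooth2_derivable Cf.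
have d2 : derivable g x (basis_vec R i) := smooth2_derivable Cg.
apply: derive_val; apply: (@is_deriveD _ _ _ (a *: f) (b *: g)).
  exact: (is_deriveZ a (derivableP d1)).
exact: (is_deriveZ b (derivableP d2)).
Qed.

Lemma partial_smooth_comb (a b : R) f g l : smooth2 f -> smooth2 g ->
  partial l (fun x => a * f x + b * g x) =
  (fun x => a * partial l f x + b * partial l g x).
Proof.
move=> Cf Cg; elim: l => // i l IH.
rewrite [LHS]/= -/(partial l _) IH derive_comb //; exact: smooth2_partials.
Qed.

Lemma smooth2_cst (c : R) : smooth2 (cst c).
Proof.
move=> k; have -> : cst c = tens (cst c) (cst 1) :> fun2 R.
  by apply/funext => x; rewrite /tens mulr1.
by apply: Ck_tens; exact: C1k_cst.
Qed.

Lemma smooth2_sum (I : Type) (r : seq I) (F : I -> fun2 R) (c : I -> R) :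
  (forall j, smooth2 (F j)) ->
  smooth2 (fun x => \sum_(j <- r) c j * F j x) /\
  forall i, 'D_(basis_vec R i) (fun x => \sum_(j <- r) c j * F j x) =
     (fun x => \sum_(j <- r) c j * 'D_(basis_vec R i) (F j) x).
Proof.
move=> CF; elim: r => [|j r [IH1 IH2]].
  under [X in smooth2 X]funext do rewrite big_nil.
  split=> [|i]; first exact: smooth2_cst.
  apply/funext => x; rewrite big_nil.
  rewrite (_ : (fun y => _) = cst 0); last by apply/funext => y; rewrite big_nil.
  exact: derive_cst.
have E : (fun x => \sum_(j <- j :: r) c j * F j x) =
   (fun x => c j * F j x + 1 * (\sum_(j <- r) c j * F j x)).
  by apply/funext => x; rewrite big_cons mul1r.
split=> [|i]; first by rewrite E; exact: smooth2_comb.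
rewrite E derive_comb//; apply/funext => x; rewrite big_cons mul1r.
by congr (_ + _); exact: (congr1 (fun h : fun2 R => h x) (IH2 i)).
Qed.

Lemma smooth2_mono2 z s a b : smooth2 (tens (mono z.1 s a) (mono z.2 s b)).
Proof. by move=> k; apply: Ck_tens; exact: C1k_mono. Qed.

Lemma bipoly_pair n z s c : bipoly n z s c =
  (fun x => \sum_(ab <- index_enum ('I_n * 'I_n)%type)
     c ab.1 ab.2 * tens (mono z.1 s ab.1) (mono z.2 s ab.2) x).
Proof.
apply/funext => x; rewrite /bipoly pair_bigA; apply: eq_bigl => -[a b] //=.
Qed.

Lemma smooth2_bipoly n z s c : smooth2 (bipoly n z s c).
Proof.
rewrite bipoly_pair.
exact: (smooth2_sum _ (fun ab : 'I_n * 'I_n => c ab.1 ab.2)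
  (fun ab : 'I_n * 'I_n => smooth2_mono2 z s ab.1 ab.2)).1.
Qed.

Lemma derive_bipoly n z s c i : 'D_(basis_vec R i) (bipoly n z s c) =
  (fun x => \sum_(a < n) \sum_(b < n)
     c a b * 'D_(basis_vec R i) (tens (mono z.1 s a) (mono z.2 s b)) x).
Proof.
rewrite bipoly_pair.
rewrite (smooth2_sum _ (fun ab : 'I_n * 'I_n => c ab.1 ab.2)
  (fun ab : 'I_n * 'I_n => smooth2_mono2 z s ab.1 ab.2)).2.
by apply/funext => x; rewrite pair_bigA; apply: eq_bigl => -[a b].
Qed.

Lemma sum_shift n (F G : nat -> R) : F 0%N = 0 -> G n = 0 ->
  (forall a, (a < n)%N -> F a.+1 = G a) ->
  \sum_(a < n.+1) F a = \sum_(a < n.+1) G a.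
Proof.
move=> F0 Gn FG; rewrite big_ord_recl big_ord_recr /= F0 Gn add0r addr0.
by apply: eq_bigr => a _; rewrite /bump /= add1n FG.
Qed.

Lemma bipoly_bound_derive n z s m f i : 0 < s ->
  bipoly_bound n z s m f ->
  bipoly_bound n z s (n%:R / s * m) ('D_(basis_vec R i) f).
Proof.
move=> s0 [c cm ->]; have m0 : 0 <= m by exact: le_trans (cm 0%N 0%N).
case: n => [|n].
  exists (fun _ _ => 0); first by move=> *; rewrite normr0 !mul0r.
  by rewrite derive_bipoly /bipoly; apply/funext => x; rewrite !big_ord0.
have nm a : (a < n.+1)%N -> a%:R * s^-1 * m <= n.+1%:R / s * m.
  move=> an; rewrite ler_wpM2r// ler_wpM2r ?invr_ge0 ?(ltW s0)//.
  by rewrite ler_nat ltnW.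
have nm0 : 0 <= n.+1%:R / s * m by rewrite !mulr_ge0 ?invr_ge0 ?(ltW s0).
have [->|->] := ord2P i.
(* Differentiation moves the coefficient of index a + 1 to index a; nothing moves to the top index
   n, which receives 0. *)
- exists (fun a b => if (a < n)%N then a.+1%:R * s^-1 * c a.+1 b else 0).
    move=> a b; case: ifPn => [an|]; last by rewrite normr0.
    rewrite normrM ger0_norm; last by rewrite mulr_ge0 ?invr_ge0 ?(ltW s0).
    by rewrite (le_trans _ (nm a.+1 an))// ler_wpM2l// mulr_ge0 ?invr_ge0 ?(ltW s0).
  rewrite derive_bipoly; apply/funext => x; rewrite /bipoly.
  under eq_bigr => a _ do under eq_bigr => b _ do
    rewrite (partial0_tens _ _ (C1k_mono 0 z.1 s a)).
  apply: (sum_shift (F := fun a => \sum_(b < n.+1) c a b * tens (derive1 (mono z.1 s a)) (mono z.2 s b) x)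
    (G := fun a => \sum_(b < n.+1) (if (a < n)%N then a.+1%:R * s^-1 * c a.+1 b else 0) *
            tens (mono z.1 s a) (mono z.2 s b) x)).
  + by apply: big1 => b _; rewrite /tens derive1_mono !mul0r mulr0.
  + by apply: big1 => b _; rewrite ltnn mul0r.
  + move=> a an; apply: eq_bigr => b _; rewrite an /tens derive1_mono /=; ring.
- exists (fun a b => if (b < n)%N then b.+1%:R * s^-1 * c a b.+1 else 0).
    move=> a b; case: ifPn => [bn|]; last by rewrite normr0.
    rewrite normrM ger0_norm; last by rewrite mulr_ge0 ?invr_ge0 ?(ltW s0).
    by rewrite (le_trans _ (nm b.+1 bn))// ler_wpM2l// mulr_ge0 ?invr_ge0 ?(ltW s0).
  rewrite derive_bipoly; apply/funext => x; rewrite /bipoly.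
  apply: eq_bigr => a _.
  under eq_bigr => b _ do rewrite (partial1_tens _ _ (C1k_mono 0 z.2 s b)).
  apply: (sum_shift (F := fun b => c a b * tens (mono z.1 s a) (derive1 (mono z.2 s b)) x)
    (G := fun b => (if (b < n)%N then b.+1%:R * s^-1 * c a b.+1 else 0) *
            tens (mono z.1 s a) (mono z.2 s b) x)).
  + by rewrite /tens derive1_mono !mul0r !mulr0.
  + by rewrite ltnn mul0r.
  + move=> b bn; rewrite bn /tens derive1_mono /=; ring.
Qed.

Lemma bipoly_bound_sup n z s m f rho x : 0 < s -> 1 <= rho ->
  bipoly_bound n z s m f ->
  `|x.1 - z.1| <= rho * s -> `|x.2 - z.2| <= rho * s ->
  `|f x| <= n%:R ^+ 2 * rho ^+ (n + n) * m.
Proof.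
move=> s0 rho1 [c cm ->] x1 x2; have m0 : 0 <= m by exact: le_trans (cm 0%N 0%N).
have rho0 : 0 <= rho by exact: le_trans rho1.
have M (y w : R) (a : 'I_n) : `|y - w| <= rho * s -> `|mono w s a y| <= rho ^+ n.
  move=> yw; rewrite /mono normrX.
  have -> : s^-1 * y + - (w / s) = (y - w) / s by field; rewrite gt_eqF.
  have h : `|(y - w) / s| <= rho.
    by rewrite normrM normfV (gtr0_norm s0) ler_pdivrMr.
  apply: (@le_trans _ _ (rho ^+ a)); first by rewrite lerXn2r ?nnegrE.
  by rewrite ler_weXn2l// ltnW.
rewrite /bipoly; apply: (le_trans (ler_norm_sum _ _ _)).
apply: (@le_trans _ _ (\sum_(a < n) n%:R * (rho ^+ (n + n) * m))).
  apply: ler_sum => a _; apply: (le_trans (ler_norm_sum _ _ _)).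
  apply: (@le_trans _ _ (\sum_(b < n) (rho ^+ (n + n) * m))).
    apply: ler_sum => b _; rewrite normrM mulrC exprD ler_pM ?normr_ge0 ?cm//.
    by rewrite /tens normrM ler_pM ?normr_ge0//; exact: M.
  by rewrite sumr_const card_ord mulr_natl.
by rewrite sumr_const card_ord -[leLHS]mulr_natl !mulrA expr2.
Qed.

(** Expansion about another centre: t^i is the value of the polynomial (s X + w)^i at (t - w) / s.
    Total degree at most p gives fewer than p + 1 powers of each variable. *)
Lemma polynomial2_bipoly p q z s : s != 0 -> polynomial2 p q ->
  exists c, q = bipoly p.+1 z s c.
Proof.
move=> s0 [c0 qE].
pose al (w : R) (i : nat) : {poly R} := 'X^i \Po (s *: 'X + w%:P).
have size_al w (i : 'I_p.+1) : (size (al w i) <= p.+1)%N.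
  rewrite (leq_trans (size_comp_poly_leq _ _))// size_polyXn /=.
  rewrite size_addl; rewrite size_scale// size_polyX; last first.
    by rewrite (leq_ltn_trans (size_polyC_leq1 _)).
  by rewrite muln1 ltn_ord.
have alE w (i : 'I_p.+1) (t : R) : t ^+ i = \sum_(a < p.+1) (al w i)`_a * mono w s a t.
  have -> : \sum_(a < p.+1) (al w i)`_a * mono w s a t = (al w i).[s^-1 * t + - (w / s)].
    by rewrite (horner_coef_wide _ (size_al w i)).
  rewrite /al horner_comp !hornerE; congr (_ ^+ _); field; exact: s0.
exists (fun a b => \sum_(i < p.+1) \sum_(k < p.+1 | (i + k <= p)%N)
   c0 i k * (al z.1 i)`_a * (al z.2 k)`_b).
apply/funext => x; rewrite qE /bipoly.
transitivity (\sum_(i < p.+1) \sum_(k < p.+1 | (i + k <= p)%N) \sum_(a < p.+1) \sum_(b < p.+1)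
    c0 i k * (al z.1 i)`_a * (al z.2 k)`_b * tens (mono z.1 s a) (mono z.2 s b) x).
  apply: eq_bigr => i _; apply: eq_bigr => k _.
  rewrite (alE z.1 i x.1) (alE z.2 k x.2) -mulrA mulr_suml mulr_sumr; apply: eq_bigr => a _.
  rewrite !mulr_sumr; apply: eq_bigr => b _; rewrite /tens; ring.
under eq_bigr => i _ do rewrite exchange_big /=.
rewrite exchange_big /=; apply: eq_bigr => a _.
under eq_bigr => i _ do rewrite exchange_big /=.
rewrite exchange_big /=; apply: eq_bigr => b _.
by rewrite mulr_suml; apply: eq_bigr => i _; rewrite mulr_suml.
Qed.

Lemma bipoly_bounded n z s c : exists m, bipoly_bound n z s m (bipoly n z s c).
Proof.
(* Coefficients beyond the range of summation are arbitrary and have to be cut off before a bound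
   for all indices is possible. *)
pose c' a b := if (a < n)%N && (b < n)%N then c a b else 0.
exists (\sum_(a < n) \sum_(b < n) `|c a b|); exists c'; last first.
  apply/funext => x; apply: eq_bigr => a _; apply: eq_bigr => b _.
  by rewrite /c' !ltn_ord.
move=> a b; rewrite /c'; case: ifPn => [/andP[an bn]|_]; last first.
  by rewrite normr0; apply: sumr_ge0 => i _; exact: sumr_ge0.
apply: (@le_trans _ _ (\sum_(b < n) `|c a b|)).
  exact: (le_sum_term (F := fun b : 'I_n => `|c a b|) (Ordinal bn)).
apply: (le_sum_term (F := fun a : 'I_n => \sum_(b < n) `|c a b|) (Ordinal an)) => i.
exact: sumr_ge0.
Qed.

End LocalPolynomials.

(** * Dual test functions and the inverse estimate *)

Section InverseEstimate.
Variable R : realType.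
Implicit Types (f g q v : fun2 R) (z : point2 R) (s m : R) (i k : 'I_2).

Definition sqbox z s : set (point2 R) := cbox (z.1 - s) (z.1 + s) (z.2 - s) (z.2 + s).

Lemma supp1_bounded (f : R -> R) a b : continuous f -> supp1 a b f ->
  exists2 C, 0 <= C & forall t, `|f t| <= C.
Proof.
move=> cf sf.
have : compact (f @` `[a, b]%classic).
  by apply: continuous_compact; [exact: continuous_subspaceT|exact: segment_compact].
move=> /compact_bounded[M [Mr HM]].
exists (`|M| + 1) => [|t]; first by rewrite addr_ge0.
have [h|h] := pselect (a <= t <= b); last by rewrite sf// normr0 addr_ge0.
apply: (HM (`|M| + 1)); first by rewrite (le_lt_trans (ler_norm M))// ltrDl.
by exists t => //=; rewrite in_itv.
Qed.

Lemma int2_sum D (I : finType) (F : I -> fun2 R) (c : I -> R) : measurable2 D ->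
  (forall j, integrable2 D (F j)) ->
  int2 D (fun x => \sum_j c j * F j x) = \sum_j c j * int2 D (F j).
Proof.
move=> mD FI.
have si (r : seq I) : integrable2 D (fun x => \sum_(j <- r) c j * F j x).
  elim: r => [|j r IH].
    under [X in integrable2 _ X]funext do rewrite big_nil.
    exact: integrable0.
  under [X in integrable2 _ X]funext do rewrite big_cons.
  by apply: integrable2D => //; exact: integrable2Z.
elim: (index_enum I) => [|j r IH].
  rewrite big_nil; under [X in int2 _ X]funext do rewrite big_nil.
  by rewrite /int2 (Rintegral_cst _ mD) mul0r.
rewrite big_cons -IH -int2Z//; under [X in int2 _ X]funext do rewrite big_cons.
by rewrite int2D//; exact: integrable2Z.
Qed.

Definition dual_test (phi : nat -> R -> R) z s (a b : nat) : fun2 R :=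
  tens (fun t => phi a (s^-1 * t + - (z.1 / s))) (fun t => phi b (s^-1 * t + - (z.2 / s))).

Section Dual.
Variables (n : nat) (phi : nat -> R -> R).
Hypothesis Cphi : forall a (k : nat), C1k k (phi a).
Hypothesis sphi : forall a, supp1 (-1) 1 (phi a).
Hypothesis bphi : forall a b, (a < n)%N -> (b < n)%N ->
  int1 (fun t => t ^+ a * phi b t) = (a == b)%:R.

Lemma phi_affine_supp (w s : R) a : 0 < s ->
  supp1 (w - s) (w + s) (fun t => phi a (s^-1 * t + - (w / s))).
Proof.
move=> s0 t tM; apply: sphi => /andP[h1 h2]; apply: tM.
have e : s * (s^-1 * t + - (w / s)) = t - w by field; rewrite gt_eqF.
have := ler_wpM2l (ltW s0) h1; have := ler_wpM2l (ltW s0) h2.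
by rewrite e => *; apply/andP; split; lra.
Qed.

Lemma dual_test_test z s a b : 0 < s -> test_function (sqbox z s) (dual_test phi z s a b).
Proof.
move=> s0; apply: (@test_tens _ _ (z.1 - s) (z.1 + s) (z.2 - s) (z.2 + s)) => //.
- by move=> k; exact: (C1k_affine _ _ (Cphi a k)).
- by move=> k; exact: (C1k_affine _ _ (Cphi b k)).
- exact: phi_affine_supp.
- exact: phi_affine_supp.
Qed.

Lemma int1_mono_dual (w s : R) a b : 0 < s -> (a < n)%N -> (b < n)%N ->
  int1 (fun t => mono w s a t * phi b (s^-1 * t + - (w / s))) = s * (a == b)%:R.
Proof.
move=> s0 an bn; rewrite -bphi//.
have c : continuous (fun t : R => t ^+ a * phi b t).
  move=> t; apply: (@continuousM _ _ (fun t : R => t ^+ a)); first exact: exprn_continuous.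
  exact: C1k_continuous (Cphi b 0) t.
have sp : supp1 (-1) 1 (fun t => t ^+ a * phi b t) by move=> t /sphi ->; rewrite mulr0.
exact: (affine_int1 w ltr01 s0 c sp).
Qed.

(** The integral factorises into two integrals over the line, and each substitution contributes one
    factor [s]. *)
Lemma bipoly_dual z s d a b : 0 < s -> (a < n)%N -> (b < n)%N ->
  int2 setT (fun x => bipoly n z s d x * dual_test phi z s a b x) = s ^+ 2 * d a b.
Proof.
move=> s0 an bn.
pose F (ab : 'I_n * 'I_n) : fun2 R :=
  tens (fun t => mono z.1 s ab.1 t * phi a (s^-1 * t + - (z.1 / s)))
       (fun t => mono z.2 s ab.2 t * phi b (s^-1 * t + - (z.2 / s))).
pose M := `|z.1| + `|z.2| + s + 1.
have M0 : 0 < M by rewrite ltr_wpDl// !addr_ge0// ltW.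
have cm (w : R) a' b' : continuous (fun t => mono w s a' t * phi b' (s^-1 * t + - (w / s))).
  apply: (@C1k_continuous _ 0); apply: C1kM; first exact: C1k_mono.
  exact: (C1k_affine _ _ (Cphi _ _)).
have sm (w : R) a' b' : `|w| <= `|z.1| + `|z.2| ->
    supp1 (- M) M (fun t => mono w s a' t * phi b' (s^-1 * t + - (w / s))).
  move=> wM t tM; rewrite (phi_affine_supp (w := w) _ s0) ?mulr0//.
  move=> /andP[h1 h2]; apply: tM.
  by move: wM; rewrite ler_norml /M => /andP[? ?]; apply/andP; split; lra.
have w1 : `|z.1| <= `|z.1| + `|z.2| by rewrite lerDl.
have w2 : `|z.2| <= `|z.1| + `|z.2| by rewrite lerDr.
have iF ab : integrable2 setT (F ab).
  apply: (@supp_integrable _ _ M); [exact: ltW|exact: continuous_tens|].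
  move=> x xM; rewrite /F /tens; have [h|h] := pselect (- M <= x.1 <= M).
    by rewrite (sm z.2 _ _ w2) ?mulr0// => h'; apply: xM.
  by rewrite (sm z.1 _ _ w1)// mul0r.
have -> : (fun x => bipoly n z s d x * dual_test phi z s a b x) =
    (fun x => \sum_(ab : 'I_n * 'I_n) d ab.1 ab.2 * F ab x).
  apply/funext => x; rewrite bipoly_pair mulr_suml; apply: eq_bigr => ab _.
  by rewrite /F /dual_test /tens; ring.
rewrite int2_sum//; last exact: measurableT.
rewrite (bigD1 (Ordinal an, Ordinal bn))//= big1 ?addr0.
  rewrite (int2_tens M0)//; try exact: sm.
  by rewrite /= !int1_mono_dual// !eqxx !mulr1 [RHS]mulrC expr2.
move=> [a' b'] /= ne; rewrite (int2_tens M0)//; try exact: sm.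
rewrite !int1_mono_dual//.
have [/eqP ea|ea] := boolP (a' == a :> nat); last by rewrite ?mulr0 mul0r mulr0.
have [/eqP eb|eb] := boolP (b' == b :> nat); last by rewrite !mulr0.
by exfalso; move/negP: ne; apply; apply/eqP; congr pair; exact/val_inj.
Qed.

End Dual.

Lemma bipoly_boundI n z s m d : 0 <= m ->
  (forall a b, (a < n)%N -> (b < n)%N -> `|d a b| <= m) ->
  bipoly_bound n z s m (bipoly n z s d).
Proof.
move=> m0 dm; exists (fun a b => if (a < n)%N && (b < n)%N then d a b else 0).
  by move=> a b; case: ifPn => [/andP[? ?]|_]; [exact: dm|rewrite normr0].
apply/funext => x; apply: eq_bigr => a _; apply: eq_bigr => b _.
by rewrite !ltn_ord.
Qed.

Lemma measurable2_sqbox z s : measurable2 (sqbox z s).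
Proof. exact: measurable2_cbox. Qed.

(* Testing the weak second derivatives with functions supported in the box
   recovers the coefficients of the classical ones. *)
Theorem inverse_estimate n : exists2 C : R, 0 < C &
  forall (Omega : set (point2 R)) v z s c, open Omega -> H2 Omega v -> 0 < s ->
    sqbox z s `<=` Omega ->
    (forall x, sqbox z s x -> v x = bipoly n z s c x) ->
    forall i k, bipoly_bound n z s
      (Num.sqrt (C * int2 (sqbox z s) (fun x => wD Omega [:: i; k] v x ^+ 2)) / s)
      (partial [:: k; i] (bipoly n z s c)).
Proof.
have [phi [Cphi sphi bphi]] := biorthogonal_exists R n.
have [B B0 BP] : exists2 B, 0 <= B & forall a t, (a < n)%N -> `|phi a t| <= B.
  elim: {bphi} n => [|n [B B0 BP]]; first by exists 0.
  have [C C0 CP] := supp1_bounded (C1k_continuous (Cphi n 0)) (sphi n).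
  exists (B + C) => [|a t]; first exact: addr_ge0.
  rewrite ltnS leq_eqVlt => /predU1P[->|an].
    by rewrite (le_trans (CP t))// lerDr.
  by rewrite (le_trans (BP a t an))// lerDl.
(* The square of a dual function is at most [B]^4 on a box of area 4 s^2; the summand 1 makes the
   constant positive. *)
exists (4 * B ^+ 4 + 1); first by rewrite ltr_wpDl// mulr_ge0// exprn_ge0.
move=> Omega v z s c oO Hv s0 QO vq i k.
have mO := open_measurable2 oO.
set q := bipoly n z s c; set g := wD Omega [:: i; k] v; set H := int2 _ _.
have Sq : smooth2 q by exact: smooth2_bipoly.
(* Only the shape of the derivative is taken from the differentiation rule; its coefficients [d] are
   estimated anew. *)
have [d dE] : exists d, partial [:: k; i] q = bipoly n z s d.
  have [m0 h0] := bipoly_bounded n z s c.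
  by have [d _ dE] := bipoly_bound_derive k s0 (bipoly_bound_derive i s0 h0); exists d; exact: dE.
rewrite dE; apply: bipoly_boundI; first by rewrite divr_ge0 ?sqrtr_ge0// ltW.
move=> a b an bn.
have H0 : 0 <= H by apply: int2_ge0 => x _; exact: sqr_ge0.
pose P := dual_test phi z s a b.
have tQ : test_function (sqbox z s) P by exact: dual_test_test.
have tP : test_function Omega P.
  case: tQ => ? [K [? KQ ?]]; split => //; exists K; split => //.
  exact: subset_trans QO.
have E1 : int2 setT (fun x => partial [:: k; i] q x * P x) = s ^+ 2 * d a b.
  by rewrite dE (bipoly_dual Cphi sphi bphi).
(* Each integration by parts moves the outermost derivative, which reverses the order of the indices
   and explains why [:: k; i] and [:: i; k] correspond. *)
have E2 : int2 setT (fun x => partial [:: k; i] q x * P x) =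
    int2 setT (fun x => q x * partial [:: i; k] P x).
  rewrite (int2_by_parts k (smooth2_partial i Sq 1%N) tP).
  rewrite (_ : partial [:: i; k] P = 'D_(basis_vec R i) ('D_(basis_vec R k) P))//.
  by rewrite (int2_by_parts i (Sq 1%N) (test_partial k tP)) opprK.
have out x l : ~ sqbox z s x -> partial l P x = 0.
  by move=> xQ; exact: test_out (test_partials l tQ) xQ.
(* Since P is supported in the box, the polynomial may be replaced by [v], to which the definition
   of the weak derivative applies. *)
have E3 : int2 setT (fun x => q x * partial [:: i; k] P x) =
    int2 Omega (v \* partial [:: i; k] P).
  rewrite [RHS]int2_mkcond; apply: int2_eq => x _; rewrite patchE.
  have [xQ|xQ] := pselect (sqbox z s x).
    by rewrite mem_set; [rewrite /= vq|exact: QO].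
  by rewrite out// mulr0; case: ifPn => // _;
    rewrite -[RHS]/(v x * partial [:: i; k] P x) (out _ [:: i; k])// mulr0.
have [Lg wP] := @wDP _ _ [:: i; k] v Hv isT.
have E4 : int2 Omega (v \* partial [:: i; k] P) = int2 (sqbox z s) (fun x => g x * P x).
  rewrite (wP _ tP) /= sqrrN expr1n mul1r [LHS]int2_mkcond [RHS]int2_mkcond.
  apply: int2_eq => x _; rewrite !patchE.
  have [xQ|xQ] := pselect (sqbox z s x).
    by rewrite !mem_set//; exact: QO.
  rewrite [in RHS]memNset//; case: ifPn => // _.
  by rewrite /= (out x [::] xQ : P x = 0) mulr0.
have mQ := measurable2_sqbox z s.
have LgQ : L2 (sqbox z s) g by exact: (L2S mO mQ QO Lg).
have LPQ : L2 (sqbox z s) P by exact: test_L2 tP.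
have CS := int2_cauchy_schwarz mQ LgQ LPQ.
have PB : int2 (sqbox z s) (fun x => P x ^+ 2) <= B ^+ 4 * ((z.1 + s - (z.1 - s)) * (z.2 + s - (z.2 - s))).
  apply: int2_bounded => //; try lra.
  - exact: (integrable2_mfun (L2_integrable_sqr mQ LPQ)).
  - exact: exprn_ge0.
  move=> x _; rewrite normrX /P /dual_test /tens normrM.
  rewrite (_ : B ^+ 4 = (B * B) ^+ 2); last by ring.
  rewrite lerXn2r ?nnegrE ?mulr_ge0//; apply: ler_pM => //; exact: BP.
rewrite -/H -E4 -E3 -E2 E1 in CS.
have {CS} CS : (s ^+ 2 * d a b) ^+ 2 <= H * (B ^+ 4 * (4 * s ^+ 2)).
  apply: (le_trans CS); rewrite ler_wpM2l//; apply: (le_trans PB).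
  by rewrite le_eqVlt; apply/orP; left; apply/eqP; ring.
have s20 : 0 < s ^+ 2 by rewrite exprn_gt0.
have {}CS : (s * d a b) ^+ 2 <= (4 * B ^+ 4 + 1) * H.
  apply: (@le_trans _ _ (4 * B ^+ 4 * H)); last by rewrite ler_wpM2r// lerDl.
  rewrite -(ler_pM2l s20) (_ : s ^+ 2 * (4 * B ^+ 4 * H) = H * (B ^+ 4 * (4 * s ^+ 2))); last by ring.
  by rewrite (_ : s ^+ 2 * (s * d a b) ^+ 2 = (s ^+ 2 * d a b) ^+ 2) //; ring.
rewrite ler_pdivlMr// mulrC -[X in X * _](gtr0_norm s0) -normrM -sqrtr_sqr.
exact: ler_wsqrtr.
Qed.

(** The dual functions live in the box and detect every coefficient. *)
Lemma bipoly_eq0_sqbox n z s c : 0 < s ->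
  (forall x, sqbox z s x -> bipoly n z s c x = 0) -> bipoly n z s c = cst 0.
Proof.
move=> s0 c0; have [phi [Cphi sphi bphi]] := biorthogonal_exists R n.
apply/funext => x; apply: big1 => a _; apply: big1 => b _.
have tQ := dual_test_test Cphi sphi z a b s0.
have := bipoly_dual Cphi sphi bphi z c s0 (ltn_ord a) (ltn_ord b).
rewrite (@int2_eq _ _ _ (cst 0)) => [|y _].
  rewrite /int2 (Rintegral_cst _ measurableT) mul0r => /esym/eqP.
  by rewrite mulf_eq0 expf_eq0 /= gt_eqF// => /eqP ->; rewrite mul0r.
have [yQ|yQ] := pselect (sqbox z s y); first by rewrite c0// mul0r.
by rewrite (test_out tQ yQ) mulr0.
Qed.

End InverseEstimate.

(** * Triangles and regular triangulations *)

Section Triangles.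
Variable R : realType.
Implicit Types (T K : triangle R) (a b c x y z : point2 R) (s : seq (point2 R)).

(** Twice the signed area of the triangle with these vertices. *)
Definition det3 a b c : R :=
  (b.1 - a.1) * (c.2 - a.2) - (c.1 - a.1) * (b.2 - a.2).

Lemma areaE T : area T = `|det3 T.1.1 T.1.2 T.2| / 2.
Proof. by []. Qed.

Lemma point_eq x y : x.1 = y.1 -> x.2 = y.2 -> x = y.
Proof. by case: x y => [? ?] [? ?] /= -> ->. Qed.

Definition conv3 a b c x : Prop := exists w0 w1 w2 : R,
  [/\ 0 <= w0, 0 <= w1, 0 <= w2, w0 + w1 + w2 = 1 &
      x.1 = w0 * a.1 + w1 * b.1 + w2 * c.1 /\ x.2 = w0 * a.2 + w1 * b.2 + w2 * c.2].

Lemma closed_triangleP T x : closed_triangle T x <-> conv3 T.1.1 T.1.2 T.2 x.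
Proof.
split=> [[w [w0 w1 ->]]|[w0 [w1 [w2 [h0 h1 h2 hs [e1 e2]]]]]].
  exists (w ord0), (w (lift ord0 ord0)), (w (lift ord0 (lift ord0 ord0))).
  split=> //; first by rewrite -w1 !big_ord_recl big_ord0 addr0 addrA.
  by rewrite !big_ord_recl big_ord0 /= !addr0 !addrA.
exists (fun i => if i == 0%N :> nat then w0 else if i == 1%N :> nat then w1 else w2).
split; first by move=> i; do 2 case: ifPn => _ //.
  by rewrite !big_ord_recl big_ord0 /= addr0 addrA.
by apply: point_eq; rewrite !big_ord_recl big_ord0 /= !addr0 !addrA.
Qed.

Definition affine_fun (f : fun2 R) := exists p q r : R, forall x, f x = p * x.1 + q * x.2 + r.

Lemma affine_hull f s x : affine_fun f -> hull s x ->
  exists w : 'I_(size s) -> R, [/\ forall i, 0 <= w i, \sum_i w i = 1 &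
    f x = \sum_i w i * f s`_i].
Proof.
move=> [p [q [r fE]]] [w [w0 w1 xE]]; exists w; split=> //.
have S1 : x.1 = \sum_i w i * (s`_i).1.
  by rewrite xE; elim/big_rec2: _ => //= i y1 y2 _ ->.
have S2 : x.2 = \sum_i w i * (s`_i).2.
  by rewrite xE; elim/big_rec2: _ => //= i y1 y2 _ ->.
rewrite fE S1 S2 -[r]mulr1 -w1 !mulr_sumr -!big_split /=.
by apply: eq_bigr => i _; rewrite fE; ring.
Qed.

Lemma affine_conv3 f a b c x : affine_fun f -> conv3 a b c x ->
  exists w0 w1 w2 : R, [/\ 0 <= w0, 0 <= w1, 0 <= w2, w0 + w1 + w2 = 1 &
    f x = w0 * f a + w1 * f b + w2 * f c].
Proof.
move=> [p [q [r fE]]] [w0 [w1 [w2 [h0 h1 h2 hs [e1 e2]]]]]; exists w0, w1, w2; split => //.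
rewrite !fE e1 e2 -{1}[r]mulr1 -{1}hs; ring.
Qed.

Lemma affine_eq0_hull f s x : affine_fun f -> (forall y, y \in s -> f y = 0) ->
  hull s x -> f x = 0.
Proof.
move=> af fs /(affine_hull af)[w [_ _ ->]].
by apply: big1 => i _; rewrite fs ?mulr0// mem_nth.
Qed.

Lemma affine_eq0_conv3 f a b c x : affine_fun f -> f a = 0 -> f b = 0 -> f c = 0 ->
  det3 a b c != 0 -> f x = 0.
Proof.
move=> [p [q [r fE]]]; rewrite !fE => fa fb fc D0.
have p0 : p = 0.
  apply: (mulIf D0); rewrite mul0r /det3.
  have -> : p * ((b.1 - a.1) * (c.2 - a.2) - (c.1 - a.1) * (b.2 - a.2)) =
    ((p * b.1 + q * b.2 + r) - (p * a.1 + q * a.2 + r)) * (c.2 - a.2)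
    - ((p * c.1 + q * c.2 + r) - (p * a.1 + q * a.2 + r)) * (b.2 - a.2) by ring.
  by rewrite fa fb fc; ring.
have q0 : q = 0.
  apply: (mulIf D0); rewrite mul0r /det3.
  have -> : q * ((b.1 - a.1) * (c.2 - a.2) - (c.1 - a.1) * (b.2 - a.2)) =
    ((p * c.1 + q * c.2 + r) - (p * a.1 + q * a.2 + r)) * (b.1 - a.1)
    - ((p * b.1 + q * b.2 + r) - (p * a.1 + q * a.2 + r)) * (c.1 - a.1) by ring.
  by rewrite fa fb fc; ring.
by move: fa; rewrite p0 q0; lra.
Qed.

(** The barycentric coordinate belonging to [a], as the quotient of two areas. *)
Definition bary a b c : fun2 R := fun x => det3 x b c / det3 a b c.

Lemma affine_bary a b c : affine_fun (bary a b c).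
Proof.
exists ((b.2 - c.2) / det3 a b c), ((c.1 - b.1) / det3 a b c),
  ((b.1 * c.2 - c.1 * b.2) / det3 a b c) => x.
rewrite /bary {1}/det3; ring.
Qed.

Lemma det3_perm a b c : det3 b c a = det3 a b c.
Proof. rewrite /det3; ring. Qed.

Lemma bary1 a b c : det3 a b c != 0 -> bary a b c a = 1.
Proof. by move=> D0; rewrite /bary divff. Qed.

Lemma bary0l a b c : bary a b c b = 0.
Proof. by rewrite /bary /det3; ring. Qed.

Lemma bary0r a b c : bary a b c c = 0.
Proof. by rewrite /bary /det3; ring. Qed.

Lemma conv3_bary a b c x : det3 a b c != 0 ->
  conv3 a b c x <-> [/\ 0 <= bary a b c x, 0 <= bary b c a x & 0 <= bary c a b x].
Proof.
move=> D0; have D1 : det3 b c a != 0 by rewrite det3_perm.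
have D2 : det3 c a b != 0 by rewrite -det3_perm.
split.
  move=> h; split.
  - have [w0 [w1 [w2 [h0 h1 h2 hs ->]]]] := affine_conv3 (affine_bary a b c) h.
    by rewrite bary1// bary0l bary0r; lra.
  - have [w0 [w1 [w2 [h0 h1 h2 hs ->]]]] := affine_conv3 (affine_bary b c a) h.
    by rewrite bary1// bary0l bary0r; lra.
  - have [w0 [w1 [w2 [h0 h1 h2 hs ->]]]] := affine_conv3 (affine_bary c a b) h.
    by rewrite bary1// bary0l bary0r; lra.
move=> [h0 h1 h2]; exists (bary a b c x), (bary b c a x), (bary c a b x).
split => //; have E1 : bary b c a x = det3 x c a / det3 a b c by rewrite /bary (det3_perm a b c).
  have E2 : bary c a b x = det3 x a b / det3 a b c by rewrite /bary -(det3_perm c a b).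
  by rewrite E1 E2 /bary -!mulrDl -[RHS](divff D0); congr (_ / _); rewrite /det3; ring.
have E2 : bary c a b x = det3 x a b / det3 a b c by rewrite /bary -(det3_perm c a b).
by rewrite E1 E2 /bary; move: D0; rewrite /det3 => D0; split; field.
Qed.

Lemma vertices_uniq T : 0 < area T -> det3 T.1.1 T.1.2 T.2 != 0.
Proof.
rewrite areaE; apply: contraTN => /eqP ->.
by rewrite normr0 mul0r ltxx.
Qed.

Lemma vertex_functional T v : 0 < area T -> v \in vertices T ->
  exists f, [/\ affine_fun f, forall x, closed_triangle T x -> 0 <= f x, f v = 1 &
    forall w, w \in vertices T -> w != v -> f w = 0].
Proof.
move=> /vertices_uniq D0; rewrite /vertices.
have D1 : det3 T.1.2 T.2 T.1.1 != 0 by rewrite det3_perm.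
have D2 : det3 T.2 T.1.1 T.1.2 != 0 by rewrite -det3_perm.
rewrite !inE => /orP[/eqP->|/orP[/eqP->|/eqP->]].
- exists (bary T.1.1 T.1.2 T.2); split; [exact: affine_bary| |exact: bary1|].
    by move=> x /closed_triangleP /(conv3_bary _ D0)[].
  by move=> w; rewrite !inE => /orP[/eqP->|/orP[/eqP->|/eqP->]];
    rewrite ?eqxx// ?bary0l ?bary0r.
- exists (bary T.1.2 T.2 T.1.1); split; [exact: affine_bary| |exact: bary1|].
    by move=> x /closed_triangleP /(conv3_bary _ D0)[].
  by move=> w; rewrite !inE => /orP[/eqP->|/orP[/eqP->|/eqP->]];
    rewrite ?eqxx// ?bary0l ?bary0r.
- exists (bary T.2 T.1.1 T.1.2); split; [exact: affine_bary| |exact: bary1|].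
    by move=> x /closed_triangleP /(conv3_bary _ D0)[].
  by move=> w; rewrite !inE => /orP[/eqP->|/orP[/eqP->|/eqP->]];
    rewrite ?eqxx// ?bary0l ?bary0r.
Qed.

Lemma vertex_in_triangle T v : v \in vertices T -> closed_triangle T v.
Proof.
rewrite /vertices !inE => h; apply/closed_triangleP.
case/orP: h => [/eqP->|/orP[/eqP->|/eqP->]].
- by exists 1, 0, 0; split=> //; [lra|split; ring].
- by exists 0, 1, 0; split=> //; [lra|split; ring].
- by exists 0, 0, 1; split=> //; [lra|split; ring].
Qed.

(** A vertex is an extreme point: its barycentric coordinate is 1 there but vanishes on the hull of
    the other vertices. *)
Lemma hull_vertex_mem T s v : 0 < area T -> v \in vertices T ->
  {subset s <= vertices T} -> hull s v -> v \in s.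
Proof.
move=> T0 vT sT hv; apply: contraT => vs.
have [f [af _ fv fw]] := vertex_functional T0 vT.
have : f v = 0.
  apply: affine_eq0_hull af _ hv => y ys; apply: fw; first exact: sT.
  by apply: contraNN vs => /eqP <-.
by rewrite fv => /eqP; rewrite oner_eq0.
Qed.

Lemma hull2_segment s : (size s <= 2)%N -> exists a b, forall x, hull s x ->
  exists2 t : R, 0 <= t <= 1 & x = (a.1 + t * (b.1 - a.1), a.2 + t * (b.2 - a.2)).
Proof.
case: s => [|a [|b [|//]]] _.
- by exists (0, 0), (0, 0) => x [w [_]]; rewrite big_ord0 => /esym/eqP; rewrite oner_eq0.
- exists a, a => x [w [_]]; rewrite !big_ord_recl !big_ord0 => w1 ->.
  exists 0; first by rewrite lexx ler01.
  by move: w1; rewrite addr0 => ->; apply: point_eq; rewrite /= /GRing.scale /=; ring.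
- exists a, b => x [w [w0]]; rewrite !big_ord_recl !big_ord0 => w1 ->.
  exists (w (lift ord0 ord0)).
    by rewrite w0; have := w0 ord0; lra.
  have E : w ord0 = 1 - w (lift ord0 ord0) by lra.
  by apply: point_eq; rewrite /= /GRing.scale /= E; ring.
Qed.

Lemma segment_hull2 a b (t : R) : 0 <= t <= 1 ->
  hull [:: a; b] (a.1 + t * (b.1 - a.1), a.2 + t * (b.2 - a.2)).
Proof.
move=> /andP[t0 t1].
exists (fun i => if i == 0%N :> nat then 1 - t else t); split.
- by move=> i; case: ifPn => _ //; lra.
- by rewrite !big_ord_recl big_ord0 /=; ring.
- by rewrite !big_ord_recl big_ord0 /=; apply: point_eq; rewrite /= /GRing.scale /=; ring.
Qed.

Lemma hull2_collinear s x y z : (size s <= 2)%N -> hull s x -> hull s y -> hull s z ->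
  det3 x y z = 0.
Proof.
move=> /hull2_segment[a [b H]] /H[t _ ->] /H[u _ ->] /H[v _ ->].
rewrite /det3 /=; ring.
Qed.

Lemma convex_triangle T a b c x : closed_triangle T a -> closed_triangle T b ->
  closed_triangle T c -> conv3 a b c x -> closed_triangle T x.
Proof.
move=> /closed_triangleP[a0 [a1 [a2 [ha0 ha1 ha2 has [ea1 ea2]]]]].
move=> /closed_triangleP[b0 [b1 [b2 [hb0 hb1 hb2 hbs [eb1 eb2]]]]].
move=> /closed_triangleP[c0 [c1 [c2 [hc0 hc1 hc2 hcs [ec1 ec2]]]]].
move=> [w0 [w1 [w2 [h0 h1 h2 hs [e1 e2]]]]]; apply/closed_triangleP.
exists (w0 * a0 + w1 * b0 + w2 * c0), (w0 * a1 + w1 * b1 + w2 * c1), (w0 * a2 + w1 * b2 + w2 * c2).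
split; try by rewrite !addr_ge0 ?mulr_ge0.
  have -> : w0 * a0 + w1 * b0 + w2 * c0 + (w0 * a1 + w1 * b1 + w2 * c1) +
     (w0 * a2 + w1 * b2 + w2 * c2) = w0 * (a0 + a1 + a2) + w1 * (b0 + b1 + b2) + w2 * (c0 + c1 + c2) by ring.
  by rewrite has hbs hcs !mulr1.
by rewrite e1 e2 ea1 eb1 ec1 ea2 eb2 ec2; split; ring.
Qed.

Lemma midpoint_in_triangle T a b : closed_triangle T a -> closed_triangle T b ->
  closed_triangle T (midpoint a b).
Proof.
move=> Ta Tb; apply: (convex_triangle Ta Tb Ta).
exists 2^-1, 2^-1, 0; split; [lra|lra|lra|lra|split; rewrite /midpoint /= /GRing.scale /=; ring].
Qed.

Lemma child1_sub T : closed_triangle (child1 T) `<=` closed_triangle T.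
Proof.
move=> x /closed_triangleP; apply: convex_triangle => /=.
- by apply: vertex_in_triangle; rewrite !inE eqxx !orbT.
- by apply: vertex_in_triangle; rewrite !inE eqxx.
- by apply: midpoint_in_triangle; apply: vertex_in_triangle; rewrite !inE eqxx ?orbT.
Qed.

Lemma child2_sub T : closed_triangle (child2 T) `<=` closed_triangle T.
Proof.
move=> x /closed_triangleP; apply: convex_triangle => /=.
- by apply: vertex_in_triangle; rewrite !inE eqxx !orbT.
- by apply: vertex_in_triangle; rewrite !inE eqxx !orbT.
- by apply: midpoint_in_triangle; apply: vertex_in_triangle; rewrite !inE eqxx ?orbT.
Qed.

Lemma area_child1 T : area (child1 T) = area T / 2.
Proof.
rewrite !areaE /child1 /=.
have -> : det3 T.2 T.1.1 (midpoint T.1.1 T.1.2) = det3 T.1.1 T.1.2 T.2 / 2.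
  by rewrite /det3 /midpoint /= /GRing.scale /=; field.
by rewrite normrM (@ger0_norm _ 2^-1)// invr_ge0.
Qed.

Lemma area_child2 T : area (child2 T) = area T / 2.
Proof.
rewrite !areaE /child2 /=.
have -> : det3 T.1.2 T.2 (midpoint T.1.1 T.1.2) = det3 T.1.1 T.1.2 T.2 / 2.
  by rewrite /det3 /midpoint /= /GRing.scale /=; field.
by rewrite normrM (@ger0_norm _ 2^-1)// invr_ge0.
Qed.

(* Bisection halves both the area and this sum of squares, so that their
   quotient, which controls the shape, is invariant. *)
Definition shape_sum T : R :=
  (T.1.1.1 - T.2.1) ^+ 2 + (T.1.1.2 - T.2.2) ^+ 2 +
  (T.1.2.1 - T.2.1) ^+ 2 + (T.1.2.2 - T.2.2) ^+ 2.

Lemma shape_child1 T : shape_sum (child1 T) = shape_sum T / 2.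
Proof. by rewrite /shape_sum /child1 /midpoint /= /GRing.scale /=; field. Qed.

Lemma shape_child2 T : shape_sum (child2 T) = shape_sum T / 2.
Proof. by rewrite /shape_sum /child2 /midpoint /= /GRing.scale /=; field. Qed.

Lemma area_ge0 T : 0 <= area T.
Proof. by rewrite areaE divr_ge0. Qed.

End Triangles.

(** * Common points of two triangles *)

Section Regular.
Variable R : realType.
Implicit Types (T K : triangle R) (a b c d x y z : point2 R) (s : seq (point2 R)).

Lemma triangle_third_vertex T a b : 0 < area T -> a \in vertices T -> b \in vertices T ->
  a != b -> exists2 c, closed_triangle T c & det3 a b c != 0.
Proof.
move=> T0 aT bT ab; have D0 := vertices_uniq T0.
have v1 : closed_triangle T T.1.1 by apply: vertex_in_triangle; rewrite !inE eqxx.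
have v2 : closed_triangle T T.1.2 by apply: vertex_in_triangle; rewrite !inE eqxx !orbT.
have v3 : closed_triangle T T.2 by apply: vertex_in_triangle; rewrite !inE eqxx !orbT.
have P c x y z : det3 x y z = det3 T.1.1 T.1.2 T.2 \/ det3 x y z = - det3 T.1.1 T.1.2 T.2 ->
    closed_triangle T c -> z = c -> exists2 c, closed_triangle T c & det3 x y c != 0.
  by move=> h Tc zc; exists c => //; rewrite -zc; case: h => ->; rewrite ?oppr_eq0.
move: aT bT ab; rewrite /vertices !inE.
move=> /orP[/eqP->|/orP[/eqP->|/eqP->]] /orP[/eqP->|/orP[/eqP->|/eqP->]]; rewrite ?eqxx // => _.
- by apply: (P _ _ _ _ _ v3 erefl); left.
- by apply: (P _ _ _ _ _ v2 erefl); right; rewrite /det3; ring.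
- by apply: (P _ _ _ _ _ v3 erefl); right; rewrite /det3; ring.
- by apply: (P _ _ _ _ _ v1 erefl); left; rewrite /det3; ring.
- by apply: (P _ _ _ _ _ v2 erefl); left; rewrite /det3; ring.
- by apply: (P _ _ _ _ _ v1 erefl); right; rewrite /det3; ring.
Qed.

(** Moving from the midpoint of a b slightly towards c' leaves the line and stays in both triangles,
    because c lies on the same side. *)
Lemma same_side_overlap T T' a b c c' :
  closed_triangle T a -> closed_triangle T b -> closed_triangle T c ->
  closed_triangle T' a -> closed_triangle T' b -> closed_triangle T' c' ->
  0 < det3 a b c * det3 a b c' ->
  exists d, [/\ closed_triangle T d, closed_triangle T' d & det3 a b d != 0].
Proof.
move=> Ta Tb Tc Ta' Tb' Tc' pos.
have D0 : det3 a b c != 0 by apply: contraTN pos => /eqP ->; rewrite mul0r ltxx.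
have D0' : det3 a b c' != 0 by apply: contraTN pos => /eqP ->; rewrite mulr0 ltxx.
pose al := bary a b c c'; pose be := bary b c a c'.
(* With this choice (1 - t) / 2 = t (|al| + |be|), which outweighs negative barycentric coordinates
   of c'. *)
pose t := (1 + 2 * `|al| + 2 * `|be|)^-1.
have den : 0 < 1 + 2 * `|al| + 2 * `|be| by rewrite !ltr_wpDr// mulr_ge0.
have t0 : 0 < t by rewrite invr_gt0.
have t1 : t * (1 + 2 * `|al| + 2 * `|be|) = 1 by rewrite mulVf// gt_eqF.
have ta : 0 <= t * `|al| by rewrite mulr_ge0// ltW.
have tb : 0 <= t * `|be| by rewrite mulr_ge0// ltW.
pose m : R := (1 - t) / 2.
pose d : point2 R := (m * a.1 + m * b.1 + t * c'.1, m * a.2 + m * b.2 + t * c'.2).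
have m0 : 0 <= m by rewrite divr_ge0//; nra.
have fd f : affine_fun f -> f d = m * f a + m * f b + t * f c'.
  move=> [p [q [r fE]]]; by rewrite !fE /d /= /m; field.
exists d; split.
- apply: (convex_triangle Ta Tb Tc); apply/conv3_bary => //.
  have e1 : bary a b c a = 1 by rewrite bary1.
  have e2 : bary b c a b = 1 by rewrite bary1// det3_perm.
  rewrite (fd _ (affine_bary a b c)) (fd _ (affine_bary b c a)) (fd _ (affine_bary c a b)).
  rewrite e1 e2 !bary0l !bary0r -/al -/be.
  have := ler_norm (- al); have := ler_norm (- be); rewrite !normrN => hb ha.
  have ga : 0 <= bary c a b c'.
    rewrite /bary -[det3 c' a b](det3_perm c' a b) -[det3 c a b](det3_perm c a b).
    rewrite (_ : _ / _ = det3 a b c * det3 a b c' / det3 a b c ^+ 2); last by field.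
    by rewrite divr_ge0 ?sqr_ge0// ltW.
  have tg := mulr_ge0 (ltW t0) ga.
  have ha' : 0 <= t * (`|al| + al) by rewrite mulr_ge0 ?(ltW t0)//; lra.
  have hb' : 0 <= t * (`|be| + be) by rewrite mulr_ge0 ?(ltW t0)//; lra.
  split; rewrite /m; lra.
- by apply: (convex_triangle Ta' Tb' Tc'); exists m, m, t; split => //; [exact: ltW|rewrite /m; lra].
- have aff : affine_fun (det3 a b).
    exists (- (b.2 - a.2)), (b.1 - a.1), (a.1 * (b.2 - a.2) - a.2 * (b.1 - a.1)) => x.
    rewrite /det3; ring.
  rewrite (fd _ aff) (_ : det3 a b a = 0); last by rewrite /det3; ring.
  rewrite (_ : det3 a b b = 0); last by rewrite /det3; ring.
  by rewrite !mulr0 !add0r mulf_neq0// gt_eqF.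
Qed.

Section Fixed.
Variables (Omega : set (point2 R)) (A : {fset triangle R}).
Hypothesis regA : regular_triangulation Omega A.

Lemma regular_area T : T \in A -> 0 < area T.
Proof. by have [+ _ _] := regA; apply. Qed.

Lemma regular_collinear T T' x y z : T \in A -> T' \in A -> T != T' ->
  closed_triangle T x -> closed_triangle T' x ->
  closed_triangle T y -> closed_triangle T' y ->
  closed_triangle T z -> closed_triangle T' z -> det3 x y z = 0.
Proof.
move=> TA TA' TT' Tx Tx' Ty Ty' Tz Tz'.
have [_ _ /(_ _ _ TA TA' TT')[s [s2 _ _ E]]] := regA.
have I v : closed_triangle T v -> closed_triangle T' v -> hull s v by rewrite -E.
by apply: (hull2_collinear s2); exact: I.
Qed.

Lemma regular_same_side T T' a b c c' : T \in A -> T' \in A ->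
  closed_triangle T a -> closed_triangle T b -> closed_triangle T c ->
  closed_triangle T' a -> closed_triangle T' b -> closed_triangle T' c' ->
  0 < det3 a b c * det3 a b c' -> T = T'.
Proof.
move=> TA TA' Ta Tb Tc Ta' Tb' Tc' pos; apply: contrapT => /eqP TT'.
have [d [Td Td' /eqP]] := same_side_overlap Ta Tb Tc Ta' Tb' Tc' pos.
by apply; apply: (regular_collinear TA TA').
Qed.

(** Of three points off the line through a and b, two lie on the same side; regularity identifies
    the triangles they belong to. *)
Lemma neighbor_unique K K' K'' a b : K \in A -> K' \in A -> K'' \in A -> a != b ->
  a \in vertices K -> b \in vertices K -> a \in vertices K' -> b \in vertices K' ->
  a \in vertices K'' -> b \in vertices K'' -> K' != K -> K'' != K -> K' = K''.
Proof.
move=> KA KA' KA'' ab aK bK aK' bK' aK'' bK'' n1 n2.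
have [c Kc c0] := triangle_third_vertex (regular_area KA) aK bK ab.
have [c' Kc' c0'] := triangle_third_vertex (regular_area KA') aK' bK' ab.
have [c'' Kc'' c0''] := triangle_third_vertex (regular_area KA'') aK'' bK'' ab.
have S U U' v v' : U \in A -> U' \in A -> a \in vertices U -> b \in vertices U ->
   a \in vertices U' -> b \in vertices U' -> closed_triangle U v -> closed_triangle U' v' ->
   0 < det3 a b v * det3 a b v' -> U = U'.
  by move=> UA UA' aU bU aU' bU' Uv Uv'; apply: regular_same_side => //; exact: vertex_in_triangle.
have [h|h] := ltP 0 (det3 a b c' * det3 a b c''); first exact: (S K' K'' c' c'').
have [h'|h'] := ltP 0 (det3 a b c * det3 a b c').
  by move: n1; rewrite (S K K' c c')// eqxx.
have [h''|h''] := ltP 0 (det3 a b c * det3 a b c'').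
  by move: n2; rewrite (S K K'' c c'')// eqxx.
exfalso; move: c0 c0' c0'' h h' h''.
set p := det3 a b c; set q := det3 a b c'; set r := det3 a b c''.
rewrite !neq_lt => /orP[p0|p0] /orP[q0|q0] /orP[r0|r0]; nra.
Qed.

Lemma measurable2_affine (f : fun2 R) : affine_fun f ->
  measurable2 [set x : point2 R | 0 <= f x].
Proof.
move=> [p [q [r fE]]].
have cf : continuous f.
  have -> : f = (fun x => (p * x.1 + q * x.2) + r) by apply/funext => x; rewrite fE.
  apply: continuous_add2; last exact: cst_continuous.
  apply: continuous_add2; apply: continuous_mul2; try exact: cst_continuous.
    exact: continuous_fst2.
  exact: continuous_snd2.
have -> : [set x | 0 <= f x] = f @^-1` `[0, +oo[%classic.
  by apply/seteqP; split=> x /=; rewrite in_itv /= andbT.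
have := continuous_measurable_fun2 cf measurableT (measurable_itv `[0, +oo[).
by rewrite setTI.
Qed.

Lemma measurable2_triangle T : 0 < area T -> measurable2 (closed_triangle T).
Proof.
move=> /vertices_uniq D0.
have -> : closed_triangle T = [set x | 0 <= bary T.1.1 T.1.2 T.2 x] `&`
   ([set x | 0 <= bary T.1.2 T.2 T.1.1 x] `&` [set x | 0 <= bary T.2 T.1.1 T.1.2 x]).
  apply/seteqP; split=> x; first by move=> /closed_triangleP /(conv3_bary _ D0)[].
  by move=> [? [? ?]]; apply/closed_triangleP/(conv3_bary _ D0).
by apply: measurableI; [|apply: measurableI]; apply: measurable2_affine; exact: affine_bary.
Qed.

(** A vertical line is the product of a point with the axis; every vertical section of any other
    line is a single point. *)
Lemma leb2_line (p q r : R) : p != 0 \/ q != 0 ->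
  (@leb2 R).-negligible [set x : point2 R | p * x.1 + q * x.2 + r = 0].
Proof.
move=> pq; have [q0|q0] := eqVneq q 0.
  have p0 : p != 0 by case: pq => //; rewrite q0 eqxx.
  pose X : set (measurableTypeR R) := [set - r / p].
  exists (X `*` setT); split.
  - by apply: measurableX => //; exact: measurable_set1.
  - have := @product_measure1E _ _ _ _ R (@lebesgue_measure R) (@lebesgue_measure R)
      X setT (measurable_set1 _) measurableT.
    move=> H; apply: (etrans H).
    have E : (@lebesgue_measure R) X = 0%E by exact: lebesgue_measure_set1.
    by apply: (etrans (congr1 (fun u => u * _)%E E)); rewrite mul0e.
  - move=> x /= h; split => //=; apply: (mulIf p0); rewrite divfK//.
    by move: h; rewrite q0; lra.
pose L : set (mpoint2 R) := [set x | p * x.1 + q * x.2 + r = 0].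
have mL : measurable L.
  have -> : L = [set x | 0 <= p * x.1 + q * x.2 + r] `&` [set x | 0 <= - p * x.1 + - q * x.2 + - r].
    apply/seteqP; split=> x; rewrite /L /=; first by move=> h; split; lra.
    by move=> [? ?]; lra.
  apply: measurableI; apply: measurable2_affine.
    by exists p, q, r.
  by exists (- p), (- q), (- r).
exists L; split => //.
have -> : leb2 R L = (\int[@lebesgue_measure R]_x ((@lebesgue_measure R) \o xsection L) x)%E by [].
rewrite -[RHS](integral0 (@lebesgue_measure R) setT); apply: eq_integral => x _ /=.
rewrite (_ : xsection L x = [set - (p * x + r) / q]); first exact: lebesgue_measure_set1.
apply/seteqP; split=> y; rewrite /xsection /= ?inE /L /=.
  by move=> h; apply: (mulIf q0); rewrite divfK//; lra.
by move=> ->; field.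
Qed.

End Fixed.
End Regular.

(** * Null overlaps and sums of integrals over triangles *)

Section Overlaps.
Variable R : realType.
Implicit Types (T K : triangle R) (a b c d x y z : point2 R) (s : seq (point2 R)).

Lemma hull2_negligible s : (size s <= 2)%N -> (@leb2 R).-negligible (hull s).
Proof.
move=> /hull2_segment[a [b H]].
have [ab|ab] := eqVneq a b.
  apply: negligibleS (leb2_line (p := 1) (q := 0) (- a.1) _).
    move=> x /H[t _ ->] /=; rewrite -ab subrr mulr0; lra.
  by left; exact: oner_neq0.
apply: negligibleS (leb2_line (p := b.2 - a.2) (q := - (b.1 - a.1))
   (- ((b.2 - a.2) * a.1 - (b.1 - a.1) * a.2)) _).
  by move=> x /H[t _ ->] /=; ring.
have [e|] := eqVneq (b.2 - a.2) 0; last by left.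
right; rewrite oppr_eq0; apply: contraNN ab => /eqP e'; apply/eqP/point_eq; lra.
Qed.

Lemma regular_null (Omega : set (point2 R)) (A : {fset triangle R}) T T' :
  regular_triangulation Omega A -> T \in A -> T' \in A -> T != T' ->
  (@leb2 R).-negligible (closed_triangle T `&` closed_triangle T').
Proof.
move=> [_ _ H] TA TA' TT'; have [s [s2 _ _ ->]] := H _ _ TA TA' TT'.
exact: hull2_negligible.
Qed.

Definition union_triangles (X : seq (triangle R)) : set (point2 R) :=
  [set x | exists2 T, T \in X & closed_triangle T x].

Lemma union_triangles_cons T X :
  union_triangles (T :: X) = closed_triangle T `|` union_triangles X.
Proof.
apply/seteqP; split=> x /=.
  move=> [K]; rewrite inE => /orP[/eqP-> ?|KX ?]; first by left.
  by right; exists K.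
move=> [Tx|[K KX Kx]]; first by exists T => //; rewrite inE eqxx.
by exists K => //; rewrite inE KX orbT.
Qed.

Lemma measurable2_union X : (forall T, T \in X -> 0 < area T) ->
  measurable2 (union_triangles X).
Proof.
elim: X => [|T X IH] h.
  rewrite (_ : union_triangles [::] = set0); first exact: measurable0.
  by apply/seteqP; split=> // x [].
rewrite union_triangles_cons; apply: measurableU.
  by apply: measurable2_triangle; apply: h; rewrite inE eqxx.
by apply: IH => K KX; apply: h; rewrite inE KX orbT.
Qed.

Lemma negligible_union T X :
  (forall K, K \in X -> (@leb2 R).-negligible (closed_triangle T `&` closed_triangle K)) ->
  (@leb2 R).-negligible (closed_triangle T `&` union_triangles X).
Proof.
elim: X => [|K X IH] h.
  rewrite (_ : _ `&` _ = set0); first exact: negligible_set0.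
  by apply/seteqP; split=> // x [_ []].
rewrite union_triangles_cons setIUr; apply: negligibleU.
  by apply: h; rewrite inE eqxx.
by apply: IH => K' KX; apply: h; rewrite inE KX orbT.
Qed.

Lemma int2_setD_negligible D E (f : fun2 R) : measurable2 D -> measurable2 E ->
  integrable2 D f -> (@leb2 R).-negligible (D `&` E) ->
  int2 (D `\` E) f = int2 D f.
Proof.
move=> mD mE fD nDE; have mDE : measurable2 (D `\` E) by exact: measurableD.
rewrite int2_mkcond [RHS]int2_mkcond; apply: int2_ae_eq; first exact: measurableT.
- apply/(measurable_fun2_mkcond f mDE).
  exact: (integrable2_mfun (integrable2S mD mDE (@subDsetl _ _ _) fD)).
- by apply/(measurable_fun2_mkcond f mD); exact: integrable2_mfun.
apply: negligibleS nDE => x /= /not_implyP[_] h; apply: contrapT => nDE; apply: h.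
rewrite !patchE; have [Dx|nDx] := pselect (D x); last by rewrite !memNset// => -[].
by rewrite !mem_set//; split => // Ex; apply: nDE.
Qed.

(** Removing from each triangle the union of the later ones makes them disjoint and changes every
    integral by zero only. *)
Lemma int2_sum_triangles X D (f : fun2 R) : uniq X ->
  (forall T, T \in X -> 0 < area T) ->
  (forall T, T \in X -> closed_triangle T `<=` D) ->
  (forall T T', T \in X -> T' \in X -> T != T' ->
     (@leb2 R).-negligible (closed_triangle T `&` closed_triangle T')) ->
  measurable2 D -> integrable2 D f -> (forall x, D x -> 0 <= f x) ->
  \sum_(T <- X) int2 (closed_triangle T) f <= int2 D f.
Proof.
move=> uX aX XD nX mD fD f0.
have UD (Y : seq (triangle R)) : {subset Y <= X} -> union_triangles Y `<=` D.
  by move=> YX x [T TY Tx]; apply: (XD _ (YX _ TY)).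
suff H : \sum_(T <- X) int2 (closed_triangle T) f <= int2 (union_triangles X) f.
  apply: (le_trans H); apply: int2_subset => //; first exact: measurable2_union.
  exact: UD.
elim: X uX aX XD nX UD => [|T X IH] /=.
  by move=> *; rewrite big_nil; apply: int2_ge0 => x [].
move=> /andP[TX uX] aX XD nX UD.
have TT : T \in T :: X by rewrite inE eqxx.
have XX K : K \in X -> K \in T :: X by move=> KX; rewrite inE KX orbT.
have mT : measurable2 (closed_triangle T) by apply: measurable2_triangle; exact: aX.
have mU : measurable2 (union_triangles X).
  by apply: measurable2_union => K /XX; exact: aX.
have mTU : measurable2 (closed_triangle T `\` union_triangles X) by exact: measurableD.
rewrite big_cons union_triangles_cons.
have -> : closed_triangle T `|` union_triangles X =
    (closed_triangle T `\` union_triangles X) `|` union_triangles X.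
  by rewrite setUDl setDv setD0.
have fTU : integrable2 ((closed_triangle T `\` union_triangles X) `|` union_triangles X) f.
  apply: (integrable2S mD) => //; first exact: measurableU.
  move=> x [[Tx _]|Ux]; first by apply: (XD T).
  by apply: (UD X).
rewrite [leRHS](@Rintegral_setU _ _ _ (leb2 R) _ _ _ mTU mU fTU); last first.
  by apply/disj_setPS => x [] [].
have fT : integrable2 (closed_triangle T) f by apply: (integrable2S mD) => //; exact: XD.
apply: lerD.
  rewrite -(int2_setD_negligible mT mU fT)//; apply: negligible_union => K KX.
  apply: nX => //; first exact: XX.
  by apply: contraNneq TX => ->.
apply: IH => //.
- by move=> K /XX; exact: aX.
- by move=> K /XX; exact: XD.
- by move=> K K' /XX KX /XX KX'; exact: nX.
- by move=> Y YX; apply: UD => K /YX /XX.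
Qed.

End Overlaps.

(** * Shape regularity *)

Section Shape.
Variable R : realType.
Implicit Types (T K : triangle R) (a b c d x y z : point2 R).

(* A Lipschitz domain lies on one side of its boundary. *)
Lemma open_sub_closure (Omega U : set (point2 R)) : open Omega ->
  lipschitz_boundary Omega -> open U -> U `<=` closure Omega -> U `<=` Omega.
Proof.
move=> oO lip oU UO x Ux; apply: contrapT => Ox.
have bx : boundary Omega x.
  split; first exact: UO.
  by move=> h; apply: Ox; exact: interior_subset h.
have [d [r [h [L [g [d1 r0 h0 gL [g0 H]]]]]]] := lip x bx.
have [e /= e0 eU] : nbhs_ball x U by apply/nbhs_ballP; exact: open_nbhs_nbhs.
(* The step [ep] against the direction [d] stays in [U] and in the range of the chart; the radius
   [rho] below satisfies 4 (1 + |L|) [rho] <= [ep]. *)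
pose ep := Num.min e h / 4; pose k := 1 + `|L|.
have k0 : 0 < k by rewrite ltr_wpDr.
have eh0 : 0 < Num.min e h by rewrite lt_min e0.
have ep0 : 0 < ep by rewrite divr_gt0.
have epe : ep <= e / 4 by rewrite ler_pM2r ?invr_gt0// ge_min lexx.
have eph : ep <= h / 4 by rewrite ler_pM2r ?invr_gt0// ge_min lexx orbT.
pose rho := Num.min ep r / (4 * k).
have er0 : 0 < Num.min ep r by rewrite lt_min ep0.
have rho0 : 0 < rho by rewrite divr_gt0// mulr_gt0.
have rk : rho * (4 * k) = Num.min ep r by rewrite divfK// gt_eqF// mulr_gt0.
have rhoe : rho * (4 * k) <= ep by rewrite rk ge_min lexx.
have rhor : rho * (4 * k) <= r by rewrite rk ge_min lexx orbT.
have L0 : 0 <= `|L| by [].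
have rL : 0 <= rho * `|L| by rewrite mulr_ge0// ltW.
have d11 : `|d.1| <= 1 by rewrite ler_norml; apply/andP; split; have := sqr_ge0 d.2; nra.
have d21 : `|d.2| <= 1 by rewrite ler_norml; apply/andP; split; have := sqr_ge0 d.1; nra.
(* This point lies below the graph, and by the choice of [rho] so does a ball around it, as the
   slope is at most |L|. Yet [p] belongs to the closure of [Omega], which provides a point of
   [Omega] in that ball. *)
pose p : point2 R := (x.1 - ep * d.1, x.2 - ep * d.2).
have Up : U p.
  apply: eU; split; rewrite /ball /= /p /= opprB addrCA subrr addr0 normrM (gtr0_norm ep0);
    rewrite (le_lt_trans (y := ep))//; try lra.
    by rewrite ler_piMr// ltW.
  by rewrite ler_piMr// ltW.
have /(_ (ball p rho)) [|y [Oy [y1 y2]]] := UO _ Up; first exact: nbhsx_ballx.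
move: y1 y2; rewrite /ball /= /p /= => y1 y2.
pose v1 := y.1 - (x.1 - ep * d.1); pose v2 := y.2 - (x.2 - ep * d.2).
have {}y1 : `|v1| < rho by rewrite distrC.
have {}y2 : `|v2| < rho by rewrite distrC.
pose s := - (v1 * d.2) + v2 * d.1; pose t := - ep + (v1 * d.1 + v2 * d.2).
have prod (u w : R) : `|u| < rho -> `|w| <= 1 -> `|u * w| <= rho.
  by move=> hu hw; rewrite normrM -[leRHS]mulr1 ler_pM// ltW.
have b1 := prod _ _ y1 d21; have b2 := prod _ _ y2 d11.
have b3 := prod _ _ y1 d11; have b4 := prod _ _ y2 d21.
have sb : `|s| <= 2 * rho.
  by rewrite (le_trans (ler_normD _ _))// normrN; lra.
have tb : `|v1 * d.1 + v2 * d.2| <= 2 * rho.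
  by rewrite (le_trans (ler_normD _ _))//; lra.
move: tb; rewrite ler_norml => /andP[tb1 tb2].
have rk' : 4 * rho + 4 * (rho * `|L|) <= ep by move: rhoe; rewrite /k; lra.
have rr' : 4 * rho + 4 * (rho * `|L|) <= r by move: rhor; rewrite /k; lra.
have st : y = (x.1 - s * d.2 + t * d.1, x.2 + s * d.1 + t * d.2).
  apply: point_eq => /=.
  - have -> : x.1 - s * d.2 + t * d.1 = x.1 - ep * d.1 + v1 * (d.1 ^+ 2 + d.2 ^+ 2).
      by rewrite /s /t; ring.
    by rewrite d1 /v1; ring.
  - have -> : x.2 + s * d.1 + t * d.2 = x.2 - ep * d.2 + v2 * (d.1 ^+ 2 + d.2 ^+ 2).
      by rewrite /s /t; ring.
    by rewrite d1 /v2; ring.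
move: Oy; rewrite st H; last 2 first.
- by rewrite (le_lt_trans sb)//; lra.
- by rewrite ltr_norml /t; apply/andP; split; lra.
have gs : - (2 * rho * `|L|) <= g s.
  have := gL s 0; rewrite g0 !subr0 => h1.
  have h2 : L * `|s| <= `|L| * (2 * rho).
    by rewrite (le_trans (ler_wpM2r _ (ler_norm L)))// ler_wpM2l.
  have := le_trans h1 h2; rewrite ler_norml => /andP[+ _]; lra.
move=> gt; have : t <= - ep + 2 * rho by rewrite /t; lra.
lra.
Qed.

(** A stand-in for the diameter, to which it is equivalent for shape-regular triangles. The weights
    of the estimator are its powers 4, 1 and 3. *)
Definition diam T : R := Num.sqrt (area T).

Lemma diam_ge0 T : 0 <= diam T. Proof. exact: sqrtr_ge0. Qed.

Lemma diam_gt0 T : 0 < area T -> 0 < diam T. Proof. by move=> ?; rewrite sqrtr_gt0. Qed.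

Lemma diam_sqr T : diam T ^+ 2 = area T.
Proof. by rewrite sqr_sqrtr// area_ge0. Qed.

Section Bounds.
Variables (kap : R) (T : triangle R).
Hypothesis kap0 : 0 < kap.
Hypothesis T0 : 0 < area T.
Hypothesis shT : shape_sum T <= kap * area T.

(** Each coordinate of a vertex differs from that of the newest one by at most sqrt(kap |T|), hence
    two vertices by at most [dil kap] times |T|^(1/2). *)
Definition dil (kap : R) : R := 2 * Num.sqrt kap.
Let D := dil kap.
Let h := diam T.

Lemma dil_gt0 : 0 < D.
Proof. by rewrite mulr_gt0// sqrtr_gt0. Qed.

Lemma coord_bound (u : R) : u ^+ 2 <= shape_sum T -> `|u| <= D / 2 * h.
Proof.
move=> uS; have -> : D / 2 * h = Num.sqrt kap * Num.sqrt (area T).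
  by rewrite /D /dil /h /diam; field.
rewrite -sqrtrM; last exact: ltW.
rewrite -sqrtr_sqr; apply: ler_wsqrtr; exact: le_trans uS shT.
Qed.

Lemma vertex_apex v : v \in vertices T ->
  `|v.1 - T.2.1| <= D / 2 * h /\ `|v.2 - T.2.2| <= D / 2 * h.
Proof.
have q u := sqr_ge0 (u : R).
rewrite /vertices !inE => /orP[/eqP->|/orP[/eqP->|/eqP->]].
- by split; apply: coord_bound; rewrite /shape_sum;
   have := (q (T.1.1.1 - T.2.1), q (T.1.1.2 - T.2.2), q (T.1.2.1 - T.2.1), q (T.1.2.2 - T.2.2));
   move=> [[[? ?] ?] ?]; lra.
- by split; apply: coord_bound; rewrite /shape_sum;
   have := (q (T.1.1.1 - T.2.1), q (T.1.1.2 - T.2.2), q (T.1.2.1 - T.2.1), q (T.1.2.2 - T.2.2));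
   move=> [[[? ?] ?] ?]; lra.
- have := dil_gt0; rewrite -/D => D0; have := diam_ge0 T; rewrite -/h => h0.
  by rewrite !subrr normr0; split; rewrite mulr_ge0// ?divr_ge0// ltW.
Qed.

Lemma vertex_dist v w : v \in vertices T -> w \in vertices T ->
  `|v.1 - w.1| <= D * h /\ `|v.2 - w.2| <= D * h.
Proof.
move=> /vertex_apex[+ +] /vertex_apex[+ +].
rewrite !ler_norml => /andP[? ?] /andP[? ?] /andP[? ?] /andP[? ?].
by split; apply/andP; split; lra.
Qed.

Definition centroid : point2 R :=
  ((T.1.1.1 + T.1.2.1 + T.2.1) / 3, (T.1.1.2 + T.1.2.2 + T.2.2) / 3).

Lemma triangle_vertex_dist x v : closed_triangle T x -> v \in vertices T ->
  `|x.1 - v.1| <= D * h /\ `|x.2 - v.2| <= D * h.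
Proof.
move=> /closed_triangleP[w0 [w1 [w2 [h0 h1 h2 hs [-> ->]]]]] vT.
have [a1 a2] := vertex_dist (mem_head _ _ : T.1.1 \in vertices T) vT.
have [b1 b2] : `|T.1.2.1 - v.1| <= D * h /\ `|T.1.2.2 - v.2| <= D * h.
  by apply: vertex_dist => //; rewrite !inE eqxx orbT.
have [c1 c2] : `|T.2.1 - v.1| <= D * h /\ `|T.2.2 - v.2| <= D * h.
  by apply: vertex_dist => //; rewrite !inE eqxx !orbT.
have key (p q r t B : R) : `|p - t| <= B -> `|q - t| <= B -> `|r - t| <= B ->
    `|w0 * p + w1 * q + w2 * r - t| <= B.
  move=> hp hq hr.
  have -> : w0 * p + w1 * q + w2 * r - t = w0 * (p - t) + w1 * (q - t) + w2 * (r - t).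
    by rewrite -{1}[t]mulr1 -{1}hs; ring.
  rewrite (le_trans (ler_normD _ _))// (le_trans (lerD (ler_normD _ _) (lexx _)))//.
  rewrite !normrM !(@ger0_norm _ w0, @ger0_norm _ w1, @ger0_norm _ w2)//.
  rewrite (_ : B = w0 * B + w1 * B + w2 * B); last by rewrite -!mulrDl hs mul1r.
  by rewrite !lerD// ler_wpM2l.
by split; apply: key.
Qed.

Lemma triangle_centroid_dist x : closed_triangle T x ->
  `|x.1 - centroid.1| <= D * h /\ `|x.2 - centroid.2| <= D * h.
Proof.
move=> Tx.
have [a1 a2] := triangle_vertex_dist Tx (mem_head _ _ : T.1.1 \in vertices T).
have [b1 b2] : `|x.1 - T.1.2.1| <= D * h /\ `|x.2 - T.1.2.2| <= D * h.
  by apply: triangle_vertex_dist => //; rewrite !inE eqxx orbT.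
have [c1 c2] : `|x.1 - T.2.1| <= D * h /\ `|x.2 - T.2.2| <= D * h.
  by apply: triangle_vertex_dist => //; rewrite !inE eqxx !orbT.
move: a1 a2 b1 b2 c1 c2; rewrite !ler_norml /centroid /=.
move=> /andP[? ?] /andP[? ?] /andP[? ?] /andP[? ?] /andP[? ?] /andP[? ?].
by split; apply/andP; split; lra.
Qed.

(** All barycentric coordinates of the centroid are 1/3. With s = h / (6 D), a shift by at most 2 s
    in each coordinate changes a numerator by at most 4 s D h, while the denominator is 2 h^2; the
    quotient is 1/3. *)
Lemma centroid_box : sqbox centroid (2 * (h / (6 * D))) `<=` closed_triangle T.
Proof.
have D0 := dil_gt0; have h0 : 0 < h := diam_gt0 T0.
set s := h / (6 * D).
have sD : 6 * (s * D) = h by rewrite /s; field; rewrite gt_eqF.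
have det0 := vertices_uniq T0.
have hd : `|det3 T.1.1 T.1.2 T.2| = 2 * h ^+ 2.
  by rewrite /h diam_sqr areaE mulrC divfK.
move=> x [x1 x2].
have [v1 hv1] : exists2 v1, x.1 = centroid.1 + v1 & `|v1| <= 2 * s.
  exists (x.1 - centroid.1); first by rewrite addrC subrK.
  by rewrite ler_norml; move: x1 => /andP[? ?]; apply/andP; split; lra.
have [v2 hv2] : exists2 v2, x.2 = centroid.2 + v2 & `|v2| <= 2 * s.
  exists (x.2 - centroid.2); first by rewrite addrC subrK.
  by rewrite ler_norml; move: x2 => /andP[? ?]; apply/andP; split; lra.
move=> {x1 x2} b2 b1.
have m1 : T.1.1 \in vertices T by rewrite !inE eqxx.
have m2 : T.1.2 \in vertices T by rewrite !inE eqxx orbT.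
have m3 : T.2 \in vertices T by rewrite !inE eqxx !orbT.
have key (a b c : point2 R) : det3 a b c = det3 T.1.1 T.1.2 T.2 ->
    b \in vertices T -> c \in vertices T ->
    det3 x b c = det3 a b c / 3 + (v1 * (b.2 - c.2) - v2 * (b.1 - c.1)) ->
    0 <= bary a b c x.
  move=> E bT cT xE; rewrite /bary xE E.
  have [d1 d2] := vertex_dist bT cT.
  set w := v1 * _ - v2 * _.
  have wb : `|w| <= 2 / 3 * h ^+ 2.
    rewrite (le_trans (ler_normB _ _))// !normrM.
    have := ler_pM (normr_ge0 _) (normr_ge0 _) b1 d2.
    have := ler_pM (normr_ge0 _) (normr_ge0 _) b2 d1.
    have -> : 2 * s * (D * h) = h * (6 * (s * D)) / 3 by field.
    rewrite sD expr2; lra.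
  have -> : (det3 T.1.1 T.1.2 T.2 / 3 + w) / det3 T.1.1 T.1.2 T.2 =
     3^-1 + w / det3 T.1.1 T.1.2 T.2 by field.
  have : `|w / det3 T.1.1 T.1.2 T.2| <= 3^-1.
    rewrite normrM normfV hd ler_pdivrMr ?mulr_gt0 ?exprn_gt0//.
    by rewrite (le_trans wb)//; lra.
  by rewrite ler_norml => /andP[? ?]; lra.
apply/closed_triangleP/(conv3_bary _ det0); split; apply: key => //.
- by rewrite /det3 hv1 hv2 /centroid /=; field.
- by rewrite det3_perm.
- by rewrite /det3 hv1 hv2 /centroid /=; field.
- by rewrite -det3_perm.
- by rewrite /det3 hv1 hv2 /centroid /=; field.
Qed.

Lemma eucl_ge (a b : point2 R) : `|a.1 - b.1| <= Defs.edist a b /\ `|a.2 - b.2| <= Defs.edist a b.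
Proof.
by split; rewrite -sqrtr_sqr; apply: ler_wsqrtr; rewrite ?lerDl ?lerDr sqr_ge0.
Qed.

Lemma eucl_le (a b : point2 R) : Defs.edist a b <= `|a.1 - b.1| + `|a.2 - b.2|.
Proof.
have n0 : 0 <= `|a.1 - b.1| + `|a.2 - b.2| by rewrite addr_ge0.
rewrite -[leRHS]ger0_norm// -sqrtr_sqr; apply: ler_wsqrtr.
rewrite -(real_normK (num_real (a.1 - b.1))) -(real_normK (num_real (a.2 - b.2))).
by have := mulr_ge0 (normr_ge0 (a.1 - b.1)) (normr_ge0 (a.2 - b.2)); nra.
Qed.

Lemma vertex_edist v w : v \in vertices T -> w \in vertices T -> Defs.edist v w <= 2 * D * h.
Proof.
move=> vT wT; have [? ?] := vertex_dist vT wT.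
by rewrite (le_trans (eucl_le _ _))//; lra.
Qed.

(** Twice the area, 2 h^2, is bounded by the edge length times the coordinate differences to the
    third vertex, which are at most D h. *)
Lemma diam_le_edist v w : v \in vertices T -> w \in vertices T -> v != w ->
  h <= D * Defs.edist v w.
Proof.
move=> vT wT vw; have h0 : 0 < h := diam_gt0 T0.
have [c cT hc] : exists2 c, c \in vertices T & `|det3 v w c| = `|det3 T.1.1 T.1.2 T.2|.
  have m1 : T.1.1 \in vertices T by rewrite !inE eqxx.
  have m2 : T.1.2 \in vertices T by rewrite !inE eqxx orbT.
  have m3 : T.2 \in vertices T by rewrite !inE eqxx !orbT.
  have P a b c : det3 a b c = det3 T.1.1 T.1.2 T.2 \/ det3 a b c = - det3 T.1.1 T.1.2 T.2 ->
      c \in vertices T -> exists2 c, c \in vertices T & `|det3 a b c| = `|det3 T.1.1 T.1.2 T.2|.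
    by move=> [e|e] cT; exists c; rewrite ?e ?normrN.
  move: vT wT vw; rewrite /vertices !inE.
  move=> /orP[/eqP->|/orP[/eqP->|/eqP->]] /orP[/eqP->|/orP[/eqP->|/eqP->]]; rewrite ?eqxx // => _.
  - by apply: (P _ _ _ _ m3); left.
  - by apply: (P _ _ _ _ m2); right; rewrite /det3; ring.
  - by apply: (P _ _ _ _ m3); right; rewrite /det3; ring.
  - by apply: (P _ _ _ _ m1); left; rewrite /det3; ring.
  - by apply: (P _ _ _ _ m2); left; rewrite /det3; ring.
  - by apply: (P _ _ _ _ m1); right; rewrite /det3; ring.
have hd : `|det3 v w c| = 2 * h ^+ 2.
  by rewrite hc /h diam_sqr areaE mulrC divfK.
have [e1 e2] := eucl_ge v w; have [c1 c2] := vertex_dist cT vT.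
have : 2 * h ^+ 2 <= 2 * (Defs.edist v w * (D * h)).
  rewrite -hd /det3 (le_trans (ler_normB _ _))// !normrM.
  rewrite distrC in e1; rewrite distrC in e2.
  have := ler_pM (normr_ge0 _) (normr_ge0 _) e1 c2.
  have := ler_pM (normr_ge0 _) (normr_ge0 _) c1 e2.
  rewrite [Defs.edist v w * _]mulrC; lra.
have -> : Defs.edist v w * (D * h) = D * Defs.edist v w * h by ring.
by rewrite expr2 !(ler_pM2l, ler_pM2r).
Qed.

End Bounds.
End Shape.

(** * Newest-vertex bisection *)

Section Bisection.
Variable R : realType.
Implicit Types (T K : triangle R) (A B : {fset triangle R}) (a b x y z : point2 R).

Lemma bisection_stepP A B K : bisection_step A B -> K \in B ->
  K \in A \/ exists2 T, T \in A & K = child1 T \/ K = child2 T.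
Proof.
move=> [T TA ->]; rewrite !inE => /orP[/andP[_ KA]|/orP[/eqP->|/eqP->]]; first by left.
  by right; exists T => //; left.
by right; exists T => //; right.
Qed.

Lemma nvb_inv (P : triangle R -> Prop) A B : nvb_refinement A B ->
  (forall T, P T -> P (child1 T) /\ P (child2 T)) ->
  (forall T, T \in A -> P T) -> forall K, K \in B -> P K.
Proof.
move=> AB Pch; elim: AB => [A1 B1 st PA K KB|//|A1 B1 C1 _ IH1 _ IH2 PA].
  have [KA|[T TA [->|->]]] := bisection_stepP st KB; first exact: PA.
    by have [] := Pch T (PA T TA).
  by have [] := Pch T (PA T TA).
by apply: IH2; exact: IH1.
Qed.

Lemma sum_subset (I : eqType) (s l : seq I) (F : I -> R) : uniq s ->
  {subset s <= l} -> (forall i, 0 <= F i) -> \sum_(i <- s) F i <= \sum_(i <- l) F i.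
Proof.
move=> us sl F0; elim: s us l sl => [|i s IH] /= us l sl.
  by rewrite big_nil sumr_ge0.
have il : i \in l by apply: sl; rewrite inE eqxx.
move: us => /andP[ns us].
rewrite big_cons (perm_big _ (perm_to_rem il)) big_cons lerD2l; apply: IH => // j js.
have jl : j \in l by apply: sl; rewrite inE js orbT.
move: jl; rewrite (perm_mem (perm_to_rem il)) inE => /orP[/eqP ji|//].
by move: ns; rewrite -ji js.
Qed.

Lemma nvb_sum (P : triangle R -> Prop) (theta : triangle R -> R) A B :
  nvb_refinement A B ->
  (forall T, P T -> P (child1 T) /\ P (child2 T)) ->
  (forall T, T \in A -> P T) ->
  (forall T, 0 <= theta T) ->
  (forall T, P T -> theta (child1 T) + theta (child2 T) <= theta T) ->
  \sum_(K <- B) theta K <= \sum_(K <- A) theta K.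
Proof.
move=> AB Pch PA th0 thch; elim: AB PA => [A1 B1 st PA|//|A1 B1 C1 AB1 IH1 _ IH2 PA].
  have [T TA BE] := st.
  (* As finite sets could merge equal elements, the sum is compared with one over a list with
     possible repetitions; this is where [theta] has to be nonnegative. *)
  apply: (@le_trans _ _ (\sum_(K <- [:: child1 T, child2 T & (A1 `\ T)%fset]) theta K)).
    apply: sum_subset => // K.
    by rewrite BE !inE => /orP[->|/orP[->|->]]; rewrite ?orbT.
  rewrite !big_cons addrA (big_fsetD1 T TA) /= lerD2r.
  by apply: thch; exact: PA.
apply: (le_trans _ (IH1 PA)); apply: IH2.
exact: (nvb_inv AB1 Pch PA).
Qed.

Lemma nvb_ancestor A B K : nvb_refinement A B -> K \in B ->
  exists T, [/\ T \in A, closed_triangle K `<=` closed_triangle T &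
    K = T \/ area K <= area T / 2].
Proof.
move=> AB; move: K; apply: (nvb_inv AB); last first.
  by move=> T TA; exists T; split => //; left.
move=> K [T [TA KT h]].
have aK : area K / 2 <= area T / 2.
  rewrite ler_pM2r ?invr_gt0//; case: h => [->//|h].
  by rewrite (le_trans h)// ler_pdivrMr// ler_peMr ?area_ge0// ler1n.
split; exists T; split => //.
- exact: subset_trans (@child1_sub _ K) KT.
- by right; rewrite area_child1.
- exact: subset_trans (@child2_sub _ K) KT.
- by right; rewrite area_child2.
Qed.

Lemma nvb_shape (kap : R) A B : nvb_refinement A B ->
  (forall T, T \in A -> shape_sum T <= kap * area T) ->
  forall K, K \in B -> shape_sum K <= kap * area K.
Proof.
move=> AB hA; apply: (nvb_inv AB) hA => T hT.
by rewrite shape_child1 shape_child2 area_child1 area_child2 mulrA ler_pM2r ?invr_gt0.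
Qed.

Lemma nvb_area (m : R) A B : nvb_refinement A B ->
  (forall T, T \in A -> area T <= m) -> forall K, K \in B -> area K <= m.
Proof.
move=> AB hA; apply: (nvb_inv AB) hA => T hT; have := area_ge0 T.
by rewrite area_child1 area_child2; split; lra.
Qed.

Lemma one_level_sub A B K : one_level_refinement A B -> K \in B ->
  exists2 T, T \in A & closed_triangle K `<=` closed_triangle T.
Proof.
move=> [f [fT H]] /H[T TA Kf]; exists T => //; move: Kf.
have c1 := @child1_sub _ T; have c2 := @child2_sub _ T.
have c11 := subset_trans (@child1_sub _ (child1 T)) c1.
have c12 := subset_trans (@child2_sub _ (child1 T)) c1.
have c21 := subset_trans (@child1_sub _ (child2 T)) c2.
have c22 := subset_trans (@child2_sub _ (child2 T)) c2.
move: (fT T TA); rewrite /one_level_splits !inE.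
by move=> /orP[/eqP->|/orP[/eqP->|/orP[/eqP->|/orP[/eqP->|/eqP->]]]]; rewrite !inE -?orbA;
  do ?[move=> /orP[/eqP-> //|]]; move=> /eqP->.
Qed.

Lemma level_sequence_sub Omega Tinit A m S K : level_sequence Omega Tinit A m S ->
  K \in A -> forall k, (k <= m)%N ->
  exists2 T, T \in S k & closed_triangle K `<=` closed_triangle T.
Proof.
move=> [_ Sm _ Sk] KA k km.
have H j : (j <= m)%N -> exists2 T, T \in S (m - j)%N & closed_triangle K `<=` closed_triangle T.
  elim: j => [|j IH] jm; first by rewrite subn0 Sm; exists K.
  have [T TS KT] := IH (ltnW jm).
  have E : (m - j)%N = (m - j.+1).+1 by rewrite subnSK.
  have lt : (m - j.+1 < m)%N by rewrite -E leq_subr.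
  rewrite E in TS; have [T' T'S TT'] := one_level_sub (Sk _ lt) TS.
  by exists T' => //; exact: subset_trans TT'.
by have := H (m - k)%N (leq_subr _ _); rewrite subKn.
Qed.

End Bisection.

(** * Edge integrals *)

Section EdgeIntegrals.
Variable R : realType.
Implicit Types (f : fun2 R) (E : point2 R * point2 R) (x y : point2 R).
Notation mu := (@lebesgue_measure R).

Lemma itv_integrable (F : R -> R) (a b : R) : continuous F ->
  mu.-integrable `[a, b] (EFin \o F).
Proof.
move=> cF; apply: continuous_compact_integrable; first exact: segment_compact.
exact: continuous_subspaceT.
Qed.

Lemma affine_integral01 (F : R -> R) (c s : R) : 0 < s -> continuous F ->
  (\int[mu]_(t in `[0%R, 1%R]) F (s * t + c) = s^-1 * \int[mu]_(t in `[c, c + s]) F t)%R.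
Proof.
move=> s0 cF; pose G t := s * t + c.
have s0' : s != 0 by rewrite gt_eqF.
have dG t : is_derive (t : R) (1 : R) G s by exact: is_derive_affine.
have G' : derive1 G = cst s by apply/funext => t; exact: is_derive1E.
have cG : continuous G by exact: C1k_continuous (C1k_affine s c (@C1k_id R 0)).
have cFG : continuous (fun t => F (G t)).
  by move=> t; apply: (@continuous_comp _ _ _ G F); [exact: cG|exact: cF].
have -> : `[c, c + s]%classic = `[G 0, G 1]%classic by rewrite /G mulr0 add0r mulr1 addrC.
rewrite /Rintegral (@integration_by_substitution_increasing _ G F) ?ler01//.
- rewrite G'; under [in RHS]eq_integral => t _ do rewrite /= mulrC EFinM.
  rewrite integralZl//=; last exact: itv_integrable.
  have fI : (\int[mu]_(x in `[0%R, 1%R]) (F (G x))%:E)%E \is a fin_num.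
    by apply: integrable_fin_num; [exact: measurable_itv|exact: itv_integrable].
  by rewrite fineM// mulrA mulVf// mul1r.
- by move=> x y _ _ xy; rewrite /G ltrD2r ltr_pM2l.
- by rewrite G' => x _; exact: cst_continuous.
- by rewrite G'; exact: is_cvg_cst.
- by rewrite G'; exact: is_cvg_cst.
- split; [by move=> x _; exact: ex_derive|exact: cvg_at_right_filter (cG _)|exact: cvg_at_left_filter (cG _)].
- exact: continuous_subspaceT.
Qed.

Lemma edge_integral_ge0 E f : (forall x, 0 <= f x) -> 0 <= edge_integral E f.
Proof. by move=> f0; rewrite mulr_ge0 ?sqrtr_ge0// Rintegral_ge0. Qed.

Lemma edist_midl x y : Defs.edist x (midpoint x y) = Defs.edist x y / 2.
Proof.
rewrite /Defs.edist /midpoint /= /GRing.scale /=.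
rewrite (_ : _ + _ = ((x.1 - y.1) ^+ 2 + (x.2 - y.2) ^+ 2) * (2^-1) ^+ 2); last by field.
by rewrite sqrtrM ?addr_ge0 ?sqr_ge0// sqrtr_sqr ger0_norm// invr_ge0.
Qed.

Lemma edist_midr x y : Defs.edist (midpoint x y) y = Defs.edist x y / 2.
Proof.
rewrite /Defs.edist /midpoint /= /GRing.scale /=.
rewrite (_ : _ + _ = ((x.1 - y.1) ^+ 2 + (x.2 - y.2) ^+ 2) * (2^-1) ^+ 2); last by field.
by rewrite sqrtrM ?addr_ge0 ?sqr_ge0// sqrtr_sqr ger0_norm// invr_ge0.
Qed.

Lemma normal_midl x y : normal (x, midpoint x y) = normal (x, y).
Proof.
rewrite /normal /= edist_midl /midpoint /= /GRing.scale /= !invfM invrK.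
by move: (Defs.edist x y)^-1 => e; apply: point_eq => /=; field.
Qed.

Lemma normal_midr x y : normal (midpoint x y, y) = normal (x, y).
Proof.
rewrite /normal /= edist_midr /midpoint /= /GRing.scale /= !invfM invrK.
by move: (Defs.edist x y)^-1 => e; apply: point_eq => /=; field.
Qed.

Lemma continuous_line f x y : continuous f -> continuous (fun t : R => f (x + t *: (y - x))).
Proof.
move=> cf t; have cl (u v : R) : continuous (fun t : R => u + t * (v - u)).
  have -> : (fun t : R => u + t * (v - u)) = (fun t => (v - u) * t + u).
    by apply/funext => t'; ring.
  exact: C1k_continuous (C1k_affine (v - u) u (@C1k_id R 0)).
apply: (@continuous2_cvg _ _ _ _ _ _ (fun t : R => x.1 + t * (y.1 - x.1))
  (fun t : R => x.2 + t * (y.2 - x.2)) (fun a b => f (a, b)) (x.1 + t * (y.1 - x.1))).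
- by rewrite (_ : (fun z => _) = f); [exact: cf|apply/funext => -[]].
- exact: cl.
- exact: cl.
Qed.

Lemma edge_integral_split x y f : continuous f ->
  edge_integral (x, midpoint x y) f + edge_integral (midpoint x y, y) f
    = edge_integral (x, y) f.
Proof.
move=> cf; rewrite /edge_integral /= edist_midl edist_midr -mulrDr -mulrA; congr (_ * _).
pose F (t : R) := f (x + t *: (y - x)).
have cF : continuous F by exact: continuous_line.
have i2 : (0 : R) < 2^-1 by rewrite invr_gt0.
have -> : (\int[mu]_(t in `[0%R, 1%R]) f (x + t *: (midpoint x y - x)) =
           \int[mu]_(t in `[0%R, 1%R]) F (2^-1 * t + 0))%R.
  apply: eq_Rintegral => t _; congr f.
  by apply: point_eq; rewrite /midpoint /= /GRing.scale /=; field.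
have -> : (\int[mu]_(t in `[0%R, 1%R]) f (midpoint x y + t *: (y - midpoint x y)) =
           \int[mu]_(t in `[0%R, 1%R]) F (2^-1 * t + 2^-1))%R.
  apply: eq_Rintegral => t _; congr f.
  by apply: point_eq; rewrite /midpoint /= /GRing.scale /=; field.
rewrite !affine_integral01// invrK -mulrDr mulrA mulVf ?mul1r// add0r.
rewrite (_ : 2^-1 + 2^-1 = 1); last by field.
have := @Rintegral_itvB R F (BLeft 0) (BRight 1) 2^-1 (itv_integrable 0 1 cF).
rewrite !bnd_simp => /(_ (ltW i2)) H.
have {H} -> : (\int[mu]_(t in `[2^-1%R, 1%R]) F t =
   \int[mu]_(t in `[0%R, 1%R]) F t - \int[mu]_(t in `[0%R, 2^-1%R]) F t)%R.
  rewrite H; last by rewrite invf_le1// ler1n.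
  apply/esym; apply: Rintegral_itv_obnd_cbnd.
  apply: integrableS (itv_integrable _ _ cF) => //; exact: subset_itv_oc_cc.
by rewrite addrC subrK.
Qed.

Lemma edge_integral_le E f g : continuous f -> continuous g ->
  (forall x, f x <= g x) -> edge_integral E f <= edge_integral E g.
Proof.
move=> cf cg fg; rewrite ler_wpM2l ?sqrtr_ge0//.
have if_ := itv_integrable 0 1 (continuous_line (x := E.1) (y := E.2) cf).
have ig_ := itv_integrable 0 1 (continuous_line (x := E.1) (y := E.2) cg).
by apply: (@le_Rintegral _ _ R mu _ _ _ (measurable_itv `[0, 1]) if_ ig_) => t _; exact: fg.
Qed.

Lemma edge_integral_comb E (a b : R) f g : continuous f -> continuous g ->
  edge_integral E (fun x => a * f x + b * g x) = a * edge_integral E f + b * edge_integral E g.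
Proof.
move=> cf cg; rewrite /edge_integral.
have if_ := itv_integrable 0 1 (continuous_line (x := E.1) (y := E.2) cf).
have ig_ := itv_integrable 0 1 (continuous_line (x := E.1) (y := E.2) cg).
have ca : continuous (fun x => a * f x) by apply: continuous_mul2 => //; exact: cst_continuous.
have cb : continuous (fun x => b * g x) by apply: continuous_mul2 => //; exact: cst_continuous.
have ia := itv_integrable 0 1 (continuous_line (x := E.1) (y := E.2) ca).
have ib := itv_integrable 0 1 (continuous_line (x := E.1) (y := E.2) cb).
have mI : measurable (`[(0 : R), 1]%classic : set (measurableTypeR R)) by exact: measurable_itv.
have -> := @RintegralD _ _ R mu _ _ _ mI ia ib.
have -> := @RintegralZl _ _ R mu _ _ a mI if_.
have -> := @RintegralZl _ _ R mu _ _ b mI ig_.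
ring.
Qed.

Lemma edge_integral_bound E f M : continuous f -> (forall t : R, 0 <= t <= 1 ->
  f (E.1 + t *: (E.2 - E.1)) <= M) -> edge_integral E f <= Defs.edist E.1 E.2 * M.
Proof.
move=> cf fM; rewrite ler_wpM2l ?sqrtr_ge0//.
have -> : M = (\int[mu]_(t in `[0%R, 1%R]) (cst M) t)%R.
  have E1 : mu `[(0 : R), 1]%classic = 1%:E.
    by rewrite lebesgue_measure_itv /= lte_fin ltr01 oppr0 adde0.
  rewrite (Rintegral_cst mu (measurable_itv `[0, 1])).
  by rewrite (congr1 fine E1 : fine _ = 1) mulr1.
have if_ := itv_integrable 0 1 (continuous_line (x := E.1) (y := E.2) cf).
have ig_ := itv_integrable 0 1 (@cst_continuous _ _ M).
apply: (@le_Rintegral _ _ R mu _ _ _ (measurable_itv `[0, 1]) if_ ig_) => t /=.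
by rewrite in_itv /=; exact: fM.
Qed.

End EdgeIntegrals.

(** * Edges of descendants on the coarse skeleton *)

Section Skeleton.
Variable R : realType.
Variables (Omega : set (point2 R)) (A : {fset triangle R}).
Hypothesis regA : regular_triangulation Omega A.
Implicit Types (T K : triangle R) (a b m x y z : point2 R).

Lemma mem_v0 T : T.1.1 \in vertices T. Proof. by rewrite !inE eqxx. Qed.
Lemma mem_v1 T : T.1.2 \in vertices T. Proof. by rewrite !inE eqxx orbT. Qed.
Lemma mem_v2 T : T.2 \in vertices T. Proof. by rewrite !inE eqxx !orbT. Qed.

Lemma vertices_distinct T : 0 < area T -> uniq (vertices T).
Proof.
move=> /vertices_uniq D0; rewrite /vertices /= !inE andbT negb_or.
have N (P : bool) : (P -> det3 T.1.1 T.1.2 T.2 = 0) -> ~~ P.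
  by move=> h; apply/negP => /h /eqP; rewrite (negbTE D0).
by apply/andP; split; [apply/andP; split|]; apply: N => /eqP e; rewrite /det3 ?e; ring.
Qed.

(** The intersection contains two distinct points and is therefore a full edge of [T]. The point y,
    the reflection of x in m, lies on the line of that edge, and points of [T] on this line belong
    to the edge. *)
Lemma extend_in_neighbor T T' x m y : T \in A -> T' \in A -> T != T' ->
  closed_triangle T x -> closed_triangle T' x -> closed_triangle T m -> closed_triangle T' m ->
  closed_triangle T y -> x != m -> y.1 = 2 * m.1 - x.1 -> y.2 = 2 * m.2 - x.2 ->
  closed_triangle T' y.
Proof.
move=> TA TA' TT' Tx Tx' Tm Tm' Ty xm y1 y2.
have T0 := regular_area regA TA.
have [_ _ /(_ _ _ TA TA' TT')[s [s2 sT _ E]]] := regA.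
have hx : hull s x by rewrite -E.
have hm : hull s m by rewrite -E.
suff : hull s y by rewrite -E => -[].
case: s s2 sT E hx hm => [|a [|b [|//]]] _ sT _.
- by move=> [w [_]]; rewrite big_ord0 => /esym/eqP; rewrite oner_eq0.
- move=> [w [_ w1 ex]] [w' [_ w'1 em]]; exfalso; move/eqP: xm; apply.
  by rewrite ex em; move: w1 w'1; rewrite !big_ord_recl !big_ord0 !addr0 => -> ->.
have P z : hull [:: a; b] z -> exists t : R, z.1 = a.1 + t * (b.1 - a.1) /\ z.2 = a.2 + t * (b.2 - a.2).
  move=> [w [_]]; rewrite !big_ord_recl !big_ord0 => w1 ->.
  exists (w (lift ord0 ord0)).
  have -> : w ord0 = 1 - w (lift ord0 ord0) by lra.
  by rewrite /= /GRing.scale /=; split; ring.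
move=> /P[t [x1 x2]] /P[u [m1 m2]].
pose tau := 2 * u - t.
have yE : y = (a.1 + tau * (b.1 - a.1), a.2 + tau * (b.2 - a.2)).
  by apply: point_eq; rewrite /= ?y1 ?y2 ?m1 ?m2 ?x1 ?x2 /tau; ring.
have aT : a \in vertices T by apply: sT; rewrite inE eqxx.
have bT : b \in vertices T by apply: sT; rewrite !inE eqxx orbT.
have ab : a != b.
  apply: contraNN xm => /eqP ab; apply/eqP/point_eq.
    by rewrite x1 m1 ab; ring.
  by rewrite x2 m2 ab; ring.
have val f : affine_fun f -> f y = f a + tau * (f b - f a).
  by move=> [p [q [r fE]]]; rewrite !fE yE /=; ring.
have [f [af f0 fa fw]] := vertex_functional T0 aT.
have [g [ag g0 gb gw]] := vertex_functional T0 bT.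
have h1 := f0 _ Ty; have h2 := g0 _ Ty.
rewrite (val f af) fa (fw b bT) 1?eq_sym// in h1.
rewrite (val g ag) gb (gw a aT ab) in h2.
by rewrite yE; apply: segment_hull2; apply/andP; split; lra.
Qed.

(** Some vertex of [T] is missing in the intersection with T'. Its barycentric coordinate is
    nonnegative on [T] and vanishes at the midpoint, hence at both ends of the refinement edge, and
    also at the newest vertex; it would vanish on all of [K]. *)
Lemma bisector_not_in_neighbor T T' K : T \in A -> T' \in A -> T != T' ->
  0 < area K -> closed_triangle K `<=` closed_triangle T ->
  closed_triangle T' (midpoint K.1.1 K.1.2) -> closed_triangle T' K.2 -> False.
Proof.
move=> TA TA' TT' K0 KT Tm' T2'.
have T0 := regular_area regA TA.
have [_ _ /(_ _ _ TA TA' TT')[s [s2 sT _ E]]] := regA.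
have k0 := KT _ (vertex_in_triangle (mem_v0 K)).
have k1 := KT _ (vertex_in_triangle (mem_v1 K)).
have k2 := KT _ (vertex_in_triangle (mem_v2 K)).
have hm : hull s (midpoint K.1.1 K.1.2) by rewrite -E; split => //; exact: midpoint_in_triangle.
have h2 : hull s K.2 by rewrite -E.
have [v vT vs] : exists2 v, v \in vertices T & v \notin s.
  apply/allPn; apply: contraTN s2 => /allP sub.
  by rewrite -ltnNge (leq_trans _ (uniq_leq_size (vertices_distinct T0) sub)).
have [f [af f0 fv fw]] := vertex_functional T0 vT.
have fs z : hull s z -> f z = 0.
  apply: affine_eq0_hull => // w ws; apply: fw; first exact: sT.
  by apply: contraNneq vs => <-.
have fm := fs _ hm; have f2 := fs _ h2.
have h0 := f0 _ k0; have h1 := f0 _ k1.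
have fmE : f (midpoint K.1.1 K.1.2) = (f K.1.1 + f K.1.2) / 2.
  by case: af => p [q [r fE]]; rewrite !fE /midpoint /= /GRing.scale /=; field.
rewrite fmE in fm.
have e0 : f K.1.1 = 0 by lra.
have e1 : f K.1.2 = 0 by lra.
have := affine_eq0_conv3 v af e0 e1 f2 (vertices_uniq K0).
by rewrite fv => /eqP; rewrite oner_eq0.
Qed.

Lemma regular_sub_eq T T' K : T \in A -> T' \in A -> 0 < area K ->
  closed_triangle K `<=` closed_triangle T -> closed_triangle K `<=` closed_triangle T' ->
  T = T'.
Proof.
move=> TA TA' K0 KT KT'; apply: contrapT => /eqP TT'.
have v0 := vertex_in_triangle (mem_v0 K); have v1 := vertex_in_triangle (mem_v1 K).
have v2 := vertex_in_triangle (mem_v2 K).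
move/eqP: (vertices_uniq K0); apply.
apply: (regular_collinear regA TA TA' TT'); [exact: KT|exact: KT'|exact: KT|exact: KT'|exact: KT|exact: KT'].
Qed.

Lemma vertex_in_neighbor T T' v : T \in A -> T' \in A -> T != T' ->
  v \in vertices T -> closed_triangle T' v -> v \in vertices T'.
Proof.
move=> TA TA' TT' vT Tv'; have T0 := regular_area regA TA.
have [_ _ /(_ _ _ TA TA' TT')[s [s2 sT sT' E]]] := regA.
apply: sT'; apply: (hull_vertex_mem T0) => //.
by rewrite -E; split => //; exact: vertex_in_triangle.
Qed.

(* The part of the boundary of a descendant [K] of [T] that lies on the
   skeleton of [A]; it does not grow under bisection. *)
Definition theta T (G : triangle R -> point2 R -> fun2 R) K : R :=
  if `[< closed_triangle K `<=` closed_triangle T >] then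
    \sum_(T' <- A | T' != T) \sum_(E <- edges K)
      (if `[< closed_triangle T' E.1 /\ closed_triangle T' E.2 >]
       then edge_integral E (G T' (normal E)) else 0)
  else 0.

Section Theta.
Variables (T : triangle R) (G : triangle R -> point2 R -> fun2 R).
Hypothesis TA : T \in A.
Hypothesis G0 : forall T' nu x, 0 <= G T' nu x.
Hypothesis Gc : forall T' nu, continuous (G T' nu).

Lemma theta_ge0 K : 0 <= theta T G K.
Proof.
rewrite /theta; case: ifPn => // _; apply: sumr_ge0 => T' _; apply: sumr_ge0 => E _.
by case: ifPn => // _; apply: edge_integral_ge0 => x; exact: G0.
Qed.

(** The bisector contributes nothing, the two other edges pass to the children with their
    orientation, and the halves of the refinement edge keep its normal and add up to it. *)
Lemma theta_children K : 0 < area K ->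
  (exists2 T0, T0 \in A & closed_triangle K `<=` closed_triangle T0) ->
  theta T G (child1 K) + theta T G (child2 K) <= theta T G K.
Proof.
move=> K0 [T0 T0A KT0].
have s1 := @child1_sub _ K; have s2 := @child2_sub _ K.
have a1 : 0 < area (child1 K) by rewrite area_child1 divr_gt0.
have a2 : 0 < area (child2 K) by rewrite area_child2 divr_gt0.
(* A nondegenerate triangle is contained in at most one element of [A], so children of a triangle
   outside [T] are outside [T] as well. *)
have [KT|KT] := pselect (closed_triangle K `<=` closed_triangle T); last first.
  have n1 : ~ closed_triangle (child1 K) `<=` closed_triangle T.
    by move=> h; apply: KT; rewrite (regular_sub_eq TA T0A a1 h (subset_trans s1 KT0)).
  have n2 : ~ closed_triangle (child2 K) `<=` closed_triangle T.
    by move=> h; apply: KT; rewrite (regular_sub_eq TA T0A a2 h (subset_trans s2 KT0)).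
  by rewrite /theta !asboolF// addr0.
rewrite /theta !asboolT//; [|exact: subset_trans KT|exact: subset_trans KT].
rewrite [X in _ <= X]big_seq_cond [X in X + _]big_seq_cond [X in _ + X]big_seq_cond -big_split /=.
apply: ler_sum => T' /andP[TA' TT']; rewrite eq_sym in TT'.
set z0 := K.1.1; set z1 := K.1.2; set z2 := K.2; set m := midpoint z0 z1.
rewrite /edges /child1 /child2 /= !big_cons !big_nil /= -/z0 -/z1 -/z2 -/m !addr0.
have k0 := KT _ (vertex_in_triangle (mem_v0 K)).
have k1 := KT _ (vertex_in_triangle (mem_v1 K)).
have k2 := KT _ (vertex_in_triangle (mem_v2 K)).
have km : closed_triangle T m by exact: midpoint_in_triangle.
have z01 : z0 != z1 by have := vertices_distinct K0; rewrite /vertices /= !inE negb_or => /andP[/andP[]].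
have z0m : z0 != m.
  apply: contraNN z01 => /eqP e; apply/eqP; move: e; rewrite /m /midpoint => e.
  have := congr1 fst e; have := congr1 snd e; rewrite /= /GRing.scale /= => e2 e1.
  by apply: point_eq; lra.
have z1m : z1 != m.
  apply: contraNN z01 => /eqP e; apply/eqP; move: e; rewrite /m /midpoint => e.
  have := congr1 fst e; have := congr1 snd e; rewrite /= /GRing.scale /= => e2 e1.
  by apply: point_eq; lra.
have nom : ~ (closed_triangle T' m /\ closed_triangle T' z2).
  by move=> [h h']; exact: (bisector_not_in_neighbor TA TA' TT' K0 KT).
have nom' : ~ (closed_triangle T' z2 /\ closed_triangle T' m) by move=> [? ?]; apply: nom.
rewrite (asboolF nom) (asboolF nom') addr0 add0r.
(* One half of the refinement edge is in T' exactly if the whole edge is; the backward direction is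
   convexity. *)
have I0 : (closed_triangle T' z0 /\ closed_triangle T' m) <-> (closed_triangle T' z0 /\ closed_triangle T' z1).
  split=> -[h h']; split=> //.
    apply: (extend_in_neighbor TA TA' TT' k0 h km h') => //;
      by rewrite /m /midpoint /= /GRing.scale /=; field.
  exact: midpoint_in_triangle.
have I1 : (closed_triangle T' m /\ closed_triangle T' z1) <-> (closed_triangle T' z0 /\ closed_triangle T' z1).
  split=> -[h h']; split=> //.
    apply: (extend_in_neighbor TA TA' TT' k1 h' km h) => //;
      by rewrite /m /midpoint /= /GRing.scale /=; field.
  exact: midpoint_in_triangle.
rewrite (asbool_equiv_eq I0) (asbool_equiv_eq I1).
rewrite normal_midl normal_midr.
have <- := edge_integral_split z0 z1 (@Gc T' (normal (z0, z1))).
rewrite -/m; case: `[< closed_triangle T' z0 /\ closed_triangle T' z1 >]; case: `[< _ >]; case: `[< _ >]; lra.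
Qed.

(** A vertex of [T] in another triangle T' is a vertex of T' by regularity, so the geometric
    condition in [theta] becomes the combinatorial one of [jump_norm2]. *)
Lemma theta_self : theta T G T = \sum_(E <- edges T)
  \sum_(T' <- A | [&& T' != T, E.1 \in vertices T' & E.2 \in vertices T'])
     edge_integral E (G T' (normal E)).
Proof.
rewrite /theta asboolT// exchange_big /=; apply: eq_big_seq => E ET.
rewrite [RHS]big_mkcond [LHS]big_mkcond /= big_seq [RHS]big_seq.
apply: eq_bigr => T' TA'; have [TT'|nTT'] := boolP (T' != T); last by [].
have [e1 e2] : E.1 \in vertices T /\ E.2 \in vertices T.
  by move: ET; rewrite !inE => /orP[/eqP->|/orP[/eqP->|/eqP->]] /=; rewrite !eqxx ?orbT.
rewrite eq_sym in TT'.
have -> : `[< closed_triangle T' E.1 /\ closed_triangle T' E.2 >] =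
    (E.1 \in vertices T') && (E.2 \in vertices T').
  apply/asboolP/andP => -[h1 h2]; split; try exact: vertex_in_triangle.
    exact: (vertex_in_neighbor TA).
  exact: (vertex_in_neighbor TA).
by [].
Qed.

Lemma theta_sum : \sum_(K <- A) theta T G K = theta T G T.
Proof.
rewrite (big_fsetD1 T TA) /= big1_seq ?addr0// => K; rewrite !inE => /andP[_ /andP[KT KA]].
rewrite /theta asboolF// => sub.
by move/eqP: KT; apply; apply: (regular_sub_eq KA TA (regular_area regA KA)).
Qed.

(** On [A] the sum consists of the value at [T] alone, and no bisection increases it. *)
Lemma theta_nvb B : nvb_refinement A B -> \sum_(K <- B) theta T G K <= theta T G T.
Proof.
move=> AB; rewrite -theta_sum.
apply: (nvb_sum (P := fun K => 0 < area K /\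
   exists2 T0, T0 \in A & closed_triangle K `<=` closed_triangle T0) AB).
- move=> K [K0 [T0 TA0 KT0]]; rewrite area_child1 area_child2 divr_gt0//.
  split; split => //; exists T0 => //.
    exact: subset_trans (@child1_sub _ K) KT0.
  exact: subset_trans (@child2_sub _ K) KT0.
- by move=> K KA; split; [exact: (regular_area regA)|exists K].
- exact: theta_ge0.
- by move=> K [K0 h]; exact: theta_children.
Qed.

End Theta.
End Skeleton.

(** * Piecewise polynomials *)

Section Pieces.
Variable R : realType.
Implicit Types (K T : triangle R) (A B : {fset triangle R}) (f g q v w : fun2 R) (p n : nat).

Lemma polynomial2_comb p (a b : R) f g : polynomial2 p f -> polynomial2 p g ->
  polynomial2 p (fun x => a * f x + b * g x).
Proof.
move=> [c fc] [d gd]; exists (fun i k => a * c i k + b * d i k) => x.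
rewrite fc gd !mulr_sumr -big_split /=; apply: eq_bigr => i _.
by rewrite !mulr_sumr -big_split /=; apply: eq_bigr => k _; ring.
Qed.

Lemma bipoly_widen n m z s c : (n <= m)%N ->
  bipoly n z s c = bipoly m z s (fun a b => if (a < n)%N && (b < n)%N then c a b else 0) :> fun2 R.
Proof.
move=> nm; apply/funext => x; rewrite /bipoly.
rewrite (big_ord_widen _ (fun a => \sum_(b < n) c a b * tens (mono z.1 s a) (mono z.2 s b) x) nm).
rewrite [LHS]big_mkcond; apply: eq_bigr => a _; case: ifPn => an /=; last first.
  by rewrite big1 // => b _; rewrite mul0r.
rewrite (big_ord_widen _ (fun b => c a b * tens (mono z.1 s a) (mono z.2 s b) x) nm).
rewrite [LHS]big_mkcond; apply: eq_bigr => b _; case: ifPn => // bn.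
by rewrite mul0r.
Qed.

Lemma polynomial2_smooth p q : polynomial2 p q -> smooth2 q.
Proof.
move=> /(@polynomial2_bipoly _ _ _ (0, 0) 1 (oner_neq0 R))[c ->].
exact: smooth2_bipoly.
Qed.

Lemma area_shape K : 0 < area K ->
  exists2 kap : R, 0 < kap & shape_sum K <= kap * area K.
Proof.
move=> K0; exists (1 + `|shape_sum K| / area K).
  by rewrite ltr_wpDr// divr_ge0// ltW.
rewrite mulrDl divfK ?gt_eqF// mul1r; apply: le_trans (ler_norm _) _.
by rewrite lerDr ltW.
Qed.

(** A triangle contains a box about its centroid, and a polynomial that vanishes on a box is
    zero. *)
Lemma polynomial2_eq_triangle p p' K q q' : 0 < area K ->
  polynomial2 p q -> polynomial2 p' q' ->
  (forall x, closed_triangle K x -> q x = q' x) -> q = q'.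
Proof.
move=> K0 Pq Pq' qq'; have [kap kap0 shK] := area_shape K0.
have h0 := diam_gt0 K0; have D0 := dil_gt0 kap0.
set z := centroid K; set s := 2 * (diam K / (6 * dil kap)).
have s0 : 0 < s by rewrite /s mulr_gt0// divr_gt0// mulr_gt0.
have sK : sqbox z s `<=` closed_triangle K by exact: centroid_box.
have [c qc] := polynomial2_bipoly z (lt0r_neq0 s0) Pq.
have [d qd] := polynomial2_bipoly z (lt0r_neq0 s0) Pq'.
set n := maxn p.+1 p'.+1.
rewrite (@bipoly_widen p.+1 n) ?leq_maxl// in qc.
rewrite (@bipoly_widen p'.+1 n) ?leq_maxr// in qd.
move: qc qd; set c1 := (fun a b => _); set d1 := (fun a b => _) => qc qd.
have E : (fun x => q x - q' x) = bipoly n z s (fun a b => c1 a b - d1 a b).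
  apply/funext => x; rewrite qc qd /bipoly -sumrB; apply: eq_bigr => a _.
  by rewrite -sumrB; apply: eq_bigr => b _; rewrite mulrBl.
have Z : bipoly n z s (fun a b => c1 a b - d1 a b) = cst 0.
  apply: bipoly_eq0_sqbox => // x xs; rewrite -E qq' ?subrr//; exact: sK.
apply/funext => x; have := congr1 (fun f => f x) E; rewrite Z /= => /eqP.
by rewrite subr_eq0 => /eqP.
Qed.

(** [piece] picks a polynomial of unspecified degree; uniqueness on a nondegenerate triangle
    identifies it. *)
Lemma pieceE p K v q : 0 < area K -> polynomial2 p q ->
  (forall x, closed_triangle K x -> v x = q x) -> piece v K = q.
Proof.
move=> K0 Pq vq.
have [[p' Pp] vp] : [set q : fun2 R | (exists p, polynomial2 p q) /\
    forall x, closed_triangle K x -> v x = q x] (piece v K).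
  by apply: getPex; exists q; split => //; exists p.
by apply: (polynomial2_eq_triangle K0 Pp Pq) => x Kx; rewrite -vp// vq.
Qed.

Definition piecewise_polynomial p A v : Prop := forall K, K \in A ->
  exists2 q, polynomial2 p q & forall x, closed_triangle K x -> v x = q x.

Lemma piece_polynomial p A v K : piecewise_polynomial p A v -> 0 < area K -> K \in A ->
  polynomial2 p (piece v K) /\ forall x, closed_triangle K x -> v x = piece v K x.
Proof. by move=> Pv K0 /Pv[q Pq vq]; rewrite (pieceE K0 Pq vq). Qed.

Lemma piecewise_polynomial_comb p A (a b : R) v w : piecewise_polynomial p A v ->
  piecewise_polynomial p A w -> piecewise_polynomial p A (fun x => a * v x + b * w x).
Proof.
move=> Pv Pw K KA; have [q Pq vq] := Pv K KA; have [r Pr wr] := Pw K KA.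
exists (fun x => a * q x + b * r x); first exact: polynomial2_comb.
by move=> x Kx; rewrite vq// wr.
Qed.

Lemma piece_comb p A (a b : R) v w K : piecewise_polynomial p A v ->
  piecewise_polynomial p A w -> 0 < area K -> K \in A ->
  piece (fun x => a * v x + b * w x) K = (fun x => a * piece v K x + b * piece w K x).
Proof.
move=> Pv Pw K0 KA; have [Pq vq] := piece_polynomial Pv K0 KA.
have [Pr wr] := piece_polynomial Pw K0 KA.
apply: (pieceE K0 (polynomial2_comb a b Pq Pr)) => x Kx; rewrite -vq// -wr//.
Qed.

Lemma piece_sub p A v K T : piecewise_polynomial p A v -> T \in A -> 0 < area T ->
  0 < area K -> closed_triangle K `<=` closed_triangle T -> piece v K = piece v T.
Proof.
move=> Pv TA T0 K0 KT; have [Pq vq] := piece_polynomial Pv T0 TA.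
by apply: (pieceE K0 Pq) => x /KT; exact: vq.
Qed.

Lemma piecewise_polynomial_nvb p A B v : nvb_refinement A B ->
  piecewise_polynomial p A v -> piecewise_polynomial p B v.
Proof.
move=> AB Pv K KB; have [T [TA KT _]] := nvb_ancestor AB KB.
by have [q Pq vq] := Pv T TA; exists q => // x /KT; exact: vq.
Qed.

(** A triangle of the last level is contained in one of every earlier level, so each summand is
    polynomial on it. *)
Lemma hierarchical_argyrisP Omega p Tinit A v : open Omega ->
  hierarchical_argyris Omega p Tinit A v -> H20 Omega v /\ piecewise_polynomial p A v.
Proof.
move=> oO [m [S [lev [w [wS vE]]]]].
suff H n : (n <= m.+1)%N -> H20 Omega (fun x => \sum_(k < n) w k x) /\
    piecewise_polynomial p A (fun x => \sum_(k < n) w k x).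
  by have := H m.+1 (leqnn _); rewrite (_ : (fun x => _) = v)//; apply/funext => x; rewrite vE.
have Hw k : (k <= m)%N -> H20 Omega (w k) /\ piecewise_polynomial p A (w k).
  move=> km; have [H Pk _] := wS k km; split => // K KA.
  have [T TS KT] := level_sequence_sub lev KA km.
  by have [q Pq wq] := Pk T TS; exists q => // x /KT; exact: wq.
have [H0 P0] := Hw 0%N (leq0n m).
elim: n => [_|n IHn nm].
  (* The empty sum is written as a trivial combination, so that the closure lemmas also cover the
     zero function. *)
  rewrite (_ : (fun x => _) = (fun x => 0 * w 0%N x + 0 * w 0%N x)); last first.
    by apply/funext => x; rewrite big_ord0 !mul0r addr0.
  by split; [exact: H20_comb|exact: piecewise_polynomial_comb].
have [H1 P1] := IHn (ltnW nm); have [H2 P2] := Hw n nm.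
rewrite (_ : (fun x => _) = (fun x => 1 * (\sum_(k < n) w k x) + 1 * w n x)); last first.
  by apply/funext => x; rewrite big_ord_recr /= !mul1r.
by split; [exact: H20_comb|exact: piecewise_polynomial_comb].
Qed.

End Pieces.

(** * Pointwise bounds by local energies *)

Section LocalBounds.
Variable R : realType.
Implicit Types (K T : triangle R) (f g q v w : fun2 R) (p n : nat) (i k : 'I_2).

Lemma open_obox (a b c d : R) : open (obox a b c d).
Proof.
rewrite oboxE; have -> : `]a, b[%classic `*` `]c, d[%classic =
    (fst @^-1` `]a, b[%classic) `&` (snd @^-1` `]c, d[%classic) :> set (point2 R) by [].
apply: openI.
  by apply: open_comp; [move=> x _; exact: continuous_fst2|exact: interval_open].
by apply: open_comp; [move=> x _; exact: continuous_snd2|exact: interval_open].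
Qed.

(** Half the size of the box known to fit into [K], so that an open box lies in between; this open
    box is what can be moved from the closure of [Omega] into [Omega]. *)
Definition core (kap : R) K : set (point2 R) := sqbox (centroid K) (diam K / (6 * dil kap)).

Definition core_energy (Omega : set (point2 R)) kap w K : R :=
  int2 (core kap K) (fun x => \sum_(i < 2) \sum_(k < 2) wD Omega [:: i; k] w x ^+ 2).

Lemma core_energy_ge0 Omega kap w K : 0 <= core_energy Omega kap w K.
Proof.
by apply: int2_ge0 => x _; apply: sumr_ge0 => i _; apply: sumr_ge0 => k _; exact: sqr_ge0.
Qed.

Lemma core_sub (kap : R) K : 0 < kap -> 0 < area K -> shape_sum K <= kap * area K ->
  core kap K `<=` obox ((centroid K).1 - 2 * (diam K / (6 * dil kap)))
      ((centroid K).1 + 2 * (diam K / (6 * dil kap)))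
      ((centroid K).2 - 2 * (diam K / (6 * dil kap)))
      ((centroid K).2 + 2 * (diam K / (6 * dil kap))) /\
  obox ((centroid K).1 - 2 * (diam K / (6 * dil kap)))
      ((centroid K).1 + 2 * (diam K / (6 * dil kap)))
      ((centroid K).2 - 2 * (diam K / (6 * dil kap)))
      ((centroid K).2 + 2 * (diam K / (6 * dil kap))) `<=` closed_triangle K.
Proof.
move=> kap0 K0 shK; have h0 := diam_gt0 K0; have D0 := dil_gt0 kap0.
have s0 : 0 < diam K / (6 * dil kap) by rewrite divr_gt0// mulr_gt0.
split.
  rewrite /core; set s := diam K / _ in s0 *; move=> x [/andP[? ?] /andP[? ?]].
  by split; apply/andP; split; lra.
apply: subset_trans (centroid_box kap0 K0 shK) => x [/andP[? ?] /andP[? ?]].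
by split; apply/andP; split; apply: ltW.
Qed.

Lemma core_sub_domain Omega (kap : R) K : open Omega -> lipschitz_boundary Omega ->
  0 < kap -> 0 < area K -> shape_sum K <= kap * area K ->
  closed_triangle K `<=` closure Omega -> core kap K `<=` Omega.
Proof.
move=> oO lip kap0 K0 shK KO; have [h1 h2] := core_sub kap0 K0 shK.
apply: subset_trans h1 _; apply: open_sub_closure => //; first exact: open_obox.
exact: subset_trans KO.
Qed.

Lemma core_sub_triangle (kap : R) K : 0 < kap -> 0 < area K -> shape_sum K <= kap * area K ->
  core kap K `<=` closed_triangle K.
Proof. by move=> kap0 K0 shK; have [h1 h2] := core_sub kap0 K0 shK; exact: subset_trans h2. Qed.

Lemma bipoly_bound_partial n z s m f (l : seq 'I_2) : 0 < s -> bipoly_bound n z s m f ->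
  bipoly_bound n z s ((n%:R / s) ^+ size l * m) (partial l f).
Proof.
move=> s0 fm; elim: l => [|i l IHl] /=; first by rewrite expr0 mul1r.
by rewrite exprS -mulrA; exact: bipoly_bound_derive.
Qed.

Lemma bipoly_bound_le n z s m m' f : m <= m' -> bipoly_bound n z s m f ->
  bipoly_bound n z s m' f.
Proof. by move=> mm [c cm ->]; exists c => // a b; exact: le_trans mm. Qed.

Section Estimate.
Variables (p : nat) (kap : R).
Hypothesis kap0 : 0 < kap.

(** In two dimensions the L^2 norm of the second derivatives over a box of size h controls h times
    their maximum, and every further derivative costs 1/h; hence the exponent [(size l).+1]. *)
Lemma partial_core_bound : exists2 C : R, 0 < C &
  forall (Omega : set (point2 R)) w K q, open Omega -> lipschitz_boundary Omega ->
    H2 Omega w -> 0 < area K -> shape_sum K <= kap * area K ->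
    closed_triangle K `<=` closure Omega -> polynomial2 p q ->
    (forall x, closed_triangle K x -> w x = q x) ->
    forall (l : seq 'I_2) i k x, (size l <= 2)%N -> closed_triangle K x ->
      (`|partial (l ++ [:: i; k]) q x| * diam K ^+ (size l).+1) ^+ 2
        <= C * core_energy Omega kap w K.
Proof.
have [C0 C00 inv] := @inverse_estimate R p.+1.
have D0 := dil_gt0 kap0; set D := dil kap in D0.
(* For s = h / (6 D) the triangle is within D h = 6 D^2 s <= [rho] s of its centroid. The number [e]
   dominates 1, 6 D and 6 D n, the factors that arise when s is replaced by h; [N] is the cost of
   evaluation. *)
pose n : nat := p.+1; pose rho : R := 1 + 6 * D ^+ 2; pose e : R := 1 + 6 * D + 6 * D * n%:R.
have rho1 : 1 <= rho by rewrite /rho lerDl mulr_ge0// sqr_ge0.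
have n0 : (0 : R) <= n%:R by rewrite ler0n.
have e1 : 1 <= e by have := mulr_ge0 (ltW D0) n0; rewrite /e; lra.
pose N : R := n%:R ^+ 2 * rho ^+ (n + n).
have N0 : 0 < N by rewrite mulr_gt0 ?exprn_gt0// ?ltr0n//; apply: lt_le_trans rho1.
exists ((N * e ^+ 3) ^+ 2 * C0).
  by rewrite mulr_gt0// exprn_gt0// mulr_gt0// exprn_gt0//; apply: lt_le_trans e1.
move=> Omega w K q oO lip Hw K0 shK KO Pq wq l i k x sl Kx.
have h0 := diam_gt0 K0; set h := diam K in h0 *.
set H := core_energy _ _ _ _; have H0 : 0 <= H by exact: core_energy_ge0.
set s := h / (6 * D); have s0 : 0 < s by rewrite divr_gt0// mulr_gt0.
set z := centroid K.
have QO : sqbox z s `<=` Omega by exact: core_sub_domain.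
have QK : sqbox z s `<=` closed_triangle K by exact: core_sub_triangle.
have [c qc] := polynomial2_bipoly z (lt0r_neq0 s0) Pq.
have mO := open_measurable2 oO; have mQ := @measurable2_sqbox R z s.
have inte : integrable2 (sqbox z s) (fun x => \sum_(i < 2) \sum_(k < 2) wD Omega [:: i; k] w x ^+ 2).
  by apply: (integrable2S mO) => //; exact: energy_integrable.
have Hik : int2 (sqbox z s) (fun x => wD Omega [:: k; i] w x ^+ 2) <= H.
  apply: int2_le => //.
    apply: (integrable2S mO) => //; apply: L2_integrable_sqr => //; exact: wD_L2.
  move=> y _; apply: le_trans (le_sum_term (F := fun i => \sum_(k < 2) wD Omega [:: i; k] w y ^+ 2) k _).
    by apply: (le_sum_term (F := fun i => wD Omega [:: k; i] w y ^+ 2)) => j; exact: sqr_ge0.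
  by move=> j; apply: sumr_ge0 => j' _; exact: sqr_ge0.
have bb : bipoly_bound n z s (Num.sqrt (C0 * H) / s) (partial [:: i; k] q).
  rewrite qc; apply: bipoly_bound_le (inv Omega w z s c oO Hw s0 QO _ k i).
    rewrite ler_pM2r ?invr_gt0// ler_wsqrtr// ler_wpM2l// ltW//.
  by move=> y Qy; rewrite wq ?qc//; exact: QK.
have {bb}bl := bipoly_bound_partial l s0 bb.
have [x1 x2] : `|x.1 - z.1| <= D * h /\ `|x.2 - z.2| <= D * h by exact: triangle_centroid_dist.
have rs : D * h <= rho * s.
  have -> : D * h = 6 * D ^+ 2 * s by rewrite /s; field; rewrite gt_eqF.
  by rewrite ler_pM2r// /rho lerDr.
have := bipoly_bound_sup s0 rho1 bl (le_trans x1 rs) (le_trans x2 rs).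
rewrite -/N; have -> : partial l (partial [:: i; k] q) = partial (l ++ [:: i; k]) q.
  by rewrite /partial foldr_cat.
move=> {bl}bf.
have {bf} bf : `|partial (l ++ [:: i; k]) q x| * h ^+ (size l).+1 <= N * e ^+ 3 * Num.sqrt (C0 * H).
  apply: (@le_trans _ _ (N * ((n%:R / s) ^+ size l * (Num.sqrt (C0 * H) / s)) * h ^+ (size l).+1)).
    by rewrite ler_wpM2r// exprn_ge0// ltW.
  rewrite -[leLHS]mulrA -[leRHS]mulrA ler_pM2l//.
  have -> : (n%:R / s) ^+ size l * (Num.sqrt (C0 * H) / s) * h ^+ (size l).+1 =
      ((6 * D * n%:R) ^+ size l * (6 * D)) * Num.sqrt (C0 * H).
    have -> : n%:R / s = 6 * D * n%:R / h by rewrite /s; field; rewrite !gt_eqF.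
    rewrite expr_div_n /s exprS; field; rewrite expf_neq0 ?gt_eqF//.
  rewrite ler_wpM2r ?sqrtr_ge0//; apply: (@le_trans _ _ (e ^+ (size l).+1)).
    rewrite exprSr; apply: ler_pM.
    - by rewrite exprn_ge0// !mulr_ge0// ltW.
    - by rewrite mulr_ge0// ltW.
    - apply: lerXn2r; rewrite ?nnegrE.
      + by rewrite !mulr_ge0// ltW.
      + by apply: le_trans e1.
      + by rewrite /e; lra.
    - by have := mulr_ge0 (ltW D0) n0; rewrite /e; lra.
  by rewrite ler_weXn2l.
have -> : (N * e ^+ 3) ^+ 2 * C0 * H = (N * e ^+ 3 * Num.sqrt (C0 * H)) ^+ 2.
  by rewrite [RHS]exprMn sqr_sqrtr ?mulrA// mulr_ge0// ltW.
apply: lerXn2r => //; rewrite nnegrE.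
  by rewrite mulr_ge0// exprn_ge0// ltW.
by rewrite mulr_ge0 ?sqrtr_ge0// mulr_ge0 ?(ltW N0)// exprn_ge0//; apply: le_trans e1.
Qed.

End Estimate.
End LocalBounds.

(** * Jumps and the stability of the estimator *)

Section JumpOperators.
Variable R : realType.
Implicit Types (K T : triangle R) (f g q v w : fun2 R) (p n : nat) (i k : 'I_2) (nu x : point2 R).

Lemma sum2 (F : 'I_2 -> R) : \sum_(i < 2) F i = F 0 + F 1.
Proof.
by rewrite !big_ord_recl big_ord0 addr0; congr (_ + F _); apply/val_inj.
Qed.

Lemma sum22 (F : 'I_2 -> 'I_2 -> R) :
  \sum_(i < 2) \sum_(k < 2) F i k = F 0 0 + F 0 1 + (F 1 0 + F 1 1).
Proof. by rewrite !sum2. Qed.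

Lemma add_combE f g : (fun x => f x + g x) = (fun x => 1 * f x + 1 * g x).
Proof. by apply/funext => x; rewrite !mul1r. Qed.

Lemma smooth2_add f g : smooth2 f -> smooth2 g -> smooth2 (fun x => f x + g x).
Proof. by move=> sf sg; rewrite add_combE; exact: smooth2_comb. Qed.

Lemma partial_smooth_add f g l : smooth2 f -> smooth2 g ->
  partial l (fun x => f x + g x) = (fun x => partial l f x + partial l g x).
Proof. by move=> sf sg; rewrite add_combE partial_smooth_comb// -add_combE. Qed.

Lemma laplacianE q : laplacian q = (fun x => partial [:: 0; 0] q x + partial [:: 1; 1] q x).
Proof. by apply/funext => x; exact: sum2. Qed.

Lemma laplacian_smooth q : smooth2 q -> smooth2 (laplacian q).
Proof.
by move=> sq; rewrite laplacianE; apply: smooth2_add; exact: (@smooth2_partials _ [:: _; _]).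
Qed.

Lemma sum_comb (a b y0 y1 z0 z1 : R) :
  (a * y0 + b * z0) + (a * y1 + b * z1) = a * (y0 + y1) + b * (z0 + z1).
Proof. ring. Qed.

Lemma sum2_comb (a b c0 c1 y0 y1 z0 z1 : R) :
  c0 * (a * y0 + b * z0) + c1 * (a * y1 + b * z1) =
  a * (c0 * y0 + c1 * y1) + b * (c0 * z0 + c1 * z1).
Proof. ring. Qed.

Lemma sum4_comb (a b c0 c1 c2 c3 y0 y1 y2 y3 z0 z1 z2 z3 : R) :
  c0 * (a * y0 + b * z0) + c1 * (a * y1 + b * z1) +
    (c2 * (a * y2 + b * z2) + c3 * (a * y3 + b * z3)) =
  a * (c0 * y0 + c1 * y1 + (c2 * y2 + c3 * y3)) + b * (c0 * z0 + c1 * z1 + (c2 * z2 + c3 * z3)).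
Proof. ring. Qed.

Lemma laplacian_comb (a b : R) f g : smooth2 f -> smooth2 g ->
  laplacian (fun x => a * f x + b * g x) = (fun x => a * laplacian f x + b * laplacian g x).
Proof.
move=> sf sg; rewrite !laplacianE; apply/funext => x.
by rewrite !partial_smooth_comb//; exact: sum_comb.
Qed.

Lemma partial_laplacian (l : seq 'I_2) q : smooth2 q ->
  partial l (laplacian q) =
    (fun x => partial (l ++ [:: 0; 0]) q x + partial (l ++ [:: 1; 1]) q x).
Proof.
move=> sq; have s0 := @smooth2_partials R [:: 0; 0] q sq; have s1 := @smooth2_partials R [:: 1; 1] q sq.
by rewrite laplacianE partial_smooth_add// /partial !foldr_cat.
Qed.

Lemma normal_deriv2E nu q : normal_deriv2 nu q = (fun x =>
  (Defs.coord nu 0 * Defs.coord nu 0 * partial [:: 0; 0] q x +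
   Defs.coord nu 0 * Defs.coord nu 1 * partial [:: 0; 1] q x) +
  (Defs.coord nu 1 * Defs.coord nu 0 * partial [:: 1; 0] q x +
   Defs.coord nu 1 * Defs.coord nu 1 * partial [:: 1; 1] q x)).
Proof.
apply/funext => x.
exact: (sum22 (fun i k => Defs.coord nu i * Defs.coord nu k * partial [:: i; k] q x)).
Qed.

Lemma normal_derivE nu q : normal_deriv nu q = (fun x =>
  Defs.coord nu 0 * partial [:: 0] q x + Defs.coord nu 1 * partial [:: 1] q x).
Proof. by apply/funext => x; exact: sum2. Qed.

Definition normal_deriv3 nu q : fun2 R := normal_deriv nu (laplacian q).

Definition linear_operator (d : point2 R -> fun2 R -> fun2 R) : Prop :=
  (forall nu q, smooth2 q -> continuous (d nu q)) /\
  forall nu (a b : R) f g, smooth2 f -> smooth2 g ->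
    d nu (fun x => a * f x + b * g x) = (fun x => a * d nu f x + b * d nu g x).

Lemma normal_deriv_smooth nu q : smooth2 q -> smooth2 (normal_deriv nu q).
Proof.
by move=> sq; rewrite normal_derivE; apply: smooth2_comb; exact: (@smooth2_partials _ [:: _]).
Qed.

Lemma normal_deriv2_linear : linear_operator (@normal_deriv2 R).
Proof.
split=> [nu q sq|nu a b f g sf sg].
  have sp i k := @smooth2_partials R [:: i; k] q sq.
  rewrite normal_deriv2E; exact: (smooth2_continuous (smooth2_add
    (smooth2_comb _ _ (sp 0 0) (sp 0 1)) (smooth2_comb _ _ (sp 1 0) (sp 1 1)))).
by rewrite !normal_deriv2E !partial_smooth_comb//; apply/funext => x; exact: sum4_comb.
Qed.

Lemma normal_deriv3_linear : linear_operator normal_deriv3.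
Proof.
split=> [nu q sq|nu a b f g sf sg].
  by apply: smooth2_continuous; apply: normal_deriv_smooth; exact: laplacian_smooth.
rewrite /normal_deriv3 laplacian_comb//; have sf' := laplacian_smooth sf; have sg' := laplacian_smooth sg.
move: (laplacian f) (laplacian g) sf' sg' => F G sF sG.
rewrite !normal_derivE !partial_smooth_comb//.
by apply/funext => x; exact: sum2_comb.
Qed.

Lemma normal_coord_le E i : `|Defs.coord (normal E) i| <= 1 :> R.
Proof.
have [e1 e2] := eucl_ge E.1 E.2.
have e0 : 0 <= Defs.edist E.1 E.2 by exact: sqrtr_ge0.
rewrite /Defs.coord /normal; case: ifP => _ /=; rewrite normrM normfV (ger0_norm e0).
  have [->|n0] := eqVneq (Defs.edist E.1 E.2) 0; first by rewrite invr0 mulr0 ler01.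
  by rewrite ler_pdivrMr ?lt_def ?n0// mul1r distrC.
have [->|n0] := eqVneq (Defs.edist E.1 E.2) 0; first by rewrite invr0 mulr0 ler01.
by rewrite ler_pdivrMr ?lt_def ?n0// mul1r.
Qed.

(** Here [r] is the order of [d] minus one, the power of h by which [d] scales against the local
    energy. Each of the three operators is a sum of four partial derivatives with coefficients of
    modulus at most 1, whence 16 = 4^2. *)
Definition operator_bound (d : point2 R -> fun2 R -> fun2 R) (r : nat) : Prop :=
  forall q x (h H : R), smooth2 q -> 0 <= h ->
    (forall (l : seq 'I_2) i k, (size l <= 2)%N ->
       (`|partial (l ++ [:: i; k]) q x| * h ^+ (size l).+1) ^+ 2 <= H) ->
    forall nu, (forall i, `|Defs.coord nu i| <= 1) -> d nu q x ^+ 2 * h ^+ (r + r) <= 16 * H.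

Lemma sqr_sum4_le (a b c d c0 c1 c2 c3 t H : R) (r : nat) : 0 <= t ->
  `|c0| <= 1 -> `|c1| <= 1 -> `|c2| <= 1 -> `|c3| <= 1 ->
  (`|a| * t ^+ r) ^+ 2 <= H -> (`|b| * t ^+ r) ^+ 2 <= H ->
  (`|c| * t ^+ r) ^+ 2 <= H -> (`|d| * t ^+ r) ^+ 2 <= H ->
  (c0 * a + c1 * b + (c2 * c + c3 * d)) ^+ 2 * t ^+ (r + r) <= 16 * H.
Proof.
move=> t0 c01 c11 c21 c31 ha hb hc hd.
have H0 : 0 <= H by apply: le_trans ha; exact: sqr_ge0.
have tr0 : 0 <= t ^+ r by exact: exprn_ge0.
have key (y e : R) : `|e| <= 1 -> (`|y| * t ^+ r) ^+ 2 <= H -> `|e * y * t ^+ r| <= Num.sqrt H.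
  move=> e1 hy; rewrite !normrM (ger0_norm tr0) -mulrA; apply: (@le_trans _ _ (`|y| * t ^+ r)).
    by rewrite ler_piMl// mulr_ge0.
  by rewrite -[leLHS]ger0_norm ?mulr_ge0// -sqrtr_sqr ler_wsqrtr.
have -> : (c0 * a + c1 * b + (c2 * c + c3 * d)) ^+ 2 * t ^+ (r + r) =
   `|c0 * a * t ^+ r + c1 * b * t ^+ r + (c2 * c * t ^+ r + c3 * d * t ^+ r)| ^+ 2.
  by rewrite real_normK ?num_real// exprD; ring.
have -> : 16 * H = (4 * Num.sqrt H) ^+ 2 by rewrite exprMn sqr_sqrtr//; ring.
have h1 := key _ _ c01 ha; have h2 := key _ _ c11 hb.
have h3 := key _ _ c21 hc; have h4 := key _ _ c31 hd.
apply: lerXn2r; rewrite ?nnegrE ?normr_ge0// ?mulr_ge0 ?sqrtr_ge0//.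
apply: le_trans (ler_normD _ _) _; apply: (@le_trans _ _ ((Num.sqrt H + Num.sqrt H) + (Num.sqrt H + Num.sqrt H))).
  by apply: lerD; apply: le_trans (ler_normD _ _) _; apply: lerD.
by lra.
Qed.

Lemma sqr_sum4_le1 (a b c d t H : R) (r : nat) : 0 <= t ->
  (`|a| * t ^+ r) ^+ 2 <= H -> (`|b| * t ^+ r) ^+ 2 <= H ->
  (`|c| * t ^+ r) ^+ 2 <= H -> (`|d| * t ^+ r) ^+ 2 <= H ->
  (a + b + (c + d)) ^+ 2 * t ^+ (r + r) <= 16 * H.
Proof.
have n1 : `|1| <= 1 :> R by rewrite normr1.
by move=> t0 ha hb hc hd; have := sqr_sum4_le t0 n1 n1 n1 n1 ha hb hc hd; rewrite !mul1r.
Qed.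

Lemma normal_deriv2_bound : operator_bound (@normal_deriv2 R) 1.
Proof.
move=> q x h H sq h0 hp nu nu1; rewrite normal_deriv2E.
have cc i k : `|Defs.coord nu i * Defs.coord nu k| <= 1 by rewrite normrM mulr_ile1.
by apply: sqr_sum4_le => //; exact: (hp [::]).
Qed.

Lemma normal_deriv3_bound : operator_bound normal_deriv3 2.
Proof.
move=> q x h H sq h0 hp nu nu1; rewrite /normal_deriv3 normal_derivE.
rewrite !partial_laplacian// !mulrDr.
by apply: sqr_sum4_le => //; exact: (hp [:: _]).
Qed.

Lemma laplacian2_bound : operator_bound (fun _ q => laplacian (laplacian q)) 3.
Proof.
move=> q x h H sq h0 hp nu nu1.
rewrite laplacianE !partial_laplacian//.
by apply: sqr_sum4_le1 => //; exact: (hp [:: _; _]).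
Qed.

End JumpOperators.

(** * Neighbouring triangles *)

Section Adjacency.
Variable R : realType.
Variables (Omega : set (point2 R)) (A : {fset triangle R}).
Hypothesis regA : regular_triangulation Omega A.
Implicit Types (T K : triangle R) (a b x : point2 R).

Lemma sum_at_most_one (I : eqType) (s : seq I) (P : pred I) (F : I -> R) (M : R) :
  uniq s -> 0 <= M -> (forall i j, i \in s -> j \in s -> P i -> P j -> i = j) ->
  (forall i, i \in s -> P i -> F i <= M) -> \sum_(i <- s | P i) F i <= M.
Proof.
move=> us M0; elim: s us => [|y s IHs] /=; first by rewrite big_nil.
move=> /andP[ys us] Pu PF; rewrite big_cons; case: ifPn => Py; last first.
  apply: IHs => // [i j is_ js|i is_]; [apply: Pu|apply: PF]; by rewrite inE ?is_ ?js orbT.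
rewrite big1_seq ?addr0; first by apply: PF; rewrite ?mem_head.
move=> i /andP[Pi is_]; exfalso; move/negP: ys; apply.
by rewrite (Pu y i)// ?mem_head// inE is_ orbT.
Qed.

Definition adjacent K K' : bool := (K' != K) && `[< exists a b,
  [/\ a != b, a \in vertices K, b \in vertices K, a \in vertices K' & b \in vertices K'] >].

Lemma adjacentC K K' : adjacent K K' = adjacent K' K.
Proof.
rewrite /adjacent eq_sym; congr (_ && _); apply: asbool_equiv_eq.
by split=> -[a [b [? ? ? ? ?]]]; exists a, b.
Qed.

(** There are nine ordered pairs of vertices of [K], and at most one other triangle contains both
    points of a given pair of distinct ones. *)
Lemma sum_adjacent K : K \in A -> \sum_(K' <- A) (adjacent K K')%:R <= (9 : R).
Proof.
move=> KA; set V := vertices K.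
apply: (@le_trans _ _ (\sum_(K' <- A) \sum_(a <- V) \sum_(b <- V)
    [&& K' != K, a != b, a \in vertices K' & b \in vertices K']%:R)).
  apply: ler_sum => K' _; rewrite /adjacent; case: eqP => [_|/eqP KK] /=.
    by apply: sumr_ge0 => a _; apply: sumr_ge0 => b _; rewrite ler0n.
  case: asboolP => [[a [b [ab aK bK aK' bK']]]|_]; last first.
    by apply: sumr_ge0 => a _; apply: sumr_ge0 => b _; rewrite ler0n.
  rewrite (big_rem a)//= (big_rem b)//= ab aK' bK' /=.
  rewrite -addrA lerDl addr_ge0// ?sumr_ge0// => c _.
  by apply: sumr_ge0 => d _; rewrite ler0n.
rewrite exchange_big /=.
apply: (@le_trans _ _ (\sum_(a <- V) \sum_(b <- V) 1)); last first.
  by rewrite /V /vertices !big_cons !big_nil; lra.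
rewrite big_seq [leRHS]big_seq; apply: ler_sum => a aV.
rewrite exchange_big /= big_seq [leRHS]big_seq; apply: ler_sum => b bV.
rewrite (eq_bigr (fun K' => if [&& K' != K, a != b, a \in vertices K' & b \in vertices K'] then 1 else 0)); last first.
  by move=> K' _; case: ifP.
rewrite -big_mkcond; apply: sum_at_most_one => //; first exact: fset_uniq.
move=> K1 K2 K1A K2A /and4P[K1K ab a1 b1] /and4P[K2K _ a2 b2].
exact: (neighbor_unique regA KA K1A K2A ab).
Qed.

Lemma edge_vertices K E : E \in edges K -> E.1 \in vertices K /\ E.2 \in vertices K.
Proof.
by rewrite !inE => /orP[/eqP->|/orP[/eqP->|/eqP->]] /=; rewrite !eqxx ?orbT.
Qed.

Lemma edge_neq K E : 0 < area K -> E \in edges K -> E.1 != E.2.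
Proof.
move=> /vertices_distinct; rewrite /vertices /= !inE !negb_or => /andP[/andP[h1 h2] /andP[h3 _]].
by move=> /orP[/eqP->|/orP[/eqP->|/eqP->]] //=; rewrite eq_sym.
Qed.

Lemma sum_neighbors_le K (F : triangle R -> R) : K \in A -> (forall K', 0 <= F K') ->
  \sum_(E <- edges K) \sum_(K' <- A | [&& K' != K, E.1 \in vertices K' & E.2 \in vertices K']) F K'
    <= 3 * \sum_(K' <- A) (adjacent K K')%:R * F K'.
Proof.
move=> KA F0; have K0 := regular_area regA KA.
set S := \sum_(K' <- A) _.
apply: (@le_trans _ _ (\sum_(E <- edges K) S)); last first.
  by rewrite /edges !big_cons big_nil; lra.
rewrite big_seq [leRHS]big_seq; apply: ler_sum => E EK.
rewrite big_mkcond; apply: ler_sum => K' _; case: ifPn => [/and3P[KK e1 e2]|_].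
  have [v1 v2] := edge_vertices EK.
  have -> : adjacent K K'; last by rewrite mul1r.
  by rewrite /adjacent KK; apply/asboolP; exists E.1, E.2; split=> //; exact: (edge_neq K0).
by rewrite mulr_ge0// ler0n.
Qed.

(** By symmetry of adjacency both summands contribute 9; with three edges per triangle this gives 3
    (9 + 9) = 54. *)
Lemma sum_adjacency (F : triangle R -> R) : (forall K, 0 <= F K) ->
  \sum_(K <- A) \sum_(E <- edges K)
    \sum_(K' <- A | [&& K' != K, E.1 \in vertices K' & E.2 \in vertices K']) (F K + F K')
    <= 54 * \sum_(K <- A) F K.
Proof.
move=> F0.
have one : \sum_(K <- A) \sum_(K' <- A) (adjacent K K')%:R * F K <= 9 * \sum_(K <- A) F K.
  rewrite mulr_sumr big_seq [leRHS]big_seq; apply: ler_sum => K KA.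
  by rewrite -mulr_suml ler_wpM2r//; exact: sum_adjacent.
have two : \sum_(K <- A) \sum_(K' <- A) (adjacent K K')%:R * F K' <= 9 * \sum_(K <- A) F K.
  rewrite exchange_big /=; apply: le_trans one; apply: ler_sum => K _; apply: ler_sum => K' _.
  by rewrite adjacentC.
apply: (@le_trans _ _ (\sum_(K <- A) 3 * \sum_(K' <- A) (adjacent K K')%:R * (F K + F K'))).
  rewrite big_seq [leRHS]big_seq; apply: ler_sum => K KA.
  by apply: (sum_neighbors_le (F := fun K' => F K + F K')) => // K'; exact: addr_ge0.
rewrite -mulr_sumr.
under eq_bigr do under eq_bigr do rewrite mulrDr.
under eq_bigr do rewrite big_split /=.
rewrite big_split /=; lra.
Qed.

Lemma segment_in_triangle K a b (t : R) : a \in vertices K -> b \in vertices K ->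
  0 <= t <= 1 -> closed_triangle K (a + t *: (b - a)).
Proof.
move=> v1 v2 /andP[t0 t1].
apply: (convex_triangle (vertex_in_triangle v1) (vertex_in_triangle v2) (vertex_in_triangle v1)).
by exists (1 - t), t, 0; split; [lra|lra|lra|lra|split; rewrite /= /GRing.scale /=; ring].
Qed.

End Adjacency.

(** * Stability of the polynomial part of the estimator *)

Section DiscreteStability.
Variable R : realType.
Implicit Types (T K : triangle R) (f g q v w : fun2 R) (r : nat).

Lemma area_powR12 K : area K `^ (1 / 2) = diam K.
Proof. by rewrite div1r powR12_sqrt ?area_ge0. Qed.

Lemma area_powR32 K : area K `^ (3 / 2) = diam K ^+ 3.
Proof.
rewrite -area_powR12 -powR_mulrn ?powR_ge0// -powRrM.
by congr (_ `^ _); field.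
Qed.

Lemma area_diam4 K : area K ^+ 2 = diam K ^+ 4.
Proof. by rewrite -diam_sqr -exprM. Qed.

Definition volume_residual w K : R :=
  int2 (closed_triangle K) (fun x => laplacian (laplacian (piece w K)) x ^+ 2).

Definition polynomial_estimator (A : {fset triangle R}) w K : R :=
  diam K ^+ 4 * volume_residual w K + diam K * jump_norm2 A K (@normal_deriv2 R) w
    + diam K ^+ 3 * jump_norm2 A K (@normal_deriv3 R) w.

Lemma jump_norm2_ge0 A K d w : 0 <= jump_norm2 A K d w.
Proof.
apply: sumr_ge0 => E _; apply: sumr_ge0 => K' _; apply: edge_integral_ge0 => x.
exact: sqr_ge0.
Qed.

Lemma polynomial_estimator_ge0 A w K : 0 <= polynomial_estimator A w K.
Proof.
rewrite /polynomial_estimator !addr_ge0// mulr_ge0 ?exprn_ge0 ?diam_ge0 ?jump_norm2_ge0//.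
by apply: int2_ge0 => x _; exact: sqr_ge0.
Qed.

Lemma triangle_measurable_fun K (f : fun2 R) : continuous f -> 0 < area K ->
  measurable_fun2 (closed_triangle K) f.
Proof.
move=> cf K0; apply: (@measurable_fun2S _ setT) => //; first exact: measurableT.
exact: continuous_measurable_fun2.
Qed.

Lemma sqr_sub_le (y y' : R) : (y - y') ^+ 2 <= 2 * y ^+ 2 + 2 * y' ^+ 2.
Proof. by have := sqr_ge0 (y + y'); nra. Qed.

Lemma two_term_bound (B a a' y y' t e : R) : 0 <= B * a -> 0 <= B * a' -> 0 <= e ->
  y * t <= 16 * (B * a) -> y' * t <= e * (16 * (B * a')) ->
  (2 * y + 2 * y') * t <= 32 * (1 + e) * B * (a + a').
Proof.
move=> a0 a0' e0 h h'; have := mulr_ge0 e0 a0; have := mulr_ge0 e0 a0'.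
rewrite (_ : (2 * y + 2 * y') * t = 2 * (y * t) + 2 * (y' * t)); last by ring.
rewrite (_ : 32 * (1 + e) * B * (a + a') =
  32 * (B * a + B * a' + e * (B * a) + e * (B * a'))); last by ring.
move: h h'; rewrite (_ : e * (16 * (B * a')) = 16 * (e * (B * a'))); last by ring.
lra.
Qed.

Section Estimate.
Variables (Omega : set (point2 R)) (A : {fset triangle R}) (p : nat) (kap : R).
Hypothesis oO : open Omega.
Hypothesis lip : lipschitz_boundary Omega.
Hypothesis regA : regular_triangulation Omega A.
Hypothesis kap0 : 0 < kap.
Hypothesis shA : forall K, K \in A -> shape_sum K <= kap * area K.
Variable w : fun2 R.
Hypothesis Hw : H2 Omega w.
Hypothesis Pw : piecewise_polynomial p A w.
Variable B : R.
Hypothesis B0 : 0 <= B.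
Let D := dil kap.
Let H := core_energy Omega kap w.

Hypothesis partialB : forall K, K \in A ->
  forall (l : seq 'I_2) (i k : 'I_2) x, (size l <= 2)%N -> closed_triangle K x ->
  (`|partial (l ++ [:: i; k]) (piece w K) x| * diam K ^+ (size l).+1) ^+ 2 <= B * H K.

Let D0 : 0 < D := dil_gt0 kap0.
Let area0 K : K \in A -> 0 < area K := @regular_area _ _ _ regA K.
Let H0 K : 0 <= H K := core_energy_ge0 _ _ _ _.

Lemma piece_smooth K : K \in A -> smooth2 (piece w K).
Proof. by move=> KA; apply: (@polynomial2_smooth _ p); exact: (piece_polynomial Pw (area0 KA) KA).1. Qed.

(** The pointwise bounds on both sides are integrated over the edge, whose length supplies one of
    the r + r powers of h. The sizes of the two triangles are compared through their common edge. *)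
Lemma jump_edge_le d r K K' E : linear_operator d -> operator_bound d r -> (0 < r)%N ->
  K \in A -> K' \in A -> E \in edges K -> E.1 \in vertices K' -> E.2 \in vertices K' ->
  diam K ^+ (r + r).-1 * edge_integral E (fun x =>
    (d (normal E) (piece w K) x - d (normal E) (piece w K') x) ^+ 2)
  <= 64 * D * (1 + (2 * D ^+ 2) ^+ (r + r)) * B * (H K + H K').
Proof.
move=> [dc dl] db r0 KA K'A EK e1 e2.
have K0 := area0 KA; have K0' := area0 K'A.
have h0 := diam_gt0 K0; have h0' := diam_gt0 K0'.
set h := diam K in h0 *; set h' := diam K' in h0'.
have [v1 v2] := edge_vertices EK; have EE := edge_neq K0 EK.
have hE : h <= D * Defs.edist E.1 E.2 by exact: (diam_le_edist kap0 K0 (shA KA)).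
have Eh : Defs.edist E.1 E.2 <= 2 * D * h by exact: (vertex_edist kap0 (shA KA)).
have Eh' : Defs.edist E.1 E.2 <= 2 * D * h' by exact: (vertex_edist kap0 (shA K'A)).
have hh' : h <= 2 * D ^+ 2 * h'.
  apply: (le_trans hE); rewrite (_ : 2 * D ^+ 2 * h' = D * (2 * D * h')); last by ring.
  by rewrite ler_pM2l.
have cc i : `|Defs.coord (normal E) i| <= 1 by exact: normal_coord_le.
have bd L x : L \in A -> closed_triangle L x ->
    d (normal E) (piece w L) x ^+ 2 * diam L ^+ (r + r) <= 16 * (B * H L).
  move=> LA Lx; apply: db => //; first exact: piece_smooth.
    exact: diam_ge0.
  by move=> l i k sl; exact: partialB.
set S := H K + H K'; have S0 : 0 <= S by exact: addr_ge0.
set e := 2 * D ^+ 2; have e0 : 0 <= e by rewrite mulr_ge0// sqr_ge0.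
(* Twice 16 for the two traces; the one from K' carries the additional factor e^(2r) because h <= e
   h'. *)
pose M := 32 * (1 + e ^+ (r + r)) * B * S / h ^+ (r + r).
have hr0 : 0 < h ^+ (r + r) by exact: exprn_gt0.
have er0 : 0 <= e ^+ (r + r) by exact: exprn_ge0.
have M0 : 0 <= M.
  by rewrite /M divr_ge0 ?(ltW hr0)// mulr_ge0// mulr_ge0// mulr_ge0// addr_ge0.
have bM (t : R) : 0 <= t <= 1 -> (d (normal E) (piece w K) (E.1 + t *: (E.2 - E.1)) -
    d (normal E) (piece w K') (E.1 + t *: (E.2 - E.1))) ^+ 2 <= M.
  move=> t01; set x := E.1 + t *: (E.2 - E.1).
  have Kx : closed_triangle K x by exact: segment_in_triangle.
  have Kx' : closed_triangle K' x.
    exact: segment_in_triangle.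
  have b1 := bd K x KA Kx; have b2 := bd K' x K'A Kx'.
  set y := d _ (piece w K) x in b1 *; set y' := d _ (piece w K') x in b2 *.
  rewrite /M ler_pdivlMr//.
  have sq := sqr_sub_le y y'.
  have b3 : y' ^+ 2 * h ^+ (r + r) <= e ^+ (r + r) * (16 * (B * H K')).
    apply: (@le_trans _ _ (y' ^+ 2 * (e * h') ^+ (r + r))).
      by rewrite ler_wpM2l ?sqr_ge0//; apply: lerXn2r; rewrite ?nnegrE ?(ltW h0)// mulr_ge0// ltW.
    rewrite exprMn mulrCA ler_wpM2l// exprn_ge0//.
  apply: (@le_trans _ _ ((2 * y ^+ 2 + 2 * y' ^+ 2) * h ^+ (r + r))).
    by rewrite ler_wpM2r// ltW.
  have BK : 0 <= B * H K by exact: mulr_ge0.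
  have BK' : 0 <= B * H K' by exact: mulr_ge0.
  exact: (two_term_bound BK BK' er0 b1 b3).
have cj : continuous (fun x => (d (normal E) (piece w K) x - d (normal E) (piece w K') x) ^+ 2).
  have -> : (fun x => (d (normal E) (piece w K) x - d (normal E) (piece w K') x) ^+ 2) =
    (fun x => (d (normal E) (piece w K) x - d (normal E) (piece w K') x) *
              (d (normal E) (piece w K) x - d (normal E) (piece w K') x)) by [].
  by apply: continuous_mul2 => x; apply: continuousB; apply: dc; exact: piece_smooth.
have := edge_integral_bound cj bM => le.
apply: (@le_trans _ _ (h ^+ (r + r).-1 * (2 * D * h * M))).
  rewrite ler_wpM2l ?exprn_ge0 ?(ltW h0)//; apply: le_trans le _.
  by rewrite ler_wpM2r.
have -> : h ^+ (r + r).-1 * (2 * D * h * M) = 64 * D * (1 + e ^+ (r + r)) * B * S; last by [].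
rewrite /M -[in h ^+ (r + r)](@prednK (r + r)) ?addn_gt0 ?r0// exprS; field.
by rewrite expf_neq0 ?gt_eqF.
Qed.

Lemma sum_jump_le d r : linear_operator d -> operator_bound d r -> (0 < r)%N ->
  \sum_(K <- A) diam K ^+ (r + r).-1 * jump_norm2 A K d w
  <= 64 * D * (1 + (2 * D ^+ 2) ^+ (r + r)) * B * (54 * \sum_(K <- A) H K).
Proof.
move=> dl db r0.
have c0 : 0 <= 64 * D * (1 + (2 * D ^+ 2) ^+ (r + r)) * B.
  by rewrite !mulr_ge0 ?addr_ge0 ?exprn_ge0 ?mulr_ge0 ?sqr_ge0 ?(ltW D0).
have := ler_wpM2l c0 (sum_adjacency regA H0); apply: le_trans.
rewrite mulr_sumr big_seq [leRHS]big_seq; apply: ler_sum => K KA.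
rewrite /jump_norm2 !mulr_sumr big_seq [leRHS]big_seq; apply: ler_sum => E EK.
rewrite !mulr_sumr big_seq_cond [leRHS]big_seq_cond; apply: ler_sum => K' /andP[K'A /and3P[_ e1 e2]].
exact: jump_edge_le.
Qed.

(** The squared bilaplacian is at most 16 B H / h^6 on [K], which fits into a square of area (2 D
    h)^2. *)
Lemma volume_le K : K \in A -> diam K ^+ 4 * volume_residual w K <= 64 * D ^+ 2 * B * H K.
Proof.
move=> KA; have K0 := area0 KA; have h0 := diam_gt0 K0; set h := diam K in h0 *.
have sq := laplacian_smooth (laplacian_smooth (piece_smooth KA)).
pose M := 16 * (B * H K) / h ^+ 6.
have M0 : 0 <= M.
  by rewrite /M divr_ge0 ?exprn_ge0 ?(ltW h0)// mulr_ge0// mulr_ge0//.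
have Dh : 0 <= D * h by rewrite mulr_ge0// ltW.
have bM x : closed_triangle K x -> `|laplacian (laplacian (piece w K)) x ^+ 2| <= M.
  move=> Kx; rewrite ger0_norm ?sqr_ge0// /M ler_pdivlMr ?exprn_gt0//.
  apply: (@laplacian2_bound R (piece w K) x h (B * H K) (piece_smooth KA) (ltW h0) _ (0, 0)).
    by move=> l i k sl; exact: partialB.
  by move=> i; rewrite /Defs.coord /=; case: ifP; rewrite normr0 ler01.
have mf : measurable_fun2 (closed_triangle K) (fun x => laplacian (laplacian (piece w K)) x ^+ 2).
  apply: measurable_fun2M; apply: triangle_measurable_fun => //; exact: smooth2_continuous.
set z := centroid K.
have := @int2_bounded R (closed_triangle K) (z.1 - D * h) (z.1 + D * h) (z.2 - D * h) (z.2 + D * h)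
  _ M (measurable2_triangle K0) _ _ _ mf M0 bM.
rewrite -/(volume_residual w K) => le.
have {}le : volume_residual w K <= M * ((2 * (D * h)) ^+ 2).
  apply: le_trans (le _ _ _) _; [lra|lra| |].
    move=> x Kx; have [h1 h2] := triangle_centroid_dist kap0 (shA KA) Kx.
    move: h1 h2; rewrite -/z -/D -/h !ler_norml => /andP[? ?] /andP[? ?].
    by split; apply/andP; split; lra.
  by rewrite [X in X <= _](_ : _ = M * (2 * (D * h)) ^+ 2)//; ring.
apply: (@le_trans _ _ (h ^+ 4 * (M * (2 * (D * h)) ^+ 2))).
  by rewrite ler_wpM2l// exprn_ge0// ltW.
rewrite /M [X in X <= _](_ : _ = 64 * D ^+ 2 * B * H K)//; field.
by rewrite gt_eqF.
Qed.

(** The cores lie in [Omega] and in triangles that overlap in null sets only. *)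
Lemma sum_core_energy : \sum_(K <- A) H K <= form_a Omega w w.
Proof.
have mO := open_measurable2 oO; rewrite form_aE.
set f := (fun x => \sum_(i < 2) \sum_(k < 2) wD Omega [:: i; k] w x ^+ 2).
have f0 x : 0 <= f x.
  by apply: sumr_ge0 => i _; apply: sumr_ge0 => k _; exact: sqr_ge0.
have intf : integrable2 Omega f by exact: energy_integrable.
(* Closed triangles meet the boundary, and outside [Omega] the representatives of the weak
   derivatives are arbitrary; hence the extension by zero. *)
have intF : integrable2 setT (f \_ Omega) by apply/(integrable2_mkcond f mO).
have F0 x : 0 <= (f \_ Omega) x by rewrite patchE; case: ifP.
rewrite int2_mkcond.
apply: le_trans (int2_sum_triangles (X := A) (D := setT) _ _ _ _ _ intF _) => //.
- rewrite big_seq [leRHS]big_seq; apply: ler_sum => K KA.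
  have K0 := area0 KA; have mK := measurable2_triangle K0.
  have [_ clo _] := regA.
  have QO : core kap K `<=` Omega.
    apply: core_sub_domain => //; first exact: shA.
    by rewrite clo => x Kx; exists K.
  have mQ : measurable2 (core kap K) by exact: measurable2_sqbox.
  rewrite /H /core_energy (@int2_eq _ (core kap K) _ (f \_ Omega)).
    apply: int2_subset => //; first exact: core_sub_triangle (shA KA).
    by apply: (integrable2S (D := setT)) => //; exact: measurableT.
  by move=> x /QO Ox; rewrite patchE mem_set.
- exact: fset_uniq.
- by move=> K K' KA KA' KK'; exact: (regular_null regA).
- exact: measurableT.
Qed.

Lemma sum_polynomial_estimator :
  \sum_(K <- A) polynomial_estimator A w K <=
  (64 * D ^+ 2 * B + 64 * D * (1 + (2 * D ^+ 2) ^+ 2) * B * 54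
     + 64 * D * (1 + (2 * D ^+ 2) ^+ 4) * B * 54) * form_a Omega w w.
Proof.
have j1 := sum_jump_le (@normal_deriv2_linear R) (@normal_deriv2_bound R) (ltn0Sn 0).
have j2 := sum_jump_le (@normal_deriv3_linear R) (@normal_deriv3_bound R) (ltn0Sn 1).
have v : \sum_(K <- A) diam K ^+ 4 * volume_residual w K <= 64 * D ^+ 2 * B * \sum_(K <- A) H K.
  by rewrite mulr_sumr big_seq [leRHS]big_seq; apply: ler_sum => K; exact: volume_le.
have e (r : nat) : 0 <= (2 * D ^+ 2) ^+ r by rewrite exprn_ge0// mulr_ge0// sqr_ge0.
have -> : \sum_(K <- A) polynomial_estimator A w K =
  \sum_(K <- A) diam K ^+ 4 * volume_residual w K +
  \sum_(K <- A) diam K ^+ 1 * jump_norm2 A K (@normal_deriv2 R) w +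
  \sum_(K <- A) diam K ^+ 3 * jump_norm2 A K (@normal_deriv3 R) w.
  by rewrite -!big_split.
have := sum_core_energy; set S := \sum_(K <- A) H K in j1 j2 v * => SF.
apply: (@le_trans _ _ ((64 * D ^+ 2 * B + 64 * D * (1 + (2 * D ^+ 2) ^+ 2) * B * 54
     + 64 * D * (1 + (2 * D ^+ 2) ^+ 4) * B * 54) * S)).
  apply: le_trans (lerD (lerD v j1) j2) _; rewrite le_eqVlt; apply/orP; left; apply/eqP.
  by rewrite /=; ring.
have D1 := ltW D0.
rewrite ler_wpM2l//; apply: addr_ge0; first apply: addr_ge0.
- by rewrite mulr_ge0// mulr_ge0// sqr_ge0.
- by rewrite mulr_ge0// mulr_ge0// mulr_ge0 ?addr_ge0// mulr_ge0.
- by rewrite mulr_ge0// mulr_ge0// mulr_ge0 ?addr_ge0// mulr_ge0.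
Qed.

End Estimate.

Theorem polynomial_estimator_bound (p : nat) (kap : R) : 0 < kap ->
  exists2 C : R, 0 < C & forall (Omega : set (point2 R)) (A : {fset triangle R}) w,
    open Omega -> lipschitz_boundary Omega -> regular_triangulation Omega A ->
    (forall K, K \in A -> shape_sum K <= kap * area K) ->
    H2 Omega w -> piecewise_polynomial p A w ->
    \sum_(K <- A) polynomial_estimator A w K <= C * form_a Omega w w.
Proof.
move=> kap0; have [B B0 HB] := partial_core_bound p kap0; have D0 := dil_gt0 kap0.
have e (r : nat) : 0 <= (2 * dil kap ^+ 2) ^+ r by rewrite exprn_ge0// mulr_ge0// sqr_ge0.
have c (r : nat) : 0 < 1 + (2 * dil kap ^+ 2) ^+ r by rewrite ltr_wpDr.
exists (64 * dil kap ^+ 2 * B + 64 * dil kap * (1 + (2 * dil kap ^+ 2) ^+ 2) * B * 54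
     + 64 * dil kap * (1 + (2 * dil kap ^+ 2) ^+ 4) * B * 54); last first.
  move=> Omega A w oO lip regA shA Hw Pw.
  apply: (@sum_polynomial_estimator Omega A p kap oO lip regA kap0 shA w Hw Pw B (ltW B0)).
  move=> K KA; have K0 := regular_area regA KA; have [Pq wq] := piece_polynomial Pw K0 KA.
  apply: HB => //; first exact: shA.
  by have [_ -> _] := regA => x Kx; exists K.
have c' (r : nat) : 0 < 64 * dil kap * (1 + (2 * dil kap ^+ 2) ^+ r) * B * 54.
  by apply: mulr_gt0 => //; apply: mulr_gt0 => //; apply: mulr_gt0 => //; apply: mulr_gt0.
apply: addr_gt0 (c' 4); apply: addr_gt0 (c' 2).
by apply: mulr_gt0 => //; apply: mulr_gt0 => //; exact: exprn_gt0.
Qed.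

End DiscreteStability.

(** * Reduction on refined triangles *)

Section Estimators.
Variable R : realType.
Implicit Types (T K : triangle R) (f g q v w : fun2 R) (A B : {fset triangle R}).

Lemma integrable2_triangle K f : 0 < area K -> continuous f ->
  integrable2 (closed_triangle K) f.
Proof.
move=> K0 cf; have [kap kap0 shK] := area_shape K0.
set z := centroid K; set r := dil kap * diam K.
have Kb : closed_triangle K `<=` cbox (z.1 - r) (z.1 + r) (z.2 - r) (z.2 + r).
  move=> x Kx; have [h1 h2] := triangle_centroid_dist kap0 shK Kx.
  by move: h1 h2; rewrite -/z -/r !ler_distl => /andP[? ?] /andP[? ?]; split; apply/andP; split.
have r0 : 0 <= r by rewrite mulr_ge0 ?diam_ge0// ltW// dil_gt0.
have [M M0 fM] := continuous_cbox_bounded (z.1 - r) (z.1 + r) (z.2 - r) (z.2 + r) cf.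
apply: (integrable2_bounded (M := M) _ _ _ Kb).
- exact: measurable2_triangle.
- by lra.
- by lra.
- exact: triangle_measurable_fun.
- by move=> x /Kb; exact: fM.
Qed.

Definition residual (l : R) v K : fun2 R := fun x => l * v x - laplacian (laplacian (piece v K)) x.

Lemma eta2E A (l : R) v K : eta2 A l v K =
  diam K ^+ 4 * int2 (closed_triangle K) (fun x => residual l v K x ^+ 2)
  + diam K * jump_norm2 A K (@normal_deriv2 R) v
  + diam K ^+ 3 * jump_norm2 A K (@normal_deriv3 R) v.
Proof.
rewrite /eta2 area_powR12 area_powR32 area_diam4 /L2_norm sqr_sqrtr//.
by apply: int2_ge0 => x _; rewrite /=; exact: sqr_ge0.
Qed.

Lemma eta2_ge0 A (l : R) v K : 0 <= eta2 A l v K.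
Proof.
rewrite eta2E !addr_ge0// mulr_ge0 ?exprn_ge0 ?diam_ge0 ?jump_norm2_ge0//.
by apply: int2_ge0 => x _; exact: sqr_ge0.
Qed.

Lemma continuous_sqr2 f : continuous f -> continuous (fun x => f x ^+ 2).
Proof. by move=> cf; apply: continuous_mul2. Qed.

Lemma continuous_comb2 (a b : R) f g : continuous f -> continuous g ->
  continuous (fun x => a * f x + b * g x).
Proof.
by move=> cf cg; apply: continuous_add2; apply: continuous_mul2 => //; exact: cst_continuous.
Qed.

Lemma residual_continuous p A (l : R) v K : piecewise_polynomial p A v -> 0 < area K -> K \in A ->
  exists2 f, continuous f & forall x, closed_triangle K x -> residual l v K x = f x.
Proof.
move=> Pv K0 KA; have [Pq vq] := piece_polynomial Pv K0 KA.
exists (fun x => l * piece v K x + (-1) * laplacian (laplacian (piece v K)) x).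
  have sq := polynomial2_smooth Pq; apply: continuous_comb2; first exact: smooth2_continuous.
  by apply: smooth2_continuous; exact: (laplacian_smooth (laplacian_smooth sq)).
by move=> x Kx; rewrite /residual vq// mulN1r.
Qed.

Section Refinement.
Variables (Omega : set (point2 R)) (A B : {fset triangle R}) (p : nat).
Hypothesis regA : regular_triangulation Omega A.
Hypothesis regB : regular_triangulation Omega B.
Hypothesis AB : nvb_refinement A B.
Variable v : fun2 R.
Hypothesis Pv : piecewise_polynomial p A v.

Let areaA T : T \in A -> 0 < area T := @regular_area _ _ _ regA T.
Let areaB K : K \in B -> 0 < area K := @regular_area _ _ _ regB K.

(** The squared jump of the coarse polynomials across the common edge; the value 0 for T' outside
    [A] makes it nonnegative and continuous for every T', as the lemmas on [theta] demand. *)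
Definition coarse_jump (d : point2 R -> fun2 R -> fun2 R) T T' (nu : point2 R) : fun2 R :=
  if T' \in A then (fun x => (d nu (piece v T) x - d nu (piece v T') x) ^+ 2) else cst 0.

Section Jump.
Variables (d : point2 R -> fun2 R -> fun2 R) (T : triangle R).
Hypothesis dl : linear_operator d.
Hypothesis TA : T \in A.

Lemma coarse_jump_ge0 T' nu x : 0 <= coarse_jump d T T' nu x.
Proof. by rewrite /coarse_jump; case: ifP => _; rewrite ?sqr_ge0. Qed.

Lemma coarse_jump_continuous T' nu : continuous (coarse_jump d T T' nu).
Proof.
rewrite /coarse_jump; case: ifPn => [T'A|_]; last exact: cst_continuous.
have sm L : L \in A -> smooth2 (piece v L).
  by move=> LA; apply: (@polynomial2_smooth _ p); exact: (piece_polynomial Pv (areaA LA) LA).1.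
apply: continuous_sqr2 => x.
by apply: continuousB; apply: dl.1; exact: sm.
Qed.

(** Across each edge there is at most one fine neighbour, and it descends from some coarse T'. If T'
    is [T], both pieces are the same polynomial and the jump is zero; otherwise the jump is one of
    the summands of [theta]. *)
Lemma refinement_jump_le K : K \in B -> closed_triangle K `<=` closed_triangle T ->
  jump_norm2 B K d v <= theta A T (coarse_jump d T) K.
Proof.
move=> KB KT; have K0 := areaB KB; have T0 := areaA TA.
rewrite /theta asboolT// exchange_big /= /jump_norm2 big_seq [leRHS]big_seq.
apply: ler_sum => E EK; have [v1 v2] := edge_vertices EK; have EE := edge_neq K0 EK.
have F0 T' : 0 <= (if `[< closed_triangle T' E.1 /\ closed_triangle T' E.2 >]
     then edge_integral E (coarse_jump d T T' (normal E)) else 0).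
  by case: ifP => // _; apply: edge_integral_ge0 => x; exact: coarse_jump_ge0.
apply: sum_at_most_one.
- exact: fset_uniq.
- by apply: sumr_ge0 => T' _; exact: F0.
- move=> K1 K2 K1B K2B /and3P[n1 a1 b1] /and3P[n2 a2 b2].
  exact: (neighbor_unique regB KB K1B K2B EE).
move=> K' K'B /and3P[KK e1 e2]; have K0' := areaB K'B.
have [T' [T'A K'T' _]] := nvb_ancestor AB K'B.
have PT := piece_sub Pv TA T0 K0 KT.
have PT' := piece_sub Pv T'A (areaA T'A) K0' K'T'.
have [TT|TT] := eqVneq T' T.
  have -> : edge_integral E (fun x => (d (normal E) (piece v K) x - d (normal E) (piece v K') x) ^+ 2) = 0.
    rewrite (_ : (fun x => _) = (fun x => 0 * 0 + 0 * 0)).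
      by rewrite (@edge_integral_comb _ E 0 0 (cst 0) (cst 0)) ?mul0r ?addr0//; exact: cst_continuous.
    by apply/funext => x; rewrite PT PT' TT subrr expr0n mul0r addr0.
  by apply: sumr_ge0 => L _; exact: F0.
rewrite (big_rem T') //= TT asboolT; last first.
  by split; apply: K'T'; exact: vertex_in_triangle.
rewrite /coarse_jump T'A PT PT' lerDl; apply: sumr_ge0 => L _.
by case: ifP => // _; apply: edge_integral_ge0 => x; case: ifP => _ //; exact: sqr_ge0.
Qed.

Lemma sum_theta_coarse : \sum_(K <- B) theta A T (coarse_jump d T) K <= jump_norm2 A T d v.
Proof.
apply: le_trans (theta_nvb regA TA coarse_jump_ge0 _ AB) _; first exact: coarse_jump_continuous.
rewrite (theta_self regA _ TA) /jump_norm2 le_eqVlt; apply/orP; left; apply/eqP.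
apply: eq_bigr => E _; rewrite big_seq_cond [RHS]big_seq_cond; apply: eq_bigr => T' /andP[T'A _].
by rewrite /coarse_jump T'A.
Qed.

End Jump.

Lemma sum_volume_refinement (l : R) T : T \in A ->
  \sum_(K <- B | `[< closed_triangle K `<=` closed_triangle T >])
    int2 (closed_triangle K) (fun x => residual l v T x ^+ 2)
  <= int2 (closed_triangle T) (fun x => residual l v T x ^+ 2).
Proof.
move=> TA; have T0 := areaA TA; rewrite -big_filter.
have [f cf fE] := residual_continuous l Pv T0 TA.
have mT := measurable2_triangle T0.
apply: int2_sum_triangles => //.
- by rewrite filter_uniq ?fset_uniq.
- by move=> K; rewrite mem_filter => /andP[_ /areaB].
- by move=> K; rewrite mem_filter => /andP[/asboolP].
- move=> K K'; rewrite !mem_filter => /andP[_ KB] /andP[_ KB'].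
  exact: (regular_null regB).
- apply: (@eq_integrable2 _ _ (fun x => f x ^+ 2)) => // [x Tx|]; first by rewrite fE.
  exact: integrable2_triangle (continuous_sqr2 cf).
- by move=> x _; exact: sqr_ge0.
Qed.

Lemma pow4_sqr : ((2 : R) `^ (- (1 / 4))) ^+ 4 = 2^-1.
Proof.
rewrite -powR_mulrn ?powR_ge0// -powRrM.
by rewrite (_ : - (1 / 4) * 4%:R = -1 :> R) ?powR_inv1//; field.
Qed.

(** Every new fine triangle is charged to its coarse ancestor. Its weights h, h^3 and h^4 are
    smaller by c = 2^(-1/2) at least, and the unweighted terms of all descendants sum up to at most
    those of the ancestor. *)
Lemma eta2_refinement (l : R) :
  \sum_(K <- (B `\` A)%fset) eta2 B l v K
  <= (2 `^ (- (1 / 4))) ^+ 2 * \sum_(T <- (A `\` B)%fset) eta2 A l v T.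
Proof.
set c := _ ^+ 2; have c0 : 0 <= c by exact: sqr_ge0.
have c2 : c ^+ 2 = 2^-1 by rewrite /c -exprM; exact: pow4_sqr.
have c1 : c <= 1 by nra.
pose psi T K := if `[< closed_triangle K `<=` closed_triangle T >] then
    int2 (closed_triangle K) (fun x => residual l v T x ^+ 2) else 0.
pose th d T K := theta A T (coarse_jump d T) K.
have psi0 T K : 0 <= psi T K.
  by rewrite /psi; case: ifP => // _; apply: int2_ge0 => x _; exact: sqr_ge0.
have th0 d T K : 0 <= th d T K by apply: theta_ge0 => *; exact: coarse_jump_ge0.
pose F T K := diam T ^+ 4 * psi T K + diam T * th (@normal_deriv2 R) T K
   + diam T ^+ 3 * th (@normal_deriv3 R) T K.
have F0 T K : 0 <= F T K by rewrite /F !addr_ge0// mulr_ge0 ?exprn_ge0 ?diam_ge0.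
have l2 := @normal_deriv2_linear R; have l3 := @normal_deriv3_linear R.
apply: (@le_trans _ _ (\sum_(K <- (B `\` A)%fset) \sum_(T <- (A `\` B)%fset) c * F T K)).
  rewrite big_seq [leRHS]big_seq; apply: ler_sum => K; rewrite in_fsetD => /andP[KA KB].
  have K0 := areaB KB; have [T [TA KT KT2]] := nvb_ancestor AB KB.
  have {}KT2 : area K <= area T / 2 by case: KT2 => // KE; rewrite KE TA in KA.
  have T0 := areaA TA.
  (* If the ancestor had survived, regularity of [B] would force [K] = [T], an element of [A]. *)
  have TB : T \notin B.
    apply/negP => TB; have KE := regular_sub_eq regB KB TB K0 (fun x h => h) KT.
    by rewrite KE TA in KA.
  have TAB : T \in (A `\` B)%fset by rewrite in_fsetD TB TA.
  rewrite (big_rem T)//=; apply: ler_wpDr; first by apply: sumr_ge0 => L _; rewrite mulr_ge0.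
  have h0 := diam_gt0 K0; have k0 := diam_gt0 T0.
  (* The area is at most halved, c^2 = 1/2, and c <= 1 lets a single factor c serve for all higher
     powers. *)
  have hh : diam K <= c * diam T.
    rewrite -(@ler_pXn2r _ 2) ?nnegrE ?(ltW h0)// ?mulr_ge0 ?(ltW k0)//.
    by rewrite exprMn c2 !diam_sqr; lra.
  have hn (n : nat) : diam K ^+ n.+1 <= c * diam T ^+ n.+1.
    apply: (@le_trans _ _ ((c * diam T) ^+ n.+1)).
      by apply: lerXn2r; rewrite ?nnegrE ?mulr_ge0 ?(ltW h0) ?(ltW k0).
    rewrite exprMn ler_wpM2r ?exprn_ge0 ?(ltW k0)// exprS ler_piMr//.
    exact: exprn_ile1.
  have PT := piece_sub Pv TA T0 K0 KT.
  have I0 : 0 <= int2 (closed_triangle K) (fun x => residual l v T x ^+ 2).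
    by apply: int2_ge0 => x _; exact: sqr_ge0.
  rewrite eta2E [leRHS](_ : _ = c * diam T ^+ 4 * psi T K + c * diam T * th (@normal_deriv2 R) T K
      + c * diam T ^+ 3 * th (@normal_deriv3 R) T K); last by rewrite /F; ring.
  rewrite {1}/psi asboolT//; apply: lerD; first apply: lerD.
  - have -> : residual l v K = residual l v T by rewrite /residual PT.
    by rewrite ler_wpM2r//; exact: hn.
  - by apply: ler_pM => //; [exact: ltW|exact: jump_norm2_ge0|exact: refinement_jump_le].
  - apply: ler_pM; [by rewrite exprn_ge0// ltW|exact: jump_norm2_ge0|exact: hn|].
    exact: refinement_jump_le.
rewrite exchange_big /= mulr_sumr big_seq [leRHS]big_seq; apply: ler_sum => T.
rewrite in_fsetD => /andP[TB TA].
apply: (@le_trans _ _ (\sum_(K <- B) c * F T K)).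
  apply: sum_subset; first exact: fset_uniq.
    by move=> K; rewrite in_fsetD => /andP[].
  by move=> K; rewrite mulr_ge0.
rewrite -mulr_sumr ler_wpM2l// eta2E /F !big_split /= -!mulr_sumr.
have k0 := diam_ge0 T.
apply: lerD; first apply: lerD.
- by rewrite ler_wpM2l ?exprn_ge0// /psi -big_mkcond; exact: sum_volume_refinement.
- by rewrite ler_wpM2l//; exact: sum_theta_coarse.
- by rewrite ler_wpM2l ?exprn_ge0//; exact: sum_theta_coarse.
Qed.

End Refinement.
End Estimators.

(** * Perturbation of the discrete function *)

Section Perturbation.
Variable R : realType.
Variables (Omega : set (point2 R)) (B : {fset triangle R}) (p : nat).
Hypothesis regB : regular_triangulation Omega B.
Variables (v vhat : fun2 R) (l lhat : R).
Hypothesis Pv : piecewise_polynomial p B v.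
Hypothesis Pvhat : piecewise_polynomial p B vhat.
Let w : fun2 R := fun x => 1 * vhat x + (-1) * v x.

Let area0 K : K \in B -> 0 < area K := @regular_area _ _ _ regB K.

Lemma sqr_perturb_le (t x y z : R) : 0 < t ->
  (x + (y - z)) ^+ 2 <= (1 + t) * x ^+ 2 + (1 + t^-1) * (2 * y ^+ 2 + 2 * z ^+ 2).
Proof.
move=> t0; apply: le_trans (sqr_add_le _ _ t0) _; rewrite lerD2l ler_wpM2l ?sqr_sub_le//.
by rewrite addr_ge0// invr_ge0 ltW.
Qed.

Lemma residual_split (a b x y : R) :
  a - x = (b - y) + ((a - b) - (1 * x + (-1) * y)).
Proof. ring. Qed.

Lemma estimator_arith (a b h4 h h3 V J2 J3 I W W2 W3 : R) :
  0 <= b * (h * W2) -> 0 <= b * (h3 * W3) ->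
  h4 * (a * V + b * (2 * I + 2 * W)) + h * (a * J2 + b * W2) + h3 * (a * J3 + b * W3)
  <= a * (h4 * V + h * J2 + h3 * J3) + b * (2 * (h4 * I) + 2 * (h4 * W + h * W2 + h3 * W3)).
Proof.
move=> h2W h3W; rewrite -subr_ge0; apply: le_trans (addr_ge0 h2W h3W) _.
by rewrite le_eqVlt; apply/orP; left; apply/eqP; ring.
Qed.

Lemma volume_perturb K t : K \in B -> 0 < t ->
  int2 (closed_triangle K) (fun x => residual lhat vhat K x ^+ 2) <=
  (1 + t) * int2 (closed_triangle K) (fun x => residual l v K x ^+ 2) +
  (1 + t^-1) * (2 * int2 (closed_triangle K) (fun x => (lhat * vhat x - l * v x) ^+ 2)
     + 2 * volume_residual w K).
Proof.
move=> KB t0; have K0 := area0 KB; have mK := measurable2_triangle K0.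
have [P1 v1] := piece_polynomial Pv K0 KB; have [P2 v2] := piece_polynomial Pvhat K0 KB.
have s1 := polynomial2_smooth P1; have s2 := polynomial2_smooth P2.
have pw : piece w K = (fun x => 1 * piece vhat K x + (-1) * piece v K x) by exact: (piece_comb 1 (-1) Pvhat Pv K0 KB).
have lw : laplacian (laplacian (piece w K)) = (fun x => 1 * laplacian (laplacian (piece vhat K)) x +
    (-1) * laplacian (laplacian (piece v K)) x).
  by rewrite pw laplacian_comb// laplacian_comb//; exact: laplacian_smooth.
have [f1 c1 e1] := residual_continuous l Pv K0 KB.
have [f2 c2 e2] := residual_continuous lhat Pvhat K0 KB.
have ii (f : fun2 R) : continuous f -> integrable2 (closed_triangle K) (fun x => f x ^+ 2).
  by move=> cf; exact: (@integrable2_triangle _ K (fun x => f x ^+ 2) K0 (continuous_sqr2 cf)).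
have i1 : integrable2 (closed_triangle K) (fun x => residual l v K x ^+ 2).
  by apply: (@eq_integrable2 _ _ (fun x => f1 x ^+ 2) _ mK _ (ii f1 c1)) => x Kx; rewrite e1.
have i2 : integrable2 (closed_triangle K) (fun x => residual lhat vhat K x ^+ 2).
  by apply: (@eq_integrable2 _ _ (fun x => f2 x ^+ 2) _ mK _ (ii f2 c2)) => x Kx; rewrite e2.
have i3 : integrable2 (closed_triangle K) (fun x => (lhat * vhat x - l * v x) ^+ 2).
  apply: (@eq_integrable2 _ _ (fun x => (lhat * piece vhat K x + (- l) * piece v K x) ^+ 2)) => //.
    by move=> x Kx; rewrite v1// v2// mulNr.
  by apply: ii; apply: continuous_comb2; exact: smooth2_continuous.
have i4 : integrable2 (closed_triangle K) (fun x => laplacian (laplacian (piece w K)) x ^+ 2).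
  apply: ii; rewrite lw; apply: continuous_comb2; apply: smooth2_continuous;
    by apply: laplacian_smooth; exact: laplacian_smooth.
rewrite /volume_residual -!int2Z// -int2D//; try exact: integrable2Z.
rewrite -int2Z//; last by apply: integrable2D => //; exact: integrable2Z.
rewrite -int2D//; last 2 first.
- exact: integrable2Z.
- by apply: integrable2Z => //; apply: integrable2D => //; exact: integrable2Z.
apply: int2_le => //.
  apply: integrable2D => //; first exact: integrable2Z.
  by apply: integrable2Z => //; apply: integrable2D => //; exact: integrable2Z.
move=> x Kx; apply: le_trans (sqr_perturb_le _ _ _ t0).
rewrite le_eqVlt; apply/orP; left; apply/eqP; congr (_ ^+ 2).
rewrite lw /residual.
exact: residual_split.
Qed.

Lemma jump_perturb d K t : linear_operator d -> K \in B -> 0 < t ->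
  jump_norm2 B K d vhat <= (1 + t) * jump_norm2 B K d v + (1 + t^-1) * jump_norm2 B K d w.
Proof.
move=> [dc dl] KB t0; have K0 := area0 KB.
have sm z L : piecewise_polynomial p B z -> L \in B -> smooth2 (piece z L).
  move=> Pz LB; apply: (@polynomial2_smooth _ p).
  exact: (piece_polynomial Pz (area0 LB) LB).1.
have dw nu L : L \in B -> d nu (piece w L) = (fun x => 1 * d nu (piece vhat L) x + (-1) * d nu (piece v L) x).
  move=> LB; rewrite -dl; [|exact: sm|exact: sm].
  by congr (d nu); apply: (piece_comb _ _ Pvhat Pv) => //; exact: area0.
rewrite /jump_norm2 !mulr_sumr -big_split /=; apply: ler_sum => E _.
rewrite !mulr_sumr -big_split /= big_seq_cond [leRHS]big_seq_cond.
apply: ler_sum => K' /andP[K'B _].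
have cj z : piecewise_polynomial p B z -> continuous (fun x =>
    (d (normal E) (piece z K) x - d (normal E) (piece z K') x) ^+ 2).
  by move=> Pz; apply: continuous_sqr2 => x; apply: continuousB; apply: dc; exact: sm.
have Pw : piecewise_polynomial p B w by exact: piecewise_polynomial_comb.
rewrite -edge_integral_comb; [|exact: cj|exact: cj].
apply: edge_integral_le; [exact: cj|apply: continuous_comb2; exact: cj|move=> x].
rewrite !dw//; apply: le_trans (sqr_add_le _ _ t0).
rewrite le_eqVlt; apply/orP; left; apply/eqP; congr (_ ^+ 2).
by move: (d _ _ x) (d _ (piece v K) x) (d _ (piece vhat K') x) (d _ (piece v K') x) => a b c e; ring.
Qed.

(** The weights 1 + t and 1 + 1/t separate the estimator of [v] from the perturbation. The latter
    consists of a volume term without derivatives and one with the bilaplacian, hence the factors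
    2. *)
Lemma eta2_perturb K t : K \in B -> 0 < t ->
  eta2 B lhat vhat K <= (1 + t) * eta2 B l v K + (1 + t^-1) *
    (2 * (diam K ^+ 4 * int2 (closed_triangle K) (fun x => (lhat * vhat x - l * v x) ^+ 2))
     + 2 * polynomial_estimator B w K).
Proof.
move=> KB t0.
have V := volume_perturb KB t0.
have J2 := jump_perturb (@normal_deriv2_linear R) KB t0.
have J3 := jump_perturb (@normal_deriv3_linear R) KB t0.
have h0 := diam_ge0 K.
rewrite !eta2E /polynomial_estimator.
have h3 : 0 <= diam K ^+ 3 by exact: exprn_ge0.
have h4 : 0 <= diam K ^+ 4 by exact: exprn_ge0.
have t1 : 0 <= 1 + t^-1 by rewrite addr_ge0// invr_ge0 ltW.
have g2 := jump_norm2_ge0 B K (@normal_deriv2 R) w.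
have g3 := jump_norm2_ge0 B K (@normal_deriv3 R) w.
apply: le_trans (lerD (lerD (ler_wpM2l h4 V) (ler_wpM2l h0 J2)) (ler_wpM2l h3 J3)) _.
have m2 : 0 <= (1 + t^-1) * (diam K * jump_norm2 B K (@normal_deriv2 R) w).
  by rewrite mulr_ge0// mulr_ge0.
have m3 : 0 <= (1 + t^-1) * (diam K ^+ 3 * jump_norm2 B K (@normal_deriv3 R) w).
  by rewrite mulr_ge0// mulr_ge0.
exact: (estimator_arith _ _ _ _ _ _ _ m2 m3).
Qed.

End Perturbation.

(** * Eigenvalues *)

Section Eigenvalues.
Variable R : realType.
Variables (Omega : set (point2 R)).
Hypothesis oO : open Omega.
Implicit Types (v w vhat : fun2 R) (l L : R).

Lemma form_b_sqr v : form_b Omega v v = int2 Omega (fun x => v x ^+ 2).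
Proof. by []. Qed.

(** The eigenvalue equation is tested with the normalised eigenfunction itself. *)
Lemma eigen_energy (W : set (fun2 R)) l v : eigen Omega W l v -> L2_norm Omega v = 1 ->
  energy_norm Omega v ^+ 2 = l /\ int2 Omega (fun x => v x ^+ 2) = 1.
Proof.
move=> [Wv ev] v1; have b1 : form_b Omega v v = 1.
  have b0 : 0 <= form_b Omega v v by rewrite form_b_sqr; apply: int2_ge0 => x _; exact: sqr_ge0.
  by rewrite -[LHS]sqr_sqrtr// [Num.sqrt _]v1 expr1n.
split; last by rewrite -form_b_sqr.
by rewrite sqr_sqrtr ?form_a_ge0// ev// b1 mulr1.
Qed.

Lemma sqr_diff_le (a b e L : R) : 0 <= a -> 0 <= b -> a <= b + e -> b <= a + e ->
  a ^+ 2 <= L -> b ^+ 2 <= L -> (a ^+ 2 - b ^+ 2) ^+ 2 <= 4 * L * e ^+ 2.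
Proof.
move=> a0 b0 ab ba aL bL; rewrite subr_sqr exprMn mulrC.
apply: ler_pM; rewrite ?sqr_ge0//; first by have := sqr_ge0 (a - b); nra.
have h1 : 0 <= e - (a - b) by lra.
have h2 : 0 <= e + (a - b) by lra.
by have := mulr_ge0 h1 h2; nra.
Qed.

(** Both eigenvalues are squared energy norms; their difference factorises into a sum, at most 2
    sqrt(L), and a difference, at most |||w||| by the triangle inequality. *)
Lemma eigenvalue_diff_le (W What : set (fun2 R)) l lhat L v vhat :
  H20 Omega v -> H20 Omega vhat ->
  eigen Omega W l v -> L2_norm Omega v = 1 ->
  eigen Omega What lhat vhat -> L2_norm Omega vhat = 1 -> l <= L -> lhat <= L ->
  (lhat - l) ^+ 2 <= 4 * L * form_a Omega (fun x => 1 * vhat x + (-1) * v x)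
                                 (fun x => 1 * vhat x + (-1) * v x).
Proof.
move=> Hv Hvh ev v1 evh vh1 lL lhL; set w := (fun x => _).
have [<- _] := eigen_energy ev v1; have [<- _] := eigen_energy evh vh1.
have Hw : H20 Omega w by exact: H20_comb.
have <- : energy_norm Omega w ^+ 2 = form_a Omega w w by rewrite sqr_sqrtr// form_a_ge0.
apply: sqr_diff_le; rewrite ?sqrtr_ge0//.
- rewrite [X in energy_norm _ X <= _](_ : vhat = fun x => v x + 1 * w x).
    by apply: energy_comb_le => //; rewrite expr1n.
  by apply/funext => x; rewrite /w; ring.
- rewrite [X in energy_norm _ X <= _](_ : v = fun x => vhat x + (-1) * w x).
    by apply: energy_comb_le => //; rewrite sqrrN expr1n.
  by apply/funext => x; rewrite /w; ring.
- by have [-> _] := eigen_energy evh vh1.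
- by have [-> _] := eigen_energy ev v1.
Qed.

(** The splitting lhat vhat - l v = lhat w - (l - lhat) v leaves the mass of w to the Friedrichs
    inequality. *)
Lemma eigen_residual_le M l lhat v vhat : 0 < M -> Omega `<=` cbox (- M) M (- M) M ->
  H20 Omega v -> H20 Omega vhat ->
  int2 Omega (fun x => (lhat * vhat x - l * v x) ^+ 2) <=
    2 * lhat ^+ 2 * (4 * (4 * M ^+ 2) ^+ 2 *
      form_a Omega (fun x => 1 * vhat x + (-1) * v x) (fun x => 1 * vhat x + (-1) * v x))
    + 2 * (lhat - l) ^+ 2 * int2 Omega (fun x => v x ^+ 2).
Proof.
move=> M0 OM Hv Hvh; set w := (fun x => 1 * vhat x + _).
have Hw : H20 Omega w by exact: H20_comb.
have mO := open_measurable2 oO.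
have L2v : L2 Omega v by case: Hv => -[].
have L2vh : L2 Omega vhat by case: Hvh => -[].
have L2w : L2 Omega w by case: Hw => -[].
have L2e : L2 Omega (fun x => lhat * vhat x - l * v x).
  have -> : (fun x => lhat * vhat x - l * v x) = (fun x => lhat * vhat x + (- l) * v x).
    by apply/funext => x; ring.
  exact: L2_comb.
have iv := L2_integrable_sqr mO L2v; have iw := L2_integrable_sqr mO L2w.
have ie := L2_integrable_sqr mO L2e.
apply: (@le_trans _ _ (2 * lhat ^+ 2 * int2 Omega (fun x => w x ^+ 2) +
    2 * (lhat - l) ^+ 2 * int2 Omega (fun x => v x ^+ 2))); last first.
  have c0 : 0 <= 2 * lhat ^+ 2 by rewrite mulr_ge0// sqr_ge0.
  by rewrite lerD2r ler_wpM2l//; exact: friedrichs.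
rewrite -!int2Z// -int2D//; try exact: integrable2Z.
apply: int2_le => //; first by apply: integrable2D => //; exact: integrable2Z.
move=> x _; have := sqr_sub_le (lhat * w x) ((l - lhat) * v x).
rewrite !exprMn (_ : lhat * w x - (l - lhat) * v x = lhat * vhat x - l * v x); last first.
  by rewrite /w; ring.
by move=> h; apply: le_trans h _; rewrite le_eqVlt; apply/orP; left; apply/eqP; ring.
Qed.

(** The weight h^4 is the squared area, bounded by that of the initial triangles; [e] vanishes
    outside [Omega], so that boundary points of closed triangles do no harm. *)
Lemma sum_mass_le (B : {fset triangle R}) (amax : R) (e : fun2 R) :
  regular_triangulation Omega B -> 0 <= amax ->
  (forall K, K \in B -> area K <= amax) -> L2 Omega e -> (forall x, ~ Omega x -> e x = 0) ->
  \sum_(K <- B) diam K ^+ 4 * int2 (closed_triangle K) (fun x => e x ^+ 2)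
    <= amax ^+ 2 * int2 Omega (fun x => e x ^+ 2).
Proof.
move=> regB a0 aB L2e e0; have mO := open_measurable2 oO.
have out x : ~ Omega x -> e x ^+ 2 = 0 by move=> /e0 ->; rewrite expr0n.
have iT : integrable2 setT (fun x => e x ^+ 2).
  have := (integrable2_mkcond (fun x => e x ^+ 2) mO).1 (L2_integrable_sqr mO L2e).
  apply: eq_integrable2; first exact: measurableT.
  move=> x _; rewrite patchE; case: ifPn => // xO; rewrite out// => Ox.
  by move/negP: xO; apply; rewrite mem_set.
rewrite int2_supp//.
apply: (@le_trans _ _ (amax ^+ 2 * \sum_(K <- B) int2 (closed_triangle K) (fun x => e x ^+ 2))).
  rewrite mulr_sumr big_seq [leRHS]big_seq; apply: ler_sum => K KB.
  rewrite -area_diam4 ler_wpM2r//; first by apply: int2_ge0 => x _; exact: sqr_ge0.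
  by apply: lerXn2r; rewrite ?nnegrE ?area_ge0//; exact: aB.
rewrite ler_wpM2l ?sqr_ge0//; apply: int2_sum_triangles => //.
- exact: fset_uniq.
- by move=> K; exact: (regular_area regB).
- by move=> K K' KB KB' KK; exact: (regular_null regB).
- exact: measurableT.
- by move=> x _; exact: sqr_ge0.
Qed.

Lemma bounded_sub_cbox : bounded_set Omega ->
  exists2 M : R, 0 < M & Omega `<=` cbox (- M) M (- M) M.
Proof.
move=> /(ex_strict_bound_gt0) [M M0 HM]; exists M => // x Ox.
have := HM x Ox; rewrite /= prod_normE gt_max /= => /andP[/ltW h1 /ltW h2].
by move: h1 h2; rewrite !ler_norml.
Qed.

(** The two squared norms in [LB] are nonnegative, so lamh - lam_j is below 1/2. *)
Lemma closeness_upper (W : set (fun2 R)) j (lam : nat -> R) (u : fun2 R) l v :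
  closeness Omega W j lam u -> discrete_eigenpair Omega W u j l v -> l <= `|lam j| + 1.
Proof.
move=> cl dp; have := cl _ _ dp; rewrite /LB => h.
have := sqr_ge0 (energy_norm Omega (u \- v)); have := sqr_ge0 (L2_norm Omega (u \- v)).
have := ler_norm (lam j); lra.
Qed.

End Eigenvalues.

(** * Constants of the initial triangulation *)

Section Constants.
Variable R : realType.
Implicit Types (Tinit : {fset triangle R}).

Lemma shape_constant Tinit : (forall T, T \in Tinit -> 0 < area T) ->
  exists2 kap : R, 0 < kap & forall T, T \in Tinit -> shape_sum T <= kap * area T.
Proof.
move=> T0; have p0 T : 0 <= `|shape_sum T| / area T by rewrite divr_ge0// area_ge0.
exists (1 + \sum_(T <- Tinit) `|shape_sum T| / area T).
  by rewrite ltr_wpDr// sumr_ge0.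
move=> T TT; have aT := T0 T TT.
apply: (@le_trans _ _ ((`|shape_sum T| / area T) * area T)).
  by rewrite divfK ?gt_eqF// ler_norm.
rewrite ler_pM2r// (big_rem T)//= addrCA lerDl addr_ge0// sumr_ge0//.
Qed.

Lemma area_constant Tinit : exists2 amax : R, 0 <= amax &
  forall T, T \in Tinit -> area T <= amax.
Proof.
exists (\sum_(T <- Tinit) area T); first by rewrite sumr_ge0// => T _; exact: area_ge0.
move=> T TT; rewrite (big_rem T)//= lerDl sumr_ge0// => K _; exact: area_ge0.
Qed.

(** Every fine triangle is contained in a coarse one and inherits its diameter bound; the properties
    assumed for small mesh sizes thus hold on the refinement, too. *)
Lemma fine_refinement Omega Tinit delta (T That : {fset triangle R}) :
  fine_triangulations Omega Tinit delta T -> triangulations Omega Tinit That ->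
  nvb_refinement T That -> fine_triangulations Omega Tinit delta That.
Proof.
move=> [_ fT] tT ref; split => // K KT x y Kx Ky.
have [T0 [TT KT0 _]] := nvb_ancestor ref KT.
by apply: (fT T0 TT); exact: KT0.
Qed.

End Constants.

(** * Proof of the reduction *)

Section Reduction.
Variable R : realType.

Lemma sum_fset_sub (A B : {fset triangle R}) (F : triangle R -> R) : (forall K, 0 <= F K) ->
  \sum_(K <- (B `\` A)%fset) F K <= \sum_(K <- B) F K.
Proof.
move=> F0; apply: sum_subset => // K.
by rewrite in_fsetD => /andP[].
Qed.

(** The perturbation is estimated over all fine triangles, the reduction over the new ones only; the
    optimisation in t then leaves 2^(-1/4) intact. *)
Lemma eta_reduction (Omega : set (point2 R)) (A B : {fset triangle R}) p
    (v vhat : fun2 R) (l lhat E : R) :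
  regular_triangulation Omega A -> regular_triangulation Omega B -> nvb_refinement A B ->
  piecewise_polynomial p A v -> piecewise_polynomial p B vhat ->
  \sum_(K <- B) diam K ^+ 4 *
     int2 (closed_triangle K) (fun x => (lhat * vhat x - l * v x) ^+ 2)
   + \sum_(K <- B) polynomial_estimator B (fun x => 1 * vhat x + (-1) * v x) K <= E ->
  eta B lhat vhat (B `\` A)%fset
    <= 2 `^ (- (1 / 4)) * eta A l v (A `\` B)%fset + Num.sqrt (2 * E).
Proof.
move=> regA regB AB Pv Pvhat EE; set c := 2 `^ _.
have c0 : 0 <= c by exact: powR_ge0.
have S0 : 0 <= \sum_(T <- (A `\` B)%fset) eta2 A l v T.
  by apply: sumr_ge0 => T _; exact: eta2_ge0.
have PvB := piecewise_polynomial_nvb AB Pv.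
have D0 K : 0 <= diam K ^+ 4 * int2 (closed_triangle K) (fun x => (lhat * vhat x - l * v x) ^+ 2).
  by rewrite mulr_ge0 ?exprn_ge0 ?diam_ge0//; apply: int2_ge0 => x _; exact: sqr_ge0.
have P0 K : 0 <= polynomial_estimator B (fun x => 1 * vhat x + (-1) * v x) K.
  exact: polynomial_estimator_ge0.
have E0 : 0 <= 2 * E by rewrite mulr_ge0//; apply: le_trans EE; rewrite addr_ge0 ?sumr_ge0.
rewrite /eta; have -> : c * Num.sqrt (\sum_(T <- (A `\` B)%fset) eta2 A l v T) =
    Num.sqrt (c ^+ 2 * \sum_(T <- (A `\` B)%fset) eta2 A l v T).
  by rewrite sqrtrM ?sqr_ge0// sqrtr_sqr ger0_norm.
apply: sqrt_le_add => //; first by rewrite mulr_ge0// sqr_ge0.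
move=> t t0; have t1 : 0 <= 1 + t by rewrite addr_ge0// ltW.
have t2 : 0 <= 1 + t^-1 by rewrite addr_ge0// invr_ge0 ltW.
pose G K := 2 * (diam K ^+ 4 * int2 (closed_triangle K) (fun x => (lhat * vhat x - l * v x) ^+ 2))
   + 2 * polynomial_estimator B (fun x => 1 * vhat x + (-1) * v x) K.
have G0 K : 0 <= G K by rewrite addr_ge0// mulr_ge0.
apply: (@le_trans _ _ (\sum_(K <- (B `\` A)%fset) ((1 + t) * eta2 B l v K + (1 + t^-1) * G K))).
  rewrite big_seq [leRHS]big_seq; apply: ler_sum => K; rewrite in_fsetD => /andP[_ KB].
  exact: (eta2_perturb regB l lhat PvB Pvhat KB t0).
rewrite big_split /= -!mulr_sumr; apply: lerD; rewrite ler_wpM2l//.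
  exact: (eta2_refinement regA regB AB Pv l).
apply: le_trans (sum_fset_sub _ _ G0) _; rewrite /G big_split /= -!mulr_sumr -mulrDr.
by rewrite ler_wpM2l.
Qed.

Lemma eigen_term_arith (a b d K F L : R) : 0 <= K * F -> a <= b -> d <= 4 * L * F ->
  2 * a * (K * F) + 2 * d * 1 <= (2 * b * K + 8 * L) * F.
Proof.
move=> KF ab dF; have := ler_wpM2r KF ab.
rewrite (_ : (2 * b * K + 8 * L) * F = 2 * (b * (K * F)) + 2 * (4 * L * F)); last by ring.
by rewrite -mulrA mulr1; lra.
Qed.

End Reduction.

Theorem mainTheorem5 (R : realType) (Omega : set (R * R))
    (hOmega : polygonal_lipschitz_domain Omega)
    (Tinit : {fset triangle R}) (hTinit : regular_triangulation Omega Tinit)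
    (p : nat) (hp : (5 <= p)%N)
    (lam : nat -> R) (hlam : spectrum Omega lam)
    (j : nat) (hj : (0 < j)%N) (hsimple : simple_eigenvalue lam j)
    (u : R * R -> R) (hu : eigen Omega (H20 Omega) (lam j) u)
    (hu1 : L2_norm Omega u = 1)
    (delta2 Lqo Lsep : R)
    (hdelta2 : 0 < delta2) (hLqo : 0 < Lqo) (hLsep : 0 < Lsep)
    (hprop : forall T, fine_triangulations Omega Tinit delta2 T ->
       let W := hierarchical_argyris Omega p Tinit T in
       [/\ quasi_optimality Omega W j lam u Lqo,
           closeness Omega W j lam u,
           separation Omega W j lam &
           separation_bound Omega W j lam Lsep]) :
  exists2 L2c : R, 0 < L2c &
    forall T That : {fset triangle R},
      fine_triangulations Omega Tinit delta2 T ->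
      triangulations Omega Tinit That -> nvb_refinement T That ->
    forall (lamh : R) (uh : R * R -> R) (lamhat : R) (uhat : R * R -> R),
      discrete_eigenpair Omega (hierarchical_argyris Omega p Tinit T)
        u j lamh uh ->
      discrete_eigenpair Omega (hierarchical_argyris Omega p Tinit That)
        u j lamhat uhat ->
      eta That lamhat uhat (That `\` T)%fset
        <= 2 `^ (- (1 / 4)) * eta T lamh uh (T `\` That)%fset
           + L2c * energy_norm Omega (uhat \- uh).
Proof.
have [[_ oO] _ bO lip _] := hOmega.
have [M M0 OM] := bounded_sub_cbox bO.
have [kap kap0 shK] := shape_constant (regular_area hTinit).
have [amax a0 aK] := area_constant Tinit.
have [C C0 HC] := polynomial_estimator_bound p kap0.
(* A common upper bound of both discrete eigenvalues, independent of the triangulations. *)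
pose L := `|lam j| + 1; have L0 : 0 < L by rewrite ltr_wpDl.
(* The first summand is the Friedrichs constant times 2 [L]^2, the second twice the 4 [L] from the
   difference of the eigenvalues; amax^2 bounds the weight h^4. *)
pose CE := amax ^+ 2 * (2 * L ^+ 2 * (4 * (4 * M ^+ 2) ^+ 2) + 8 * L).
have CE0 : 0 <= CE.
  apply: mulr_ge0; first exact: sqr_ge0.
  apply: addr_ge0; last by rewrite mulr_ge0// ltW.
  by apply: mulr_ge0; apply: mulr_ge0 => //; exact: sqr_ge0.
have Cp : 0 < 2 * (CE + C) by rewrite mulr_gt0// ltr_wpDl.
(* The 2 stems from separating the eigenvalue residual, bounded by [CE], from the polynomial
   estimator, bounded by [C]. *)
exists (Num.sqrt (2 * (CE + C))); first by rewrite sqrtr_gt0.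
move=> T That fT tTh ref lamh uh lamhat uhat dp dph.
have fTh := fine_refinement fT tTh ref.
have [_ cl _ _] := hprop T fT; have [_ clh _ _] := hprop That fTh.
have lL := closeness_upper cl dp; have lhL := closeness_upper clh dph.
rewrite -/L in lL lhL.
have [[nT regT] _] := fT; have [nTh regTh] := tTh.
have [N [lams [_ _ _ ev [uh1 _]]]] := dp.
have [Nh [lamsh [_ _ _ evh [uhat1 _]]]] := dph.
have [Hv Pv] := hierarchical_argyrisP oO ev.1.
have [Hvh Pvh] := hierarchical_argyrisP oO evh.1.
set w := uhat \- uh.
have wE : w = (fun x => 1 * uhat x + (-1) * uh x).
  by apply/funext => x; rewrite /w /= mul1r mulN1r.
have F0 := form_a_ge0 Omega w.
rewrite /energy_norm -sqrtrM; last exact: ltW.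
rewrite -mulrA; apply: (eta_reduction regT regTh ref Pv Pvh).
have PvB := piecewise_polynomial_nvb ref Pv.
rewrite mulrDl; apply: lerD; last first.
  rewrite wE; apply: HC => //.
  - exact: nvb_shape nTh shK.
  - by case: (H20_comb oO 1 (-1) Hvh Hv).
  - exact: piecewise_polynomial_comb.
have [_ uhI] := eigen_energy ev uh1.
have [lamE _] := eigen_energy evh uhat1.
have lam0 : 0 <= lamhat by rewrite -lamE sqr_ge0.
have dl := eigenvalue_diff_le oO Hv Hvh ev uh1 evh uhat1 lL lhL.
have res := eigen_residual_le oO lamh lamhat M0 OM Hv Hvh.
rewrite -wE in dl; rewrite -wE uhI in res.
have He : H20 Omega (fun x => lamhat * uhat x + (- lamh) * uh x) by exact: H20_comb.
have eE : (fun x => lamhat * uhat x - lamh * uh x) = (fun x => lamhat * uhat x + (- lamh) * uh x).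
  by apply/funext => x; rewrite mulNr.
have [[L2e _] e0 _] := He; rewrite -eE in L2e.
have {}e0 x : ~ Omega x -> lamhat * uhat x - lamh * uh x = 0 by rewrite -mulNr; exact: e0.
apply: le_trans (sum_mass_le oO regTh a0 (nvb_area nTh aK) L2e e0) _.
rewrite /CE -[leRHS]mulrA ler_wpM2l ?sqr_ge0//; apply: le_trans res _.
have lsq : lamhat ^+ 2 <= L ^+ 2 by apply: lerXn2r; rewrite ?nnegrE ?(ltW L0).
apply: eigen_term_arith => //.
by rewrite mulr_ge0// mulr_ge0// sqr_ge0.
Qed.
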